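(* Let $n\geqslant 3$ and let $\varLambda_n:D(\varLambda_n)\subset Y\to Y$ be the unbounded linear operator with $$D(\varLambda_n)=X^1\times X^{\frac{n-1}{n}}\times X^{\frac{n-2}{n}}\times\cdots\times X^{\frac1n},\qquad \varLambda_n\,(v_1,v_2,\ldots,v_{n-1},v_n)^{T}=(-v_2,-v_3,\ldots,-v_n,\,Av_1)^{T}.$$ Then all of the following hold. (i) $0\in\rho(\varLambda_n)$ and $$\varLambda_n^{-1}=\begin{bmatrix}0&0&0&\cdots&0&A^{-1}\\-I&0&0&\cdots&0&0\\0&-I&0&\cdots&0&0\\\vdots&\vdots&\vdots&\ddots&\vdots&\vdots\\0&0&0&\cdots&0&0\\0&0&0&\cdots&-I&0\end{bmatrix},$$ that is, $\varLambda_n^{-1}(\varphi_1,\ldots,\varphi_n)^T=(A^{-1}\varphi_n,-\varphi_1,-\varphi_2,\ldots,-\varphi_{n-1})^T$. Moreover, if $A$ has compact resolvent on $X$, then $\varLambda_n$ has compact resolvent on $Y$. (ii) Fractional powers $\varLambda_n^\alpha$ can be defined for $0<\alpha<1$ by $$\varLambda_n^\alpha=\frac{\sin(\alpha\pi)}{\pi}\int_0^\infty\lambda^{\alpha-1}\varLambda_n(\lambda I+\varLambda_n)^{-1}\,d\lambda,$$ where the identity is understood as acting on elements of $D(\varLambda_n)$. (iii) For every $0\leqslant\alpha\leqslant1$, the operator $\varLambda_n^\alpha:D(\varLambda_n^\alpha)\subset Y\to Y$ has domain $$D(\varLambda_n^\alpha)=X^{\frac{\alpha+n-1}{n}}\times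 X^{\frac{\alpha+n-2}{n}}\times X^{\frac{\alpha+n-3}{n}}\times\cdots\times X^{\frac{\alpha}{n}}$$ and is given by the $n\times n$ operator matrix $$\varLambda_n^\alpha=\left[\frac{(-1)^{i-j}}{n}\,U_{n-1}\!\left(\cos\left(\frac{(\alpha+i-j)\pi}{n}\right)\right)A^{\frac{\alpha+i-j}{n}}\right]_{1\leqslant i,j\leqslant n},$$ where $U_{n-1}$ is the Chebyshev polynomial of the second kind of degree $n-1$.
   Context: $X$ is a separable complex Hilbert space and $A:D(A)\subset X\to X$ is an unbounded, closed, densely defined, self-adjoint and positive definite linear operator; there is $\lambda_0>0$ with $\mathrm{Re}\,\lambda>\lambda_0$ for all $\lambda\in\sigma(A)$. For $0<\alpha<1$, $A^\alpha$ is the fractional power of $A$ (the usual closed operator, given by Balakrishnan's formula $A^\alpha=\frac{\sin(\alpha\pi)}{\pi}\int_0^\infty\lambda^{\alpha-1}A(\lambda I+A)^{-1}\,d\lambda$, equivalently by the spectral theorem), with $A^0=I$, $A^1=A$, and $A^{-\beta}=(A^\beta)^{-1}$ for $\beta>0$. For $0\leqslant\alpha\leqslant1$, $X^\alpha:=D(A^\alpha)$ with norm $\|x\|_{X^\alpha}=\|A^\alpha x\|_X$, and $X^0=X$. The phase space is $Y=X^{\frac{n-1}{n}}\times X^{\frac{n-2}{n}}\times\cdots\times X^{\frac1n}\times X$ (the $i$-th factor is $X^{\frac{n-i}{n}}$, $1\leqslant i\leqslant n$), with norm given by $\|(v_1,\ldots,v_n)\|_Y^2=\sum_{i=1}^n\|v_i\|^2_{X^{\frac{n-i}{n}}}$.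 For $0<\alpha<1$, $\varLambda_n^\alpha$ is the fractional power in the usual sense for operators of positive type: the closed operator $\varLambda_n^\alpha=(\varLambda_n^{-\alpha})^{-1}$, where $\varLambda_n^{-\alpha}=\frac{\sin(\alpha\pi)}{\pi}\int_0^\infty\lambda^{-\alpha}(\lambda I+\varLambda_n)^{-1}\,d\lambda$ is a bounded injective operator on $Y$; also $\varLambda_n^0=I$ and $\varLambda_n^1=\varLambda_n$. The Chebyshev polynomials of the second kind $U_m:\mathbb{C}\to\mathbb{C}$ are defined by $U_0(x)=1$, $U_1(x)=2x$, $U_2(x)=4x^2-1$, $U_3(x)=8x^3-4x$, and $U_{m+1}(x)=2xU_m(x)-U_{m-1}(x)$ for $x\in\mathbb{C}$ and $m\geqslant3$. *)

(* Defs.v *)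
From Stdlib Require Import Reals Lra Lia ZArith.
From Stdlib Require Import Classical ClassicalEpsilon ProofIrrelevance FunctionalExtensionality.
From mathcomp Require Import all_boot.
From Coquelicot Require Import Coquelicot.

Set Implicit Arguments.
Unset Strict Implicit.
Unset Printing Implicit Defensive.
Local Open Scope R_scope.

Section NormedBuild.
Variables (K : AbsRing) (V : ModuleSpace K) (N : V -> R).
Hypothesis Ntri : forall x y, N (plus x y) <= N x + N y.
Hypothesis Nscal : forall (l : K) x, N (scal l x) <= abs l * N x.
Hypothesis Ndef : forall x, N x = 0 -> x = zero.

Lemma norm0_build : N zero = 0.
Proof.
have h := Nscal zero zero.
rewrite scal_zero_l abs_zero Rmult_0_l in h.
have := Ntri zero zero; rewrite plus_zero_l; lra.
Qed.

Lemma normN_build x : N (opp x) = N x.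
Proof.
have hle : forall y, N (opp y) <= N y.
  by move=> y; have := Nscal (opp one) y; rewrite scal_opp_one abs_opp_one Rmult_1_l.
by apply: Rle_antisym => //; rewrite -{1}(opp_opp x).
Qed.

Definition ball_build (x : V) (e : R) (y : V) : Prop := N (minus y x) < e.

Lemma ball_build_center x (e : posreal) : ball_build x e x.
Proof. by rewrite /ball_build minus_eq_zero norm0_build; case: e. Qed.

Lemma ball_build_sym x y e : ball_build x e y -> ball_build y e x.
Proof. by rewrite /ball_build -(normN_build (minus x y)) opp_minus. Qed.

Lemma ball_build_triangle x y z e1 e2 :
  ball_build x e1 y -> ball_build y e2 z -> ball_build x (e1 + e2) z.
Proof.
rewrite /ball_build (minus_trans y z x) => h1 h2.
apply: Rle_lt_trans (Ntri _ _) _; lra.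
Qed.

Definition build_aux : NormedModuleAux K :=
  NormedModuleAux.Pack K V
    (NormedModuleAux.Class K V (ModuleSpace.class K V)
       (UniformSpace.Mixin V zero ball_build
          ball_build_center ball_build_sym ball_build_triangle)) V.

Definition build_mixin : NormedModule.mixin_of K build_aux.
Proof.
refine (NormedModule.Mixin K build_aux N 1 Ntri Nscal _ _ Ndef).
- by [].
- by move=> x y e; rewrite Rmult_1_l.
Defined.

Definition build_normed : NormedModule K :=
  NormedModule.Pack K V
    (NormedModule.Class K V (NormedModuleAux.class K build_aux) build_mixin) V.
End NormedBuild.

(** A complex normed module seen as a real one: same points, norm and topology. *)
Section Realify.
Variable V : NormedModule C_AbsRing.

Definition real_scal (r : R_AbsRing) (x : V) : V := scal (RtoC r : C_AbsRing) x.

Definition real_module_mixin : ModuleSpace.mixin_of R_Ring (NormedModule.AbelianGroup _ V).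
Proof.
refine (ModuleSpace.Mixin R_Ring (NormedModule.AbelianGroup _ V) real_scal _ _ _ _).
- move=> x y u; rewrite /real_scal scal_assoc; congr scal.
  by rewrite /mult /= RtoC_mult.
- by move=> u; apply: scal_one.
- by move=> x u v; apply: scal_distr_l.
- move=> x y u; rewrite /real_scal -scal_distr_r; congr scal.
  by rewrite /plus /= RtoC_plus.
Defined.

Definition real_aux : NormedModuleAux R_AbsRing :=
  NormedModuleAux.Pack R_AbsRing V
    (NormedModuleAux.Class R_AbsRing V
       (ModuleSpace.Class R_Ring V
          (AbelianGroup.class (NormedModule.AbelianGroup _ V)) real_module_mixin)
       (UniformSpace.class (NormedModule.UniformSpace _ V))) V.

Definition real_mixin : NormedModule.mixin_of R_AbsRing real_aux.
Proof.
refine (NormedModule.Mixin R_AbsRing real_aux (@norm _ V) (@norm_factor _ V) _ _ _ _ _).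
- exact: (@norm_triangle _ V).
- move=> l x; have := @norm_scal _ V (RtoC l) x.
  by rewrite /abs /= Cmod_R.
- exact: (@norm_compat1 _ V).
- exact: (@norm_compat2 _ V).
- exact: (@norm_eq_zero _ V).
Defined.

Definition realify : NormedModule R_AbsRing :=
  NormedModule.Pack R_AbsRing V
    (NormedModule.Class R_AbsRing V (NormedModuleAux.class R_AbsRing real_aux) real_mixin) V.
End Realify.

Section L2Product.
Variables (K : AbsRing) (n : nat) (F : 'I_n -> NormedModule K).

Definition prod_car : Type := forall i, F i.

Definition prod_group_mixin0 : AbelianMonoid.mixin_of prod_car.
Proof.
refine (AbelianMonoid.Mixin prod_car (fun u v i => plus (u i) (v i)) (fun i => zero) _ _ _).
- by move=> u v; apply: functional_extensionality_dep => i; apply: plus_comm.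
- by move=> u v w; apply: functional_extensionality_dep => i; apply: plus_assoc.
- by move=> u; apply: functional_extensionality_dep => i; apply: plus_zero_r.
Defined.

Definition prod_monoid := AbelianMonoid.Pack prod_car prod_group_mixin0 prod_car.

Definition prod_group_mixin : AbelianGroup.mixin_of prod_monoid.
Proof.
refine (AbelianGroup.Mixin prod_monoid (fun u i => opp (u i)) _).
by move=> u; apply: functional_extensionality_dep => i; apply: plus_opp_r.
Defined.

Definition prod_group : AbelianGroup :=
  AbelianGroup.Pack prod_car (AbelianGroup.Class prod_car _ prod_group_mixin) prod_car.

Definition prod_module_mixin : ModuleSpace.mixin_of K prod_group.
Proof.
refine (ModuleSpace.Mixin K prod_group (fun l u i => scal l (u i)) _ _ _ _).
- by move=> x y u; apply: functional_extensionality_dep => i; apply: scal_assoc.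
- by move=> u; apply: functional_extensionality_dep => i; apply: scal_one.
- by move=> x u v; apply: functional_extensionality_dep => i; apply: scal_distr_l.
- by move=> x y u; apply: functional_extensionality_dep => i; apply: scal_distr_r.
Defined.

Definition prod_module : ModuleSpace K :=
  ModuleSpace.Pack K prod_car (ModuleSpace.Class K prod_car _ prod_module_mixin) prod_car.

Definition l2 (m : nat) (a : 'I_m -> R) : R := sqrt (\big[Rplus/0]_(i < m) (a i) ^ 2).

Lemma sumsq_ge0 m (a : 'I_m -> R) : 0 <= \big[Rplus/0]_(i < m) (a i) ^ 2.
Proof. by apply: big_ind; [lra | move=> x y; lra | move=> i _; apply: pow2_ge_0]. Qed.

Lemma l2_recl m (a : 'I_m.+1 -> R) :
  l2 a = Cmod (a ord0, l2 (fun i => a (lift ord0 i))).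
Proof.
rewrite /l2 /Cmod big_ord_recl; congr sqrt.
rewrite [X in _ = _ + X](_ : _ = \big[Rplus/0]_(i < m) (a (lift ord0 i)) ^ 2) //=.
have := sumsq_ge0 (fun i => a (lift ord0 i)) => /= h.
by rewrite Rmult_1_r sqrt_sqrt.
Qed.

Lemma l2_ge0 m (a : 'I_m -> R) : 0 <= l2 a.
Proof. exact: sqrt_pos. Qed.

Lemma l2_le m (a b : 'I_m -> R) : (forall i, 0 <= a i <= b i) -> l2 a <= l2 b.
Proof.
elim: m a b => [|m ih] a b h; first by rewrite /l2 !big_ord0; lra.
rewrite !l2_recl /Cmod; apply: sqrt_le_1_alt => /=.
have h1 := ih (fun i => a (lift ord0 i)) (fun i => b (lift ord0 i)) (fun i => h (lift ord0 i)).
have h2 := l2_ge0 (fun i : 'I_m => a (lift ord0 i)).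
have [h3 h4] := h ord0.
by rewrite !Rmult_1_r; apply: Rplus_le_compat; apply: Rmult_le_compat.
Qed.

Lemma l2_triangle m (a b : 'I_m -> R) : l2 (fun i => a i + b i) <= l2 a + l2 b.
Proof.
elim: m a b => [|m ih] a b; first by rewrite /l2 !big_ord0 sqrt_0; lra.
rewrite !l2_recl.
set a' := fun i => a (lift ord0 i); set b' := fun i => b (lift ord0 i).
apply: Rle_trans (Cmod_triangle (a ord0, l2 a') (b ord0, l2 b')).
rewrite /Cmod; apply: sqrt_le_1_alt => /=.
have h1 := ih a' b'.
have h2 := l2_ge0 (fun i => a' i + b' i).
move: h1 h2; rewrite /a' /b' /=; set p := l2 _; set q := l2 _; set r := l2 _ => h1 h2.
nra.
Qed.

Lemma l2_scal m (c : R) (a : 'I_m -> R) : 0 <= c -> l2 (fun i => c * a i) = c * l2 a.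
Proof.
move=> hc; elim: m a => [|m ih] a; first by rewrite /l2 !big_ord0 sqrt_0; lra.
rewrite !l2_recl (ih (fun i => a (lift ord0 i))).
set t := l2 _.
have -> : (c * a ord0, c * t) = Cmult (RtoC c) (a ord0, t).
  by rewrite /Cmult /=; congr pair; ring.
by rewrite Cmod_mult Cmod_R Rabs_pos_eq.
Qed.

Lemma l2_eq0 m (a : 'I_m -> R) : l2 a = 0 -> forall i, a i = 0.
Proof.
elim: m a => [|m ih] a h; first by case.
move: h; rewrite l2_recl => /Cmod_eq_0 [h0 h1] i.
by case: (unliftP ord0 i) => [j|] -> //; apply: (ih _ h1 j).
Qed.

Definition prod_norm (u : prod_module) : R := l2 (fun i => norm (u i : F i)).

Lemma prod_norm_triangle u v : prod_norm (plus u v) <= prod_norm u + prod_norm v.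
Proof.
apply: Rle_trans (l2_triangle _ _); apply: l2_le => i; split; first exact: norm_ge_0.
exact: norm_triangle.
Qed.

Lemma prod_norm_scal (l : K) u : prod_norm (scal l u) <= abs l * prod_norm u.
Proof.
rewrite -l2_scal; last exact: abs_ge_0.
apply: l2_le => i; split; first exact: norm_ge_0.
exact: norm_scal.
Qed.

Lemma prod_norm_def u : prod_norm u = 0 -> u = zero.
Proof.
move=> /l2_eq0 h; apply: functional_extensionality_dep => i.
exact: norm_eq_zero (h i).
Qed.

Definition l2_prod : NormedModule K :=
  build_normed prod_norm_triangle prod_norm_scal prod_norm_def.
End L2Product.

(** Possibly unbounded, partially defined operators are identified with their graphs. *)
Definition operator (V : Type) := V -> V -> Prop.

Section OperatorAlgebra.
Variable V : ModuleSpace C_Ring.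
Implicit Types S T : operator V.

Definition dom T (x : V) : Prop := exists y, T x y.
Definition op_eq S T : Prop := forall x y, S x y <-> T x y.
Definition op_fun (R : V -> V) : operator V := fun x y => y = R x.
Definition op_id : operator V := fun x y => y = x.
Definition op_zero : operator V := fun _ y => y = zero.
Definition op_inv T : operator V := fun x y => T y x.
Definition op_comp S T : operator V := fun x z => exists y, T x y /\ S y z.
Definition op_plus S T : operator V :=
  fun x y => exists u v, S x u /\ T x v /\ y = plus u v.
Definition op_scal (c : C) T : operator V := fun x y => exists u, T x u /\ y = scal c u.
Definition op_restrict (D : V -> Prop) T : operator V := fun x y => D x /\ T x y.

Record linear_op T : Prop := LinearOp {
  linear_op_fun : forall x y y', T x y -> T x y' -> y = y';
  linear_op_zero : T zero zero;
  linear_op_plus : forall x y x' y', T x y -> T x' y' -> T (plus x x') (plus y y');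
  linear_op_scal : forall (c : C) x y, T x y -> T (scal c x) (scal c y)
}.

Definition injective_op T : Prop := forall x x' y, T x y -> T x' y -> x = x'.

(** The operator matrix [M i j], on its natural domain. *)
Definition op_matrix (n : nat) (M : 'I_n -> 'I_n -> operator V) (v w : 'I_n -> V) : Prop :=
  exists z : 'I_n -> 'I_n -> V,
    (forall i j, M i j (v j) (z i j)) /\
    (forall i, w i = \big[plus/zero]_(j < n) z i j).
End OperatorAlgebra.

Arguments op_id {V}.
Arguments op_zero {V}.

Section OperatorTopology.
Variable V : NormedModule C_AbsRing.
Implicit Types T : operator V.

Definition closed_op T : Prop :=
  closed (fun p : prod_UniformSpace V V => T p.1 p.2).

Definition dense (D : V -> Prop) : Prop :=
  forall (x : V) (eps : posreal), exists y, D y /\ ball x eps y.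

Definition op_closure T : operator V := fun x y =>
  forall eps : posreal, exists x' y', T x' y' /\ ball x eps x' /\ ball y eps y'.

(** Everywhere defined and bounded; [is_linear] includes boundedness. *)
Definition bounded_op T : Prop :=
  exists R : V -> V, is_linear R /\ op_eq T (op_fun R).

Definition compact_op T : Prop :=
  exists R : V -> V, is_linear R /\ op_eq T (op_fun R) /\
    forall u : nat -> V, (exists M, forall k, norm (u k) <= M) ->
    exists (phi : nat -> nat) (y : V), (forall k, (phi k < phi k.+1)%N) /\
      filterlim (fun k => R (u (phi k))) eventually (locally y).

Definition resolvent T (l : C) : operator V :=
  op_inv (op_plus (op_scal l op_id) (op_scal (RtoC (-1)) T)).

Definition resolvent_set T (l : C) : Prop := bounded_op (resolvent T l).

Definition spectrum T (l : C) : Prop := ~ resolvent_set T l.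

(** By the resolvent identity, compactness at one point of the resolvent set is
    compactness at every point. *)
Definition compact_resolvent T : Prop :=
  exists l : C, resolvent_set T l /\ compact_op (resolvent T l).

Definition shift_inv T (l : R) : operator V :=
  op_inv (op_plus (op_scal (RtoC l) op_id) T).

Record positive_type T : Prop := PositiveType {
  positive_type_linear : linear_op T;
  positive_type_closed : closed_op T;
  positive_type_dense : dense (dom T);
  positive_type_resolvent : forall l, 0 <= l -> bounded_op (shift_inv T l);
  positive_type_bound : exists M, forall l x y, 0 <= l ->
    shift_inv T l x y -> (1 + l) * norm y <= M * norm x
}.

(** [x |-> int_0^oo w(l) K(l) x dl], as an improper Riemann integral in the norm of [V]. *)
Definition op_integral (w : R -> R) (K : R -> operator V) : operator V := fun x y =>
  exists f : R -> V, (forall l, 0 < l -> K l x (f l)) /\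
    @is_RInt_gen (realify V) (fun l => scal (RtoC (w l) : C_AbsRing) (f l))
      (at_right 0) (Rbar_locally p_infty) y.

Definition balakrishnan T (a : R) : operator V :=
  op_scal (RtoC (sin (a * PI) / PI))
    (op_integral (fun l => Rpower l (a - 1)) (fun l => op_comp T (shift_inv T l))).

Definition neg_power T (a : R) : operator V :=
  op_scal (RtoC (sin (a * PI) / PI))
    (op_integral (fun l => Rpower l (- a)) (shift_inv T)).

(** [T^a] for [T] of positive type and [0 <= a <= 1]. *)
Definition positive_power T (a : R) : operator V :=
  if Req_EM_T a 0 then op_id
  else if Req_EM_T a 1 then T
  else op_inv (neg_power T a).

(** [A^a]: Balakrishnan's formula gives it on [D(A)], and [A^a] is the closed
    operator so obtained.  Only exponents [0 <= a <= 1] occur; others are clamped. *)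
Definition frac_power0 A (a : R) : operator V :=
  if Rle_dec a 0 then op_id
  else if Rle_dec 1 a then A
  else op_closure (op_restrict (dom A) (balakrishnan A a)).

(** With [A^(-b) = (A^b)^-1]. *)
Definition frac_power A (a : R) : operator V :=
  if Rle_dec 0 a then frac_power0 A a else op_inv (frac_power0 A (- a)).
End OperatorTopology.

(** [D(T)] with the norm [||x|| = ||T x||], for an injective linear operator [T]. *)
Section DomainSpace.
Variables (V : NormedModule C_AbsRing) (T : operator V).
Hypotheses (hT : linear_op T) (hinj : injective_op T).

Definition dom_car : Type := {x : V | dom T x}.

Definition op_val (x : V) : V := epsilon (inhabits zero) (T x).

Lemma op_valP x : dom T x -> T x (op_val x).
Proof. exact: epsilon_spec. Qed.

Lemma op_valE x y : T x y -> op_val x = y.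
Proof. by move=> h; apply: (linear_op_fun hT _ h); apply: op_valP; exists y. Qed.

Lemma dom_car_eq (x y : dom_car) : proj1_sig x = proj1_sig y -> x = y.
Proof.
case: x y => [x hx] [y hy] /= e; subst y; congr exist; exact: proof_irrelevance.
Qed.

Lemma dom_zero : dom T zero.
Proof. by exists zero; apply: linear_op_zero hT. Qed.

Lemma dom_plus x y : dom T x -> dom T y -> dom T (plus x y).
Proof. by move=> [u hu] [v hv]; exists (plus u v); apply: linear_op_plus. Qed.

Lemma dom_scal (c : C_AbsRing) x : dom T x -> dom T (scal c x).
Proof. by move=> [u hu]; exists (scal c u); apply: linear_op_scal. Qed.

Lemma dom_opp x : dom T x -> dom T (opp x).
Proof. by move=> h; rewrite -scal_opp_one; apply: dom_scal. Qed.

Definition dom_monoid_mixin : AbelianMonoid.mixin_of dom_car.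
Proof.
refine (AbelianMonoid.Mixin dom_car
  (fun x y => exist _ (plus (proj1_sig x) (proj1_sig y)) (dom_plus (proj2_sig x) (proj2_sig y)))
  (exist _ zero dom_zero) _ _ _).
- by move=> x y; apply: dom_car_eq; apply: plus_comm.
- by move=> x y z; apply: dom_car_eq; apply: plus_assoc.
- by move=> x; apply: dom_car_eq; apply: plus_zero_r.
Defined.

Definition dom_monoid := AbelianMonoid.Pack dom_car dom_monoid_mixin dom_car.

Definition dom_group_mixin : AbelianGroup.mixin_of dom_monoid.
Proof.
refine (AbelianGroup.Mixin dom_monoid
  (fun x : dom_car => exist _ (opp (proj1_sig x)) (dom_opp (proj2_sig x))) _).
by move=> x; apply: dom_car_eq; apply: plus_opp_r.
Defined.

Definition dom_group : AbelianGroup :=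
  AbelianGroup.Pack dom_car (AbelianGroup.Class dom_car _ dom_group_mixin) dom_car.

Definition dom_module_mixin : ModuleSpace.mixin_of C_Ring dom_group.
Proof.
refine (ModuleSpace.Mixin C_Ring dom_group
  (fun c (x : dom_car) => exist _ (scal c (proj1_sig x)) (dom_scal c (proj2_sig x))) _ _ _ _).
- by move=> x y u; apply: dom_car_eq; apply: scal_assoc.
- by move=> u; apply: dom_car_eq; apply: scal_one.
- by move=> x u v; apply: dom_car_eq; apply: scal_distr_l.
- by move=> x y u; apply: dom_car_eq; apply: scal_distr_r.
Defined.

Definition dom_module : ModuleSpace C_Ring :=
  ModuleSpace.Pack C_Ring dom_car (ModuleSpace.Class C_Ring dom_car _ dom_module_mixin) dom_car.

Definition dom_norm (x : dom_module) : R := norm (op_val (proj1_sig x)).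

Lemma dom_norm_triangle x y : dom_norm (plus x y) <= dom_norm x + dom_norm y.
Proof.
rewrite /dom_norm (op_valE (y := plus (op_val (proj1_sig x)) (op_val (proj1_sig y)))).
  exact: norm_triangle.
by apply: (linear_op_plus hT); apply: op_valP; apply: proj2_sig.
Qed.

Lemma dom_norm_scal (c : C_AbsRing) x : dom_norm (scal c x) <= abs c * dom_norm x.
Proof.
rewrite /dom_norm (op_valE (y := scal c (op_val (proj1_sig x)))).
  exact: norm_scal.
by apply: (linear_op_scal hT); apply: op_valP; apply: proj2_sig.
Qed.

Lemma dom_norm_def x : dom_norm x = 0 -> x = zero.
Proof.
move=> /norm_eq_zero h; apply: dom_car_eq => /=.
apply: hinj (linear_op_zero hT); rewrite -h; apply: op_valP; exact: proj2_sig.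
Qed.

Definition domain_space : NormedModule C_AbsRing :=
  build_normed dom_norm_triangle dom_norm_scal dom_norm_def.
End DomainSpace.

Record Hilbert := {
  hilbert_space :> CompleteNormedModule C_AbsRing;
  inner : hilbert_space -> hilbert_space -> C;
  inner_plus : forall x y z, inner (plus x y) z = Cplus (inner x z) (inner y z);
  inner_scal : forall (c : C) x y, inner (scal c x) y = Cmult c (inner x y);
  inner_conj : forall x y, inner y x = Cconj (inner x y);
  inner_norm : forall x, inner x x = RtoC (norm x ^ 2)
}.

Definition separable (X : Hilbert) : Prop :=
  exists u : nat -> X, dense (fun x => exists k, x = u k).

Definition adjoint (X : Hilbert) (A : operator X) : operator X := fun y z =>
  forall x w, A x w -> inner w y = inner x z.

Record positive_selfadjoint (X : Hilbert) (A : operator X) : Prop := {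
  psa_linear : linear_op A;
  psa_closed : closed_op A;
  psa_dense : dense (dom A);
  psa_selfadjoint : op_eq (adjoint A) A;
  psa_definite : forall x y, A x y -> x <> zero -> 0 < Re (inner y x);
  psa_spectrum : exists l0, 0 < l0 /\ forall l, spectrum A l -> l0 < Re l
}.

Section RealLinear.
Variable V : NormedModule R_AbsRing.

Lemma is_RInt_linear (W : NormedModule R_AbsRing) (phi : V -> W) f a b I :
  is_linear phi -> is_RInt f a b I -> is_RInt (fun t => phi (f t)) a b (phi I).
Proof.
move=> hphi h.
have hs : forall ptd, Riemann_sum (fun t => phi (f t)) ptd = phi (Riemann_sum f ptd).
  apply: SF_cons_ind => [x0|p s ih].
    by rewrite /Riemann_sum /= linear_zero.
  by rewrite !Riemann_sum_cons ih linear_plus // linear_scal.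
rewrite /is_RInt.
apply: (filterlim_ext (fun ptd => phi (scal (sign (b - a)) (Riemann_sum f ptd)))).
  by move=> ptd; rewrite linear_scal // hs.
by apply: (filterlim_comp _ _ _ _ phi _ _ _ h); apply: linear_cont.
Qed.

Lemma is_RInt_gen_linear (W : NormedModule R_AbsRing) (phi : V -> W) f Fa Fb I
    (FFa : Filter Fa) (FFb : Filter Fb) :
  is_linear phi -> is_RInt_gen f Fa Fb I ->
  is_RInt_gen (fun t => phi (f t)) Fa Fb (phi I).
Proof.
move=> hphi h P hP.
have := h _ (linear_cont phi I hphi P hP).
rewrite /filtermapi; apply: filter_imp => ab [J [hJ1 hJ2]].
by exists (phi J); split => //; apply: is_RInt_linear.
Qed.
End RealLinear.

Lemma is_RInt_gen_ge (h : R -> R) Fa Fb (m L : R)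
    (FFa : ProperFilter Fa) (FFb : ProperFilter Fb) :
  filter_prod Fa Fb (fun ab => forall J, is_RInt h ab.1 ab.2 J -> m <= J) ->
  is_RInt_gen h Fa Fb L -> m <= L.
Proof.
move=> hm hL; case: (Rle_lt_dec m L) => // lt.
have e0 : 0 < m - L by lra.
have := hL _ (locally_ball L (mkposreal _ e0)).
rewrite /filtermapi => hF.
have [ab [h1 [J [h2 h3]]]] := filter_ex _ (filter_and _ _ hm hF).
have := h1 _ h2.
move: h3; rewrite /ball /= /AbsRing_ball /abs /minus /plus /opp /= => /Rabs_def2 []; lra.
Qed.

Section ImproperExistence.
Variable V : CompleteNormedModule R_AbsRing.
Variables (h : R -> V) (phi dphi : R -> R).
Hypothesis hc : forall l, 0 < l -> continuous h l.
Hypothesis hd : forall l, 0 < l -> is_derive phi l (dphi l).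
Hypothesis hdc : forall l, 0 < l -> continuous dphi l.
Hypothesis hb : forall l, 0 < l -> norm (h l) <= dphi l.

Lemma impr_ex a b : 0 < a -> 0 < b -> ex_RInt h a b.
Proof.
move=> ha hb'; apply: ex_RInt_continuous => z [hz _]; apply: hc.
apply: Rlt_le_trans hz; exact: Rmin_glb_lt.
Qed.

Lemma impr_bound a b : 0 < a -> a <= b -> norm (RInt h a b) <= phi b - phi a.
Proof.
move=> ha hab.
have pos z : a <= z -> 0 < z by lra.
apply: (norm_RInt_le h dphi a b) => //.
- by move=> x [hx _]; apply: hb; apply: pos.
- by apply: RInt_correct; apply: impr_ex; lra.
- apply: is_RInt_derive => z; rewrite Rmin_left // => -[hz _].
    by apply: hd; apply: pos.
  by apply: hdc; apply: pos.
Qed.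

Lemma impr_bound_abs a b : 0 < a -> 0 < b -> norm (RInt h a b) <= Rabs (phi b - phi a).
Proof.
move=> ha hb'; case: (Rle_lt_dec a b) => hab.
  by apply: Rle_trans (Rle_abs _); apply: impr_bound.
rewrite -opp_RInt_swap; last by apply: impr_ex.
rewrite norm_opp Rabs_minus_sym; apply: Rle_trans (Rle_abs _); apply: impr_bound => //; lra.
Qed.

Lemma impr_half F (FF : ProperFilter F) L :
  F (fun b => 0 < b) -> filterlim phi F (locally L) ->
  exists I, is_RInt_gen h (at_point 1) F I.
Proof.
move=> Fpos hphi.
have [I hI] : exists I, filterlim (fun b => RInt h 1 b) F (locally I).
  apply/filterlim_locally_cauchy => eps.
  have [P [FP hP]] := proj2 (filterlim_locally_cauchy phi) (ex_intro _ L hphi) eps.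
  exists (fun b => P b /\ 0 < b); split; first exact: filter_and.
  move=> u v [Pu u0] [Pv v0]; apply: norm_compat1.
  have -> : minus (RInt h 1 v) (RInt h 1 u) = RInt h u v.
    rewrite /minus plus_comm opp_RInt_swap; last by apply: impr_ex; lra.
    by apply: RInt_Chasles; apply: impr_ex; lra.
  apply: Rle_lt_trans (impr_bound_abs u0 v0) _.
  exact: hP u v Pu Pv.
exists I => P hP.
rewrite /filtermapi.
apply: Filter_prod (fun a => a = 1) (fun b => P (RInt h 1 b) /\ 0 < b) _ _ _.
- by [].
- by apply: filter_and => //; apply: hI.
- move=> a b -> [h1 h2]; exists (RInt h 1 b); split => //.
  by apply: RInt_correct; apply: impr_ex => //=; lra.
Qed.
End ImproperExistence.

Lemma Rpower_deriv (r l : R) : 0 < l -> is_derive (fun t => Rpower t r) l (r * Rpower l (r - 1)).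
Proof.
move=> hl; apply/is_derive_Reals.
by apply: derivable_pt_lim_power.
Qed.

Lemma Rpower_cont (r l : R) : 0 < l -> continuous (fun t => Rpower t r) l.
Proof.
move=> hl; apply: (@ex_derive_continuous R_AbsRing R_NormedModule).
by eexists; apply: Rpower_deriv.
Qed.

Lemma Rpower_lim0 (r : R) : 0 < r -> filterlim (fun t => Rpower t r) (at_right 0) (locally 0).
Proof.
move=> hr; apply/filterlim_locally => eps.
have e0 := cond_pos eps.
exists (mkposreal _ (exp_pos (ln eps / r))) => t /=.
rewrite /ball /= /AbsRing_ball /abs /minus /plus /opp /= => ht t0.
have {}ht : t < exp (ln eps / r) by move: ht; rewrite Ropp_0 Rplus_0_r Rabs_pos_eq; lra.
rewrite Ropp_0 Rplus_0_r Rabs_pos_eq; last by left; apply: exp_pos.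
rewrite /Rpower -[X in _ < X](exp_ln eps) //; apply: exp_increasing.
have : ln t < ln eps / r by rewrite -[X in _ < X]ln_exp; apply: ln_increasing.
move=> h; have := Rmult_lt_compat_l _ _ _ hr h.
by rewrite (_ : r * (ln eps / r) = ln eps) //; field; lra.
Qed.

Lemma Rpower_liminf (r : R) : r < 0 ->
  filterlim (fun t => Rpower t r) (Rbar_locally p_infty) (locally 0).
Proof.
move=> hr; apply/filterlim_locally => eps.
have e0 := cond_pos eps.
exists (exp (ln eps / r)) => t ht.
have t0 : 0 < t by have := exp_pos (ln eps / r); lra.
rewrite /ball /= /AbsRing_ball /abs /minus /plus /opp /=.
rewrite Ropp_0 Rplus_0_r Rabs_pos_eq; last by left; apply: exp_pos.
rewrite /Rpower -[X in _ < X](exp_ln eps) //; apply: exp_increasing.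
have h : ln eps / r < ln t by rewrite -[X in X < _]ln_exp; apply: ln_increasing => //; apply: exp_pos.
have := Rmult_lt_gt_compat_neg_l _ _ _ hr h.
rewrite (_ : r * (ln eps / r) = ln eps); [lra | field; lra].
Qed.

Lemma lim_const_mult (k : R) (f : R -> R) (F : (R -> Prop) -> Prop) :
  filterlim f F (locally 0) -> filterlim (fun t => k * f t) F (locally 0).
Proof.
move=> hf; rewrite -[X in locally X](Rmult_0_r k).
apply: (filterlim_comp _ _ _ f (fun t => k * t) _ _ _ hf).
exact: (filterlim_scal_r (k : R_AbsRing) (0 : R_NormedModule)).
Qed.

Definition realify_complete (V : CompleteNormedModule C_AbsRing) : CompleteNormedModule R_AbsRing :=
  CompleteNormedModule.Pack R_AbsRing V
    (CompleteNormedModule.Class R_AbsRing V (NormedModule.class R_AbsRing (realify V))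
       (CompleteSpace.class (CompleteNormedModule.CompleteSpace _ V))) V.

Section FracSpaces.
Variables (X : Hilbert) (A : operator X).
Hypothesis hA : positive_selfadjoint A.

Let ri (x y : X) : R := Re (inner x y).

Let ri_plusl x y z : ri (plus x y) z = ri x z + ri y z.
Proof. by rewrite /ri inner_plus. Qed.

Let ri_scall (l : R) x y : ri (scal (RtoC l : C_AbsRing) x) y = l * ri x y.
Proof. by rewrite /ri inner_scal re_scal_l. Qed.

Let ri_sym x y : ri x y = ri y x.
Proof. by rewrite /ri (inner_conj x y). Qed.

Let ri_plusr x y z : ri x (plus y z) = ri x y + ri x z.
Proof. by rewrite !(ri_sym x) ri_plusl. Qed.

Let ri_scalr (l : R) x y : ri x (scal (RtoC l : C_AbsRing) y) = l * ri x y.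
Proof. by rewrite !(ri_sym x) ri_scall. Qed.

Let ri_norm x : ri x x = norm x ^ 2.
Proof. by rewrite /ri inner_norm. Qed.

Let oppE (x : X) : opp x = scal (RtoC (-1) : C_AbsRing) x.
Proof. by rewrite -scal_opp_one; congr scal; symmetry; apply: (RtoC_opp 1). Qed.

Let ri_oppl x y : ri (opp x) y = - ri x y.
Proof. by rewrite oppE ri_scall; ring. Qed.

Let ri_zerol y : ri zero y = 0.
Proof. by have := ri_plusl zero zero y; rewrite plus_zero_l; lra. Qed.

Let ri_CS x y : ri x y <= norm x * norm y.
Proof.
have hx := norm_ge_0 x; have hy := norm_ge_0 y.
case: (Req_dec (norm x) 0) => [/norm_eq_zero ->|nx].
  by rewrite ri_zerol; apply: Rmult_le_pos => //; apply: norm_ge_0.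
case: (Req_dec (norm y) 0) => [/norm_eq_zero ->|ny].
  by rewrite ri_sym ri_zerol; apply: Rmult_le_pos => //; apply: norm_ge_0.
set z := plus (scal (RtoC (norm y) : C_AbsRing) x) (scal (RtoC (- norm x) : C_AbsRing) y).
have := pow2_ge_0 (norm z).
rewrite -ri_norm /z !ri_plusl !ri_plusr !ri_scall !ri_scalr !ri_norm (ri_sym y x).
move: (ri x y) => c.
have h0 : 0 < norm x * norm y by apply: Rmult_lt_0_compat; lra.
move=> h.
have : 0 <= 2 * (norm x * norm y) * (norm x * norm y - c) by lra.
move=> h'; case: (Rle_lt_dec c (norm x * norm y)) => // lt; nra.
Qed.

Let ri_CSabs x y : Rabs (ri x y) <= norm x * norm y.
Proof.
apply: Rabs_le; split; last exact: ri_CS.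
have := ri_CS (opp x) y; rewrite ri_oppl norm_opp; lra.
Qed.

Let ri_linear w : @is_linear R_AbsRing (realify X) R_NormedModule (fun x => ri x w).
Proof.
split.
- by move=> x y; apply: ri_plusl.
- by move=> l x; apply: ri_scall.
- exists (norm w + 1); split; first by have := norm_ge_0 w; lra.
  move=> x; apply: Rle_trans (ri_CSabs x w) _.
  rewrite Rmult_comm; apply: Rmult_le_compat_r; first exact: norm_ge_0.
  lra.
Qed.

Let A_sym x y x' y' : A x y -> A x' y' -> ri y x' = ri x y'.
Proof. by move=> h h'; rewrite /ri; congr Re; apply: ((psa_selfadjoint hA x' y').2 h'). Qed.

Let A_pos x y : A x y -> 0 <= ri y x.
Proof.
move=> h; case: (classic (x = zero)) => [->|nz].
  by rewrite ri_sym ri_zerol; lra.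
by left; apply: psa_definite hA _ _ h nz.
Qed.

Let C1_scal (x : X) : scal (RtoC 1 : C_AbsRing) x = x.
Proof. exact: scal_one. Qed.

Let rsr (l m : R) (x : X) :
  scal (RtoC l : C_AbsRing) (scal (RtoC m : C_AbsRing) x) = scal (RtoC (l * m) : C_AbsRing) x.
Proof. by rewrite scal_assoc; congr scal; rewrite RtoC_mult. Qed.

Let rsp (l m : R) (x : X) :
  plus (scal (RtoC l : C_AbsRing) x) (scal (RtoC m : C_AbsRing) x) = scal (RtoC (l + m) : C_AbsRing) x.
Proof. by rewrite -scal_distr_r; congr scal; rewrite RtoC_plus. Qed.

Let rs_eq (l m : R) (x : X) :
  l = m -> scal (RtoC l : C_AbsRing) x = scal (RtoC m : C_AbsRing) x.
Proof. by move->. Qed.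

Let A_lin := psa_linear hA.

Let A_res l : l <= 0 -> resolvent_set A (RtoC l).
Proof.
move=> hl; apply: NNPP => hn.
have [l0 [h0 h]] := psa_spectrum hA.
by have := h _ hn => /=; lra.
Qed.

Let A_inv : exists M, 0 < M /\ forall x y, A x y -> norm x <= M * norm y.
Proof.
have [S [Slin hS]] := A_res (Rle_refl 0).
have [M [M0 hM]] := linear_norm _ Slin.
exists M; split => // x y hxy.
have -> : x = S (scal (RtoC (-1) : C_AbsRing) y).
  apply: (hS _ _).1; exists (scal (RtoC 0 : C_AbsRing) x), (scal (RtoC (-1) : C_AbsRing) y).
  split; [by exists x | split; first by exists y].
  by rewrite (_ : RtoC 0 = zero) // scal_zero_l plus_zero_l.
by apply: Rle_trans (hM _) _; rewrite -oppE norm_opp; lra.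
Qed.

Let A_inj : injective_op A.
Proof.
have [M [M0 hM]] := A_inv.
move=> x x' y h h'.
have : norm (minus x x') <= M * norm (minus y y).
  apply: hM; rewrite /minus !oppE; apply: (linear_op_plus A_lin) => //.
  exact: linear_op_scal.
rewrite minus_eq_zero norm_zero Rmult_0_r => hle.
apply: (plus_reg_r (opp x')); rewrite plus_opp_r; apply: norm_eq_zero.
by apply: Rle_antisym => //; apply: norm_ge_0.
Qed.

(** [f = (l + A)^-1 x] and [g = A f]. *)
Let split_at l x f g := A f g /\ x = plus (scal (RtoC l : C_AbsRing) f) g.

Let split_ex l x : 0 < l -> exists f g, split_at l x f g.
Proof.
move=> hl; have hl' : - l <= 0 by lra.
have [S [_ hS]] := A_res hl'.
have [u [v [[f [hf hu]] [[g [hg hv]] e]]]] := (hS (opp x) (S (opp x))).2 erefl.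
move: hf hg; move: (S (opp x)) => y hf hg.
exists y, g; split => //.
rewrite -[x]opp_opp e hu hv hf oppE scal_distr_l !rsr; congr plus.
  by apply: rs_eq; ring.
by rewrite -[RHS]C1_scal; apply: rs_eq; ring.
Qed.

Let split_comp l x g : op_comp A (shift_inv A l) x g <-> exists f, split_at l x f g.
Proof.
split.
- move=> [f' [[u [v [[w [hw hu]] [hv e]]]] h]].
  exists f'; split => //; rewrite e hu hw; congr plus; exact: (linear_op_fun A_lin hv h).
- move=> [f' [h e]]; exists f'; split => //.
  exists (scal (RtoC l : C_AbsRing) f'), g; split; first by exists f'.
  by split.
Qed.

Let split_acc l x f g : 0 < l -> split_at l x f g -> norm g ^ 2 <= ri g x.
Proof.
move=> hl [h ->]; rewrite ri_plusr ri_scalr ri_norm.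
have := A_pos h; nra.
Qed.

Let split_g l x f g : 0 < l -> split_at l x f g -> norm g <= norm x.
Proof.
move=> hl h; have h1 := split_acc hl h; have h2 := ri_CS g x.
have := norm_ge_0 g; have := norm_ge_0 x; nra.
Qed.

Let split_f l x f g : 0 < l -> split_at l x f g -> l * norm f <= norm x.
Proof.
move=> hl [h e].
have h1 : l * norm f ^ 2 <= ri f x.
  by rewrite e ri_plusr ri_scalr ri_norm (ri_sym f g); have := A_pos h; lra.
have h2 := ri_CS f x; have h3 := norm_ge_0 f; have h4 := norm_ge_0 x.
case: (Req_dec (norm f) 0) => [->|n0]; first by rewrite Rmult_0_r.
apply: (Rmult_le_reg_r (norm f)); nra.
Qed.

Let split_minus l x f g x' f' g' :
  split_at l x f g -> split_at l x' f' g' -> split_at l (minus x x') (minus f f') (minus g g').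
Proof.
move=> [h ->] [h' ->]; split.
  by rewrite /minus !oppE; apply: (linear_op_plus A_lin) => //; apply: linear_op_scal.
rewrite /minus opp_plus scal_distr_l !plus_assoc; congr plus.
rewrite -!plus_assoc; congr plus.
by rewrite plus_comm !oppE !rsr Rmult_comm.
Qed.

Let split_uniq l x f g f' g' :
  0 < l -> split_at l x f g -> split_at l x f' g' -> f = f' /\ g = g'.
Proof.
move=> hl h h'; have hm := split_minus h h'.
have hg := split_g hl hm.
have hf : A (minus f f') zero.
  have [hAf _] := hm.
  suff -> : zero = minus g g' by [].
  symmetry; apply: norm_eq_zero; apply: Rle_antisym; last exact: norm_ge_0.
  by rewrite minus_eq_zero norm_zero in hg.
have e : minus f f' = zero by apply: A_inj hf (linear_op_zero A_lin).
have ef : f = f' by apply: (plus_reg_r (opp f')); rewrite plus_opp_r.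
split => //; subst f'.
exact: linear_op_fun A_lin _ _ _ h.1 h'.1.
Qed.

(** For [x] in [D(A)], [A (l + A)^-1 x = (l + A)^-1 A x]. *)
Let split_dom l x z f g : A x z -> split_at l x f g -> split_at l z g (minus z (scal (RtoC l : C_AbsRing) g)).
Proof.
move=> hz [h e].
have eg : g = plus x (scal (RtoC (- l) : C_AbsRing) f).
  rewrite e [plus (scal (RtoC l : C_AbsRing) f) g]plus_comm -plus_assoc rsp (_ : l + - l = 0); last ring.
  by rewrite (_ : RtoC 0 = zero) // scal_zero_l plus_zero_r.
split; last by rewrite /minus plus_comm -plus_assoc plus_opp_l plus_zero_r.
rewrite /minus [X in A X _]eg; apply: (linear_op_plus A_lin) => //.
rewrite oppE rsr (_ : -1 * l = - l); last ring.
exact: linear_op_scal.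
Qed.

Section Power.
Variable a : R.
Hypothesis ha : 0 < a < 1.

Let B : operator X := op_restrict (dom A) (balakrishnan A a).

Let c_pos : 0 < sin (a * PI) / PI.
Proof.
have := PI_RGT_0 => h; apply: Rdiv_lt_0_compat => //; apply: sin_gt_0; nra.
Qed.

Let at_right_pos : at_right 0 (fun b => 0 < b).
Proof. by exists (mkposreal _ Rlt_0_1). Qed.

Let infty_pos : Rbar_locally p_infty (fun b => 0 < b).
Proof. by exists 0. Qed.

Let Fr0 : Filter (at_right 0). Proof. exact _. Qed.
Let Fri : Filter (Rbar_locally p_infty). Proof. exact _. Qed.

Let B_dom x : dom A x -> dom B x.
Proof.
move=> hx; have [z hz] := hx.
pose G l := epsilon (inhabits zero) (fun g => exists f, split_at l x f g).
have hG l : 0 < l -> exists f, split_at l x f (G l).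
  move=> hl; apply: (epsilon_spec (inhabits zero) (fun g => exists f, split_at l x f g)).
  by have [f [g h]] := split_ex x hl; exists g, f.
have hGx l : 0 < l -> norm (G l) <= norm x.
  by move=> hl; have [f h] := hG l hl; apply: split_g h.
have hGz l : 0 < l -> l * norm (G l) <= norm z.
  move=> hl; have [f h] := hG l hl; apply: split_f hl (split_dom hz h).
have hGlip l m : 0 < l -> 0 < m -> l * norm (minus (G m) (G l)) <= Rabs (m - l) * norm x.
  move=> hl hm.
  have [f h] := hG l hl; have [f' h'] := hG m hm.
  have h1 := split_dom hz h; have [h2 e2] := split_dom hz h'.
  have h3 : split_at l (plus z (scal (RtoC (l - m) : C_AbsRing) (G m))) (G m)
              (minus z (scal (RtoC m : C_AbsRing) (G m))).
    split => //; rewrite /minus !oppE rsr.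
    rewrite [RHS]plus_comm -plus_assoc rsp (_ : -1 * m + l = l - m) //; ring.
  have := split_f hl (split_minus h3 h1).
  rewrite /minus [plus z _]plus_comm -plus_assoc plus_opp_r plus_zero_r => h4.
  apply: Rle_trans h4 _; apply: Rle_trans (norm_scal _ _) _.
  rewrite /abs /= Cmod_R Rabs_minus_sym.
  by apply: Rmult_le_compat_l (hGx _ hm); apply: Rabs_pos.
have hGc l : 0 < l -> @continuous R_UniformSpace (realify_complete X) G l.
  move=> hl; apply/filterlim_locally => eps.
  have e0 := cond_pos eps.
  have nx := norm_ge_0 x.
  have d0 : 0 < Rmin l (l * eps / (norm x + 1)).
    apply: Rmin_glb_lt => //; apply: Rdiv_lt_0_compat; last lra.
    exact: Rmult_lt_0_compat.
  exists (mkposreal _ d0) => m; rewrite /ball /= /AbsRing_ball /abs /minus /plus /opp /= => hm.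
  have h1 := Rlt_le_trans _ _ _ hm (Rmin_l _ _).
  have h2 := Rlt_le_trans _ _ _ hm (Rmin_r _ _).
  have hm0 : 0 < m by have [] := Rabs_def2 _ _ h1; lra.
  apply: (@norm_compat1 _ X).
  apply: (Rmult_lt_reg_l l) => //; apply: Rle_lt_trans (hGlip _ _ hl hm0) _.
  have h3 : Rabs (m - l) * (norm x + 1) < l * eps.
    have hx1 : 0 < norm x + 1 by lra.
    have := Rmult_lt_compat_r _ _ _ hx1 h2.
    by rewrite (_ : l * eps / (norm x + 1) * (norm x + 1) = l * eps) //; field; lra.
  have := Rabs_pos (m - l); nra.
pose h l : realify_complete X := @scal R_Ring (realify_complete X) (Rpower l (a - 1)) (G l).
have hc l : 0 < l -> continuous h l.
  by move=> hl; apply: continuous_scal; [apply: Rpower_cont | apply: hGc].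
have hn l : norm (h l) <= Rpower l (a - 1) * norm (G l).
  apply: Rle_trans (norm_scal _ _) _.
  rewrite {1}/abs /= Rabs_pos_eq; [exact: Rle_refl | left; apply: exp_pos].
have [I0 hI0] : exists I, is_RInt_gen h (at_point 1) (at_right 0) I.
  apply: (@impr_half _ h (fun l => norm x / a * Rpower l a) (fun l => norm x * Rpower l (a - 1))
            _ _ _ _ _ _ 0) => //.
  - move=> l hl.
    have := is_derive_scal _ _ (norm x / a) _ (Rpower_deriv a hl).
    by rewrite (_ : norm x * Rpower l (a - 1) = norm x / a * (a * Rpower l (a - 1))) //; field; lra.
  - by move=> l hl; apply: continuous_mult; [apply: continuous_const | apply: Rpower_cont].
  - move=> l hl; apply: Rle_trans (hn l) _; rewrite Rmult_comm.
    by apply: Rmult_le_compat_r (hGx _ hl); left; apply: exp_pos.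
  - exact: lim_const_mult (Rpower_lim0 ha.1).
have [I1 hI1] : exists I, is_RInt_gen h (at_point 1) (Rbar_locally p_infty) I.
  apply: (@impr_half _ h (fun l => norm z / (a - 1) * Rpower l (a - 1))
            (fun l => norm z * Rpower l (a - 1 - 1)) _ _ _ _ _ _ 0) => //.
  - move=> l hl.
    have := is_derive_scal _ _ (norm z / (a - 1)) _ (Rpower_deriv (a - 1) hl).
    by rewrite (_ : norm z * Rpower l (a - 1 - 1) =
        norm z / (a - 1) * ((a - 1) * Rpower l (a - 1 - 1))) //; field; lra.
  - by move=> l hl; apply: continuous_mult; [apply: continuous_const | apply: Rpower_cont].
  - move=> l hl; apply: Rle_trans (hn l) _.
    have -> : Rpower l (a - 1) = Rpower l (a - 1 - 1) * l.
      by rewrite -[X in _ = _ * X](Rpower_1 l hl) -Rpower_plus; congr Rpower; ring.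
    rewrite Rmult_assoc Rmult_comm.
    by apply: Rmult_le_compat_r (hGz _ hl); left; apply: exp_pos.
  - by apply: lim_const_mult; apply: Rpower_liminf; lra.
have hI := is_RInt_gen_Chasles h 1 _ _ (is_RInt_gen_swap h I0 hI0) hI1.
eexists; split => //.
eexists; split; last by reflexivity.
exists G; split; last exact: hI.
by move=> l hl; apply/split_comp => //; apply: hG.
Qed.

Let B_data x y : B x y -> exists (G : R -> X) (I : X),
  (forall l, 0 < l -> exists f, split_at l x f (G l)) /\
  @is_RInt_gen (realify X) (fun l => scal (RtoC (Rpower l (a - 1)) : C_AbsRing) (G l))
    (at_right 0) (Rbar_locally p_infty) I /\
  y = scal (RtoC (sin (a * PI) / PI) : C_AbsRing) I.
Proof.
move=> [_ [I [[G [hG hI]] ->]]]; exists G, I; split => // l hl.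
by apply/split_comp; apply: hG.
Qed.

Let B_inner x y w : B x y -> exists G,
  (forall l, 0 < l -> exists f, split_at l x f (G l)) /\
  exists L, is_RInt_gen (fun l => Rpower l (a - 1) * ri (G l) w)
    (at_right 0) (Rbar_locally p_infty) L /\ ri y w = sin (a * PI) / PI * L.
Proof.
move=> /B_data [G [I [hG [hI ->]]]]; exists G; split => //.
exists (ri I w); split; last exact: ri_scall.
have := @is_RInt_gen_linear _ _ _ _ _ _ _ Fr0 Fri (ri_linear w) hI.
apply: is_RInt_gen_ext.
apply: filter_forall => ab t _; exact: ri_scall.
Qed.

Let pos_int (f g : R -> R) :
  (forall l, 0 < l -> f l = g l) ->
  filter_prod (at_right 0) (Rbar_locally p_infty)
    (fun ab => forall t, Rmin ab.1 ab.2 < t < Rmax ab.1 ab.2 -> f t = g t).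
Proof.
move=> h; apply: Filter_prod at_right_pos infty_pos _ => u v hu hv t [ht _].
apply: h; apply: Rle_lt_trans ht; apply: Rlt_le; exact: Rmin_glb_lt.
Qed.

Let B_sym x y x' y' : B x y -> B x' y' -> ri y x' = ri x y'.
Proof.
move=> h h'.
have [G [hG [L [hL ->]]]] := B_inner x' h.
have [G' [hG' [L' [hL' e]]]] := B_inner x h'.
rewrite (ri_sym x y') e; congr (_ * _).
have hL2 : is_RInt_gen (fun l => Rpower l (a - 1) * ri (G l) x')
    (at_right 0) (Rbar_locally p_infty) L'.
  apply: is_RInt_gen_ext hL'; apply: pos_int => l hl; congr (_ * _).
  have [f [h1 e1]] := hG l hl; have [f' [h2 e2]] := hG' l hl.
  rewrite e1 e2 !ri_plusr !ri_scalr (ri_sym (G' l) (G l)); congr (_ * _ + _).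
  by rewrite (ri_sym (G' l) f); symmetry; apply: A_sym h1 h2.
by rewrite -(is_RInt_gen_unique _ _ hL) -(is_RInt_gen_unique _ _ hL2).
Qed.

Let B_low : exists k, 0 < k /\ forall x y, B x y -> k * norm x ^ 2 <= ri y x.
Proof.
have [M [M0 hM]] := A_inv.
pose m := / 2 * / (1 + 2 * M) ^ 2.
have m0 : 0 < m.
  by apply: Rmult_lt_0_compat; [lra | apply: Rinv_0_lt_compat; apply: pow_lt; lra].
exists (sin (a * PI) / PI * m); split; first exact: Rmult_lt_0_compat.
move=> x y h; have [G [hG [L [hL ->]]]] := B_inner x h.
rewrite Rmult_assoc; apply: Rmult_le_compat_l; first by left.
have h0 l : 0 < l -> 0 <= Rpower l (a - 1) * ri (G l) x.
  move=> hl; apply: Rmult_le_pos; first by left; apply: exp_pos.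
  have [f hf] := hG l hl; apply: Rle_trans (split_acc hl hf); exact: pow2_ge_0.
have h1 l : 1 < l < 2 -> m * norm x ^ 2 <= Rpower l (a - 1) * ri (G l) x.
  move=> hl; have l0 : 0 < l by lra.
  have [f hf] := hG l l0; have hacc := split_acc l0 hf.
  have hx : norm x <= (1 + 2 * M) * norm (G l).
    have [hfA {1}->] := hf.
    apply: Rle_trans (norm_triangle _ _) _.
    have h2 : norm (scal (RtoC l : C_AbsRing) f) <= l * norm f.
      apply: Rle_trans (norm_scal _ _) _.
      by rewrite {1}/abs /= Cmod_R Rabs_pos_eq; lra.
    have h3 := hM _ _ hfA; have h4 := norm_ge_0 f; have h5 := norm_ge_0 (G l).
    have h6 : l * norm f <= 2 * (M * norm (G l)) by apply: Rmult_le_compat; lra.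
    by apply: Rle_trans (Rplus_le_compat_r _ _ _ h2) _; lra.
  have hp : / 2 <= Rpower l (a - 1).
    apply: Rle_trans (_ : Rpower 2 (- 1) <= _).
      by rewrite Rpower_Ropp Rpower_1; lra.
    apply: (Rle_trans _ (Rpower l (- 1))).
      rewrite !Rpower_Ropp !Rpower_1; try lra.
      by apply: Rinv_le_contravar; lra.
    by apply: Rle_Rpower; lra.
  rewrite /m Rmult_assoc; apply: Rmult_le_compat; try lra.
    apply: Rmult_le_pos; last exact: pow2_ge_0.
    by left; apply: Rinv_0_lt_compat; apply: pow_lt; lra.
  apply: Rle_trans hacc.
  have hq : 0 < (1 + 2 * M) ^ 2 by apply: pow_lt; lra.
  apply: (Rmult_le_reg_l ((1 + 2 * M) ^ 2)) => //.
  rewrite -Rmult_assoc Rinv_r ?Rmult_1_l; last lra.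
  rewrite -Rpow_mult_distr; apply: pow_incr; split => //; exact: norm_ge_0.
apply: is_RInt_gen_ge hL.
apply: (Filter_prod _ _ _ (fun u => 0 < u < 1) (fun v => 2 < v)).
- exists (mkposreal _ Rlt_0_1) => u /= hu u0; split => //.
  move: hu; rewrite /ball /= /AbsRing_ball /abs /minus /plus /opp /=.
  by move=> /Rabs_def2 []; lra.
- by exists 2.
move=> u v [u0 u1] hv J /= hJ.
have hex : ex_RInt (fun l => Rpower l (a - 1) * ri (G l) x) u v by exists J.
have ex1 : ex_RInt (fun l => Rpower l (a - 1) * ri (G l) x) u 2.
  by apply: (ex_RInt_Chasles_1 _ u 2 v) => //; lra.
have ex2 : ex_RInt (fun l => Rpower l (a - 1) * ri (G l) x) 2 v.
  by apply: (ex_RInt_Chasles_2 _ u 2 v) => //; lra.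
have ex3 : ex_RInt (fun l => Rpower l (a - 1) * ri (G l) x) u 1.
  by apply: (ex_RInt_Chasles_1 _ u 1 2) => //; lra.
have ex4 : ex_RInt (fun l => Rpower l (a - 1) * ri (G l) x) 1 2.
  by apply: (ex_RInt_Chasles_2 _ u 1 2) => //; lra.
rewrite -(is_RInt_unique _ _ _ _ hJ) -(RInt_Chasles _ u 2 v) // -(RInt_Chasles _ u 1 2) //.
have i1 := RInt_ge_0 _ u 1 (Rlt_le _ _ u1) ex3.
have i2 := RInt_ge_0 _ 2 v (Rlt_le _ _ hv) ex2.
have le12 : 1 <= 2 by lra.
have i3 := RInt_le (fun _ => m * norm x ^ 2) _ 1 2 le12 (ex_RInt_const _ _ _) ex4 h1.
rewrite RInt_const /scal /= /mult /= in i3.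
rewrite /plus /=.
have j1 : 0 <= RInt (fun l => Rpower l (a - 1) * ri (G l) x) u 1.
  by apply: i1 => t ht; apply: h0; lra.
have j2 : 0 <= RInt (fun l => Rpower l (a - 1) * ri (G l) x) 2 v.
  by apply: i2 => t ht; apply: h0; lra.
lra.
Qed.

Let B_plus x y x' y' : B x y -> B x' y' -> B (plus x x') (plus y y').
Proof.
move=> h h'.
have [G [I [hG [hI ->]]]] := B_data h; have [G' [I' [hG' [hI' ->]]]] := B_data h'.
split; first by have := dom_plus A_lin (proj1 h) (proj1 h').
exists (plus I I'); split; last by rewrite scal_distr_l.
exists (fun l => plus (G l) (G' l)); split.
  move=> l hl; apply/split_comp.
  have [f [h1 e1]] := hG l hl; have [f' [h2 e2]] := hG' l hl.
  exists (plus f f'); split; first exact: linear_op_plus A_lin _ _ _ _ h1 h2.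
  rewrite {1}e1 {1}e2 scal_distr_l -!plus_assoc; congr plus.
  by rewrite !plus_assoc; congr plus; apply: plus_comm.
have hp := @is_RInt_gen_plus (realify X) _ _ Fr0 Fri _ _ _ _ hI hI'.
refine (@is_RInt_gen_ext (realify X) _ _ Fr0 Fri _ _ _ _ hp); apply: filter_forall => ab t _.
by rewrite scal_distr_l.
Qed.

Let C_scal_linear (c : C_AbsRing) :
  @is_linear R_AbsRing (realify X) (realify X) (fun x => scal c x).
Proof.
split.
- by move=> x y; apply: (@scal_distr_l _ X).
- move=> k x; change (@scal _ X c (@scal _ X (RtoC k : C_AbsRing) x) =
    @scal _ X (RtoC k : C_AbsRing) (@scal _ X c x)).
  by rewrite !scal_assoc; congr scal; apply: Cmult_comm.
- exists (abs c + 1); split; first by have := abs_ge_0 c; lra.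
  move=> x; apply: Rle_trans (@norm_scal _ X c x) _.
  apply: Rmult_le_compat_r; [exact: norm_ge_0 | lra].
Qed.

Let B_scal (c : C) x y : B x y -> B (scal (c : C_AbsRing) x) (scal (c : C_AbsRing) y).
Proof.
move=> h.
have [G [I [hG [hI ->]]]] := B_data h.
split; first by have := dom_scal A_lin c (proj1 h).
exists (scal (c : C_AbsRing) I); split; last first.
  by rewrite !scal_assoc; congr scal; apply: Cmult_comm.
exists (fun l => scal (c : C_AbsRing) (G l)); split.
  move=> l hl; apply/split_comp.
  have [f [h1 e1]] := hG l hl.
  exists (scal (c : C_AbsRing) f); split; first exact: linear_op_scal A_lin _ _ _ h1.
  rewrite {1}e1 scal_distr_l !scal_assoc; congr (plus (scal _ _) _); exact: Cmult_comm.
have hp := @is_RInt_gen_linear _ _ _ _ _ _ _ Fr0 Fri (C_scal_linear c) hI.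
refine (@is_RInt_gen_ext (realify X) _ _ Fr0 Fri _ _ _ _ hp); apply: filter_forall => ab t _.
change (@scal _ X c (@scal _ X (RtoC (Rpower t (a - 1)) : C_AbsRing) (G t)) =
  @scal _ X (RtoC (Rpower t (a - 1)) : C_AbsRing) (@scal _ X c (G t))).
by rewrite !scal_assoc; congr scal; apply: Cmult_comm.
Qed.

Let T := op_closure B.

Let T_approx x y (e : posreal) : T x y ->
  exists x' y', B x' y' /\ norm (minus x' x) < e /\ norm (minus y' y) < e.
Proof.
move=> h; have [Mf hMf] : exists Mf, 0 < Mf /\ @norm_factor _ X <= Mf.
  by exists (Rmax 1 (@norm_factor _ X)); split; [apply: Rlt_le_trans (Rmax_l _ _); lra | apply: Rmax_r].
have e0 : 0 < e / Mf by apply: Rdiv_lt_0_compat; [exact: cond_pos | exact: hMf.1].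
have [x' [y' [hB [hx hy]]]] := h (mkposreal _ e0).
have hle : @norm_factor _ X * (e / Mf) <= e.
  apply: Rle_trans (_ : Mf * (e / Mf) <= _); last by right; field; lra.
  by apply: Rmult_le_compat_r hMf.2; left.
exists x', y'; split => //; split.
  exact: Rlt_le_trans (norm_compat2 _ _ _ hx) hle.
exact: Rlt_le_trans (norm_compat2 _ _ _ hy) hle.
Qed.

Let T_of x y : (forall e : posreal,
  exists x' y', B x' y' /\ norm (minus x' x) <= e /\ norm (minus y' y) <= e) -> T x y.
Proof.
move=> h e; have [x' [y' [hB [hx hy]]]] := h (pos_div_2 e).
have e0 := cond_pos e; rewrite /= in hx hy.
by exists x', y'; split => //; split; apply: norm_compat1; [apply: Rle_lt_trans hx _ | apply: Rle_lt_trans hy _]; lra.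
Qed.

Let minus_plus_norm (x y x' y' : X) :
  norm (minus (plus x y) (plus x' y')) <= norm (minus x x') + norm (minus y y').
Proof.
have -> : minus (plus x y) (plus x' y') = plus (minus x x') (minus y y').
  rewrite /minus opp_plus -!plus_assoc; congr plus.
  by rewrite !plus_assoc; congr plus; apply: plus_comm.
exact: norm_triangle.
Qed.

Let minus_scal (c : C_AbsRing) (x y : X) : minus (scal c x) (scal c y) = scal c (minus x y).
Proof. by rewrite /minus scal_distr_l scal_opp_r. Qed.

Let T_plus x y x' y' : T x y -> T x' y' -> T (plus x x') (plus y y').
Proof.
move=> h h'; apply: T_of => e.
have [u [v [hB [hx hy]]]] := T_approx (pos_div_2 e) h.
have [u' [v' [hB' [hx' hy']]]] := T_approx (pos_div_2 e) h'.
rewrite /= in hx hy hx' hy'.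
exists (plus u u'), (plus v v'); split; first exact: B_plus.
by split; apply: Rle_trans (minus_plus_norm _ _ _ _) _; lra.
Qed.

Let T_scal (c : C) x y : T x y -> T (scal (c : C_AbsRing) x) (scal (c : C_AbsRing) y).
Proof.
move=> h; apply: T_of => e.
have c0 := @abs_ge_0 C_AbsRing c.
have e0 : 0 < e / (@abs C_AbsRing c + 1).
  by apply: Rdiv_lt_0_compat; [exact: cond_pos | lra].
have [u [v [hB [hx hy]]]] := T_approx (mkposreal _ e0) h.
rewrite /= in hx hy.
have hle t : t < e / (@abs C_AbsRing c + 1) -> 0 <= t -> @abs C_AbsRing c * t <= e.
  move=> ht t0; apply: Rle_trans (_ : (@abs C_AbsRing c + 1) * (e / (@abs C_AbsRing c + 1)) <= _).
    by apply: Rmult_le_compat; lra.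
  by right; field; lra.
exists (scal (c : C_AbsRing) u), (scal (c : C_AbsRing) v); split; first exact: B_scal.
split; rewrite minus_scal; apply: Rle_trans (norm_scal _ _) _; apply: hle => //; exact: norm_ge_0.
Qed.

Let B_zero : B zero zero.
Proof.
have [y hy] := B_dom (dom_zero A_lin).
have := B_scal (RtoC 0) hy.
have e (t : X) : scal (RtoC 0 : C_AbsRing) t = zero by exact: scal_zero_l.
by rewrite !e.
Qed.

Let T_zero : T zero zero.
Proof.
by apply: T_of => e; exists zero, zero; split; [exact: B_zero |];
   rewrite minus_eq_zero norm_zero; split; left; apply: cond_pos.
Qed.

Let small_le (u v : R) K : 0 <= K -> (forall e : posreal, e <= 1 -> u <= v + K * e) -> u <= v.
Proof.
move=> hK h; case: (Rle_lt_dec u v) => // lt.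
have d0 : 0 < Rmin 1 ((u - v) / (2 * (K + 1))).
  by apply: Rmin_glb_lt; [lra | apply: Rdiv_lt_0_compat; lra].
have := h (mkposreal _ d0) (Rmin_l _ _) => /=.
have h1 := Rmin_r 1 ((u - v) / (2 * (K + 1))).
have h2 := Rmult_le_compat_l _ _ _ hK h1.
have h3 : K * ((u - v) / (2 * (K + 1))) < u - v.
  have -> : K * ((u - v) / (2 * (K + 1))) = (u - v) * (K / (2 * (K + 1))) by field; lra.
  rewrite -[X in _ < X]Rmult_1_r; apply: Rmult_lt_compat_l; first lra.
  apply: (Rmult_lt_reg_r (2 * (K + 1))); first lra.
  rewrite /Rdiv Rmult_assoc Rinv_l; lra.
lra.
Qed.

Let ri_minusl x y z : ri (minus x y) z = ri x z - ri y z.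
Proof. by rewrite /minus ri_plusl ri_oppl. Qed.

(** [B] is symmetric and densely defined, hence closable. *)
Let T_fun0 y : T zero y -> y = zero.
Proof.
move=> h; apply: norm_eq_zero.
have orth x' y' : B x' y' -> ri y x' <= 0.
  move=> h'; have n1 := norm_ge_0 x'; have n2 := norm_ge_0 y'.
  apply: (@small_le _ _ (norm x' + norm y')); first lra.
  move=> e _; have [u [v [hB [hu hv]]]] := T_approx e h.
  have e0 := cond_pos e.
  have es := B_sym hB h'.
  have q1 := ri_CSabs (minus v y) x'; rewrite ri_minusl in q1.
  have q2 := ri_CSabs (minus u zero) y'; rewrite ri_minusl ri_zerol in q2.
  have {}q1 := Rle_trans _ _ _ q1 (Rmult_le_compat_r _ _ _ n1 (Rlt_le _ _ hv)).
  have {}q2 := Rle_trans _ _ _ q2 (Rmult_le_compat_r _ _ _ n2 (Rlt_le _ _ hu)).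
  have := Rabs_le_between (ri v x' - ri y x') (e * norm x').
  have := Rabs_le_between (ri u y' - 0) (e * norm y').
  move=> /proj1 /(_ q2) p2 /proj1 /(_ q1) p1; lra.
have ny := norm_ge_0 y.
have hle : norm y ^ 2 <= 0.
  apply: (@small_le _ _ (norm y)) => // e _.
  have [Mf [Mf0 hMf]] : exists Mf, 0 < Mf /\ @norm_factor _ X <= Mf.
    by exists (Rmax 1 (@norm_factor _ X)); split; [apply: Rlt_le_trans (Rmax_l _ _); lra | apply: Rmax_r].
  have e0 : 0 < e / Mf by apply: Rdiv_lt_0_compat; [exact: cond_pos | ].
  have [x' [hx' hb]] := psa_dense hA y (mkposreal _ e0).
  have {}hb : norm (minus x' y) <= e.
    apply: Rle_trans (Rlt_le _ _ (norm_compat2 _ _ _ hb)) _.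
    apply: Rle_trans (_ : Mf * (e / Mf) <= _); last by right; field; lra.
    by apply: Rmult_le_compat_r => //; left.
  have [y' hy'] := B_dom hx'.
  have q0 := orth _ _ hy'.
  have q1 := ri_CSabs (minus x' y) y; rewrite ri_minusl ri_norm in q1.
  have {}q1 := Rle_trans _ _ _ q1 (Rmult_le_compat_r _ _ _ ny hb).
  have := Rabs_le_between (ri x' y - norm y ^ 2) (e * norm y).
  move=> /proj1 /(_ q1); rewrite (ri_sym x' y); lra.
nra.
Qed.

Let T_low : exists k, 0 < k /\ forall x y, T x y -> k * norm x ^ 2 <= norm y * norm x.
Proof.
have [k [k0 hk]] := B_low; exists k; split => // x y h.
have n1 := norm_ge_0 x; have n2 := norm_ge_0 y.
apply: (@small_le _ _ (2 * k * norm x + norm y + norm x + 1)).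
  have := Rmult_le_pos k (norm x) (Rlt_le _ _ k0) n1; lra.
move=> e e1; have e0 := cond_pos e.
have [u [v [hB [hu hv]]]] := T_approx e h.
have q := Rle_trans _ _ _ (hk _ _ hB) (ri_CS v u).
have tri (s t : X) : norm (minus s t) < e -> norm s <= norm t + e /\ norm t <= norm s + e.
  move=> hst; split.
    have -> : s = plus t (minus s t) by rewrite /minus plus_comm -plus_assoc plus_opp_l plus_zero_r.
    by apply: Rle_trans (norm_triangle _ _) _; apply: Rplus_le_compat_l; left.
  have -> : t = plus s (minus t s) by rewrite /minus plus_comm -plus_assoc plus_opp_l plus_zero_r.
  apply: Rle_trans (norm_triangle _ _) _; apply: Rplus_le_compat_l; left.
  by rewrite -norm_opp opp_minus.
have [u1 u2] := tri _ _ hu; have [v1 v2] := tri _ _ hv.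
have n3 := norm_ge_0 u; have n4 := norm_ge_0 v.
move: q u1 u2 v1 v2 n1 n2 n3 n4.
move: (norm x) (norm y) (norm u) (norm v) => X0 Y0 U V q u1 u2 v1 v2 n1 n2 n3 n4.
have w1 : V * U <= (Y0 + e) * (X0 + e) by apply: Rmult_le_compat.
have w2 : (Y0 + e) * (X0 + e) <= Y0 * X0 + (Y0 + X0 + 1) * e by nra.
have w3 : X0 ^ 2 <= U ^ 2 + 2 * X0 * e.
  case: (Rle_lt_dec X0 e) => hXe; first by nra.
  have : (X0 - e) ^ 2 <= U ^ 2 by apply: pow_incr; lra.
  nra.
have := Rmult_le_compat_l _ _ _ (Rlt_le _ _ k0) w3; lra.
Qed.

Let T_opp x y : T x y -> T (opp x) (opp y).
Proof. by rewrite !oppE; apply: T_scal. Qed.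

Lemma closure_linear : linear_op T.
Proof.
split.
- move=> x y y' h h'.
  have := T_plus h (T_opp h'); rewrite plus_opp_r => /T_fun0 e.
  by apply: (plus_reg_r (opp y')); rewrite plus_opp_r.
- exact: T_zero.
- exact: T_plus.
- exact: T_scal.
Qed.

Lemma closure_injective : injective_op T.
Proof.
move=> x x' y h h'.
have [k [k0 hk]] := T_low.
have := hk _ _ (T_plus h (T_opp h')); rewrite plus_opp_r norm_zero Rmult_0_l => hle.
have n := norm_ge_0 (plus x (opp x')).
have e : plus x (opp x') = zero.
  apply: norm_eq_zero; move: hle n; set t := norm _ => hle n.
  case: (Rle_lt_dec t 0) => h0; first lra.
  have := Rmult_lt_0_compat _ _ k0 (pow_lt _ 2 h0); lra.
by apply: (plus_reg_r (opp x')); rewrite plus_opp_r.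
Qed.
End Power.

Lemma frac_power0_linear a : linear_op (frac_power0 A a).
Proof.
rewrite /frac_power0; case: Rle_dec => h0; last case: Rle_dec => h1.
- by split => //; [move=> x y y' -> -> | move=> x y x' y' -> -> | move=> c x y ->].
- exact: psa_linear.
- by apply: closure_linear; lra.
Qed.

Lemma frac_power0_injective a : injective_op (frac_power0 A a).
Proof.
rewrite /frac_power0; case: Rle_dec => h0; last case: Rle_dec => h1.
- by move=> x x' y -> ->.
- exact: A_inj.
- by apply: closure_injective; lra.
Qed.

(** X^a; [frac_power0 A a] is single-valued and injective, so [x |-> ||A^a x||] is a norm. *)
Definition frac_space (a : R) : NormedModule C_AbsRing :=
  domain_space (frac_power0_linear a) (@frac_power0_injective a).
End FracSpaces.

Section PhaseSpace.
Variables (X : Hilbert) (A : operator X) (hA : positive_selfadjoint A) (n : nat).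

(** Indices run over [0 <= i < n], so the factor [i] is X^((n-i-1)/n). *)
Definition phase_space : NormedModule C_AbsRing :=
  l2_prod (fun i : 'I_n => frac_space hA ((INR n - INR i.+1) / INR n)).

Definition coord (v : phase_space) (i : 'I_n) : X := proj1_sig (v i).

Definition Lambda : operator phase_space := fun v w =>
  (forall i : 'I_n, dom (frac_power A ((INR n - INR i) / INR n)) (coord v i)) /\
  (forall i j : 'I_n, nat_of_ord j = i.+1 -> coord w i = opp (coord v j)) /\
  (forall i j : 'I_n, nat_of_ord i = 0%N -> j.+1 = n -> A (coord v i) (coord w j)).

Definition Lambda_inv_entry (i j : 'I_n) : operator X :=
  if (nat_of_ord i == 0%N) && (j.+1 == n) then op_inv A
  else if nat_of_ord i == j.+1 then op_scal (RtoC (-1)) op_id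
  else op_zero.
End PhaseSpace.

Fixpoint chebyshevU (m : nat) (x : C) : C :=
  match m with
  | 0%N => RtoC 1
  | 1%N => (RtoC 2 * x)%C
  | 2%N => (RtoC 4 * Cpow x 2 - RtoC 1)%C
  | 3%N => (RtoC 8 * Cpow x 3 - RtoC 4 * x)%C
  | (p.+1 as q).+1 => (RtoC 2 * x * chebyshevU q x - chebyshevU p x)%C
  end.

Definition Lambda_power_entry (X : Hilbert) (A : operator X) (n : nat) (a : R)
    (i j : 'I_n) : operator X :=
  op_scal
    (RtoC (powerRZ (-1) (Z.of_nat i - Z.of_nat j) / INR n) *
     chebyshevU n.-1 (RtoC (cos ((a + INR i - INR j) * PI / INR n))))%C
    (frac_power A ((a + INR i - INR j) / INR n)).

(* Main.v *)
(** Put [T = A^-1].  In the coordinates [u_i = A^((n-i)/n) v_i], [Y] becomes [X^n] and [Lambda_n]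
    becomes [A^(1/n)] times a constant matrix [N], where [-N] shifts the components cyclically
    with a sign, so [(-N)^n = -1].  Hence the entries of [(l + Lambda_n)^-1] are, up to sign, the
    functions [l^(m-1) T^(m/n) / (1 + l^n T)], [1 <= m <= n], and the integral for [Lambda_n^(-al)]
    is computed entrywise from [int_0^oo x^(a-1) / (1 + x) dx = pi / sin (pi a)].  The result is
    [A^(-al/n)] times a constant matrix; by the finite Fourier identity for
    [U_(n-1)(cos x) = sin (n x) / sin x] these matrices form a one-parameter group in [al], which
    gives the inverse, [Lambda_n^al].

    Functions of [T] are limits of Bernstein polynomials: if [T <= c], the operators
    [T^j (c - T)^k] are positive, which turns scalar estimates into operator norm estimates. *)

(* The unbounded operators are never handled directly. [A^a], [Lambda_n] and [Lambda_n^al] are each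
   shown to be a relation [x = R y] with [R] bounded, linear and injective, so that domains,
   closedness and identities between powers become equations between functions of [T] and constant
   matrices.

   Integrals are not exchanged with the functional calculus. The scalar integrand has an explicit
   primitive in [l]; functions of [T] inherit derivatives and limits in [l] as soon as the scalar
   estimates are uniform over the spectrum, and the integral is read off from the limits of the
   primitive. The delicate place is [t] near 0, where [l^n t] may stay small although [l] is large;
   the factor [t^(al/n)] restores uniformity there.

   The same computation with [n = 1] evaluates Balakrishnan's formula for [A] itself, and so
   identifies the [A^a] of the statement with the inverse of [T^a]. *)
Require Import Defs.
From HB Require Import structures.
From Stdlib Require Import Reals Lra Lia Classical ClassicalEpsilon FunctionalExtensionality.
From mathcomp Require Import all_boot.
From Coquelicot Require Import Coquelicot.
Set Implicit Arguments.
Unset Strict Implicit.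
Unset Printing Implicit Defensive.
Local Open Scope R_scope.

(** * The integral of x^(a-1) / (1 + x) *)

(** [t^b] on [[0, oo)]; [Rpower 0 b] has the junk value [1]. *)
Definition pw (b t : R) : R :=
  if Req_EM_T b 0 then 1 else if Rle_dec t 0 then 0 else Rpower t b.

Lemma pw_pos_def b t : 0 < t -> pw b t = Rpower t b.
Proof.
move=> ht; rewrite /pw; case: Req_EM_T => [h|hne] /=.
  by suff -> : Rpower t b = 1; [| rewrite h Rpower_O].
by case: Rle_dec => // h; lra.
Qed.

Lemma pw_0 b : 0 < b -> pw b 0 = 0.
Proof.
by move=> hb; rewrite /pw; case: Req_EM_T => [h|hne] /=; [lra | case: Rle_dec => // h; lra].
Qed.

Lemma pw_O t : pw 0 t = 1.
Proof. by rewrite /pw; case: Req_EM_T. Qed.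

Lemma pw_1 t : 0 <= t -> pw 1 t = t.
Proof.
case=> [ht|<-]; first by rewrite pw_pos_def // Rpower_1.
by apply: pw_0; lra.
Qed.

Lemma pw_ge0 b t : 0 <= pw b t.
Proof.
rewrite /pw; case: Req_EM_T => h /=; first lra.
by case: Rle_dec => h' /=; [lra | left; apply: exp_pos].
Qed.

Lemma pw_add b c t : 0 <= b -> 0 <= c -> 0 <= t -> pw (b + c) t = pw b t * pw c t.
Proof.
move=> hb hc [ht|<-].
  by rewrite !pw_pos_def // Rpower_plus.
case: hb => [hb|<-]; last by rewrite pw_O Rplus_0_l Rmult_1_l.
by rewrite (pw_0 hb) pw_0; lra.
Qed.

Lemma pw_le b s t : 0 <= b -> 0 <= s <= t -> pw b s <= pw b t.
Proof.
case=> [hb|<-] [[hs|<-] ht]; rewrite ?pw_O; try lra.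
  rewrite !pw_pos_def; try lra; apply: Rle_Rpower_l; lra.
rewrite pw_0 //; exact: pw_ge0.
Qed.

Lemma pw_le1 b t : 0 <= b -> 0 <= t <= 1 -> pw b t <= 1.
Proof.
move=> hb ht; apply: Rle_trans (pw_le hb ht) _.
rewrite pw_pos_def; last lra.
by rewrite /Rpower ln_1 Rmult_0_r exp_0; lra.
Qed.

Lemma pw_bound b t : 0 <= b <= 1 -> 0 <= t -> pw b t <= 1 + t.
Proof.
move=> hb ht; case: (Rle_lt_dec t 1) => h; first by have := @pw_le1 b t; lra.
rewrite pw_pos_def; last lra.
apply: Rle_trans (Rle_Rpower _ _ 1 _ _) _; try lra.
rewrite Rpower_1; lra.
Qed.

Lemma pw_le_exp b c x : 0 <= b <= c -> 0 <= x <= 1 -> pw c x <= pw b x.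
Proof.
move=> hbc hx; rewrite (_ : c = b + (c - b)); last ring.
rewrite pw_add; try lra.
have := @pw_le1 (c - b) x; have := @pw_ge0 b x; nra.
Qed.

Lemma pw_pow n b t : 0 <= b -> 0 <= t -> pw b t ^ n = pw (INR n * b) t.
Proof.
move=> hb ht; elim: n => [|n ih]; first by rewrite /= Rmult_0_l pw_O.
rewrite S_INR [_ ^ _]/= ih Rmult_plus_distr_r Rmult_1_l Rplus_comm pw_add //.
apply: Rmult_le_pos => //; exact: pos_INR.
Qed.

Lemma pw_inv b t : 0 < t -> pw b (/ t) = / pw b t.
Proof.
move=> ht; have h := Rinv_0_lt_compat _ ht.
rewrite !pw_pos_def // /Rpower ln_Rinv // -exp_Ropp; congr exp; ring.
Qed.

Lemma pw_deriv b t : 0 < t -> is_derive (pw b) t (b * Rpower t (b - 1)).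
Proof.
move=> ht; apply: (is_derive_ext_loc (fun s => Rpower s b)).
  exists (mkposreal _ ht) => s /=.
  rewrite /ball /= /AbsRing_ball /abs /minus /plus /opp /= => /Rabs_def2 [h1 h2].
  by rewrite pw_pos_def //; lra.
by apply/is_derive_Reals; apply: derivable_pt_lim_power.
Qed.

Lemma pw_small b e : 0 < b -> 0 < e -> exists d, 0 < d /\ forall t, t < d -> pw b t < e.
Proof.
move=> hb he; exists (Rpower e (/ b)); split; first exact: exp_pos.
move=> t ht; rewrite /pw; case: Req_EM_T => h /=; first lra.
case: Rle_dec => t0 /=; first lra.
have -> : e = Rpower (Rpower e (/ b)) b.
  by rewrite Rpower_mult Rinv_l // Rpower_1.
by apply: Rlt_Rpower_l; lra.
Qed.

Lemma pw_cont b t : 0 <= b -> continuous (pw b) t.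
Proof.
case=> [hb|<-]; last first.
  apply: (continuous_ext (fun _ => 1)); first by move=> s; rewrite pw_O.
  exact: continuous_const.
case: (Rtotal_order t 0) => [ht|[->|ht]].
- apply: (continuous_ext_loc _ (fun _ => 0)); last exact: continuous_const.
  have h : 0 < - t by lra.
  exists (mkposreal _ h) => s /=.
  rewrite /ball /= /AbsRing_ball /abs /minus /plus /opp /= => /Rabs_def2 [h1 h2].
  rewrite /pw; case: Req_EM_T => ? /=; first lra.
  by case: Rle_dec => ? /=; lra.
- apply/filterlim_locally => e; have [d [d0 hd]] := pw_small hb (cond_pos e).
  exists (mkposreal _ d0) => s /=.
  rewrite /ball /= /AbsRing_ball /abs /minus /plus /opp /= => /Rabs_def2 [h1 h2].
  rewrite pw_0 // Ropp_0 Rplus_0_r Rabs_pos_eq; last exact: pw_ge0.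
  by apply: hd; lra.
- apply: (@ex_derive_continuous R_AbsRing R_NormedModule).
  by eexists; apply: pw_deriv.
Qed.

Section Reflection.

Let kern (a x : R) := pw a x / (1 + x).

Lemma kern_cont a x : 0 <= a -> -1 < x -> continuous (kern a) x.
Proof.
move=> ha hx; apply: (continuous_mult (pw a) (fun x => / (1 + x))); first exact: pw_cont.
apply: continuous_Rinv_comp; last lra.
apply: (continuous_plus (fun _ => 1) (fun x => x)); [exact: continuous_const | exact: continuous_id].
Qed.

Lemma kern_int a y z : 0 <= a -> -1 < y -> -1 < z -> ex_RInt (kern a) y z.
Proof.
move=> ha hy hz; apply: ex_RInt_continuous => x [hx _]; apply: kern_cont => //.
apply: Rlt_le_trans hx; exact: Rmin_glb_lt.
Qed.

(** The integral of [x^(a-1) / (1 + x)] over [(0, z)], written without the singularity at [0]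
    by means of [x^(a-1) / (1 + x) = x^(a-1) - x^a / (1 + x)]. *)
Definition stieltjes (a z : R) : R := pw a z / a - RInt (kern a) 0 z.

Lemma stieltjes_cont a z : 0 < a -> -1 < z -> continuous (stieltjes a) z.
Proof.
move=> ha hz; apply: (continuous_minus (fun z => pw a z / a) (fun z => RInt (kern a) 0 z)).
  apply: (continuous_mult (pw a) (fun _ => / a)); last exact: continuous_const.
  by apply: pw_cont; lra.
have z0 : 0 < z + 1 by lra.
apply: (continuous_RInt_1 _ _ _ (fun z => RInt (kern a) 0 z)).
exists (mkposreal _ z0) => s /=.
rewrite /ball /= /AbsRing_ball /abs /minus /plus /opp /= => /Rabs_def2 [h1 h2].
by apply: RInt_correct; apply: kern_int; lra.
Qed.

Lemma stieltjes_deriv a z : 0 < a -> 0 < z ->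
  is_derive (stieltjes a) z (Rpower z (a - 1) / (1 + z)).
Proof.
move=> ha hz.
have h1 : is_derive (fun z => RInt (kern a) 0 z) z (kern a z).
  apply: (is_derive_RInt _ _ 0); last by apply: kern_cont; lra.
  exists (mkposreal _ hz) => s /=.
  rewrite /ball /= /AbsRing_ball /abs /minus /plus /opp /= => /Rabs_def2 [h1 h2].
  by apply: RInt_correct; apply: kern_int; lra.
have h2 := is_derive_minus _ _ _ _ _ (is_derive_scal _ _ (/ a) _ (pw_deriv a hz)) h1.
rewrite /stieltjes.
apply: (is_derive_ext (fun z => minus (/ a * pw a z) (RInt (kern a) 0 z))).
  by move=> t; rewrite /minus /plus /opp /=; field; lra.
suff -> : Rpower z (a - 1) / (1 + z) = minus (/ a * (a * Rpower z (a - 1))) (kern a z) by [].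
rewrite /kern pw_pos_def //.
have -> : Rpower z a = Rpower z (a - 1) * z.
  by rewrite -[X in _ * X](Rpower_1 z hz) -Rpower_plus; congr Rpower; ring.
rewrite /minus /plus /opp /=; field; lra.
Qed.

(** For the lower bound, the derivative is nonnegative but may be singular at 0, so monotonicity is
    used on [[s, z]] only and combined with the crude bound [- s <= stieltjes a s] for small [s]. *)
Lemma stieltjes_bound a z : 0 < a -> 0 <= z -> 0 <= stieltjes a z <= pw a z / a.
Proof.
move=> ha hz; split; last first.
  rewrite /stieltjes; suff : 0 <= RInt (kern a) 0 z by lra.
  apply: RInt_ge_0 => //; first by apply: kern_int; lra.
  by move=> x hx; apply: Rdiv_le_0_compat; [exact: pw_ge0 | lra].
rewrite /stieltjes.
suff : RInt (kern a) 0 z <= pw a z / a by lra.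
case: hz => [hz|<-]; last by rewrite RInt_point /zero /= pw_0 //; lra.
apply: Rnot_lt_le => hlt.
(* otherwise [stieltjes a], increasing, stays below a negative constant near 0 *)
set e := RInt (kern a) 0 z - pw a z / a.
have hd s : 0 < s -> is_derive (stieltjes a) s (Rpower s (a - 1) / (1 + s)) by apply: stieltjes_deriv.
have mono s : 0 < s < z -> stieltjes a s <= - e.
  move=> hs.
  have [c [hc1 hc2]] : exists c, s <= c <= z /\ stieltjes a z - stieltjes a s =
      Rpower c (a - 1) / (1 + c) * (z - s).
    have := @MVT_gen (stieltjes a) s z (fun s => Rpower s (a - 1) / (1 + s)).
    rewrite Rmin_left; last lra. rewrite Rmax_right; last lra.
    case=> [x hx|x hx|c hc]; first by apply: hd; lra.
      apply/continuity_pt_filterlim; apply: (@ex_derive_continuous R_AbsRing R_NormedModule).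
      by eexists; apply: hd; lra.
    by exists c.
  have : 0 <= Rpower c (a - 1) / (1 + c) * (z - s).
    apply: Rmult_le_pos; last lra.
    apply: Rdiv_le_0_compat; [left; apply: exp_pos | lra].
  rewrite -hc2 /e {1}/stieltjes; lra.
have e0 : 0 < e by rewrite /e; lra.
have small s : 0 < s < 1 -> - s <= stieltjes a s.
  move=> hs; rewrite /stieltjes.
  have h1 := pw_ge0 a s.
  have h2 : 0 <= pw a s / a by apply: Rdiv_le_0_compat.
  have : RInt (kern a) 0 s <= RInt (fun _ => 1) 0 s.
    apply: RInt_le; [lra | apply: kern_int; lra | exact: ex_RInt_const |].
    move=> x hx; rewrite /kern; apply/Rle_div_l; first lra.
    have := @pw_le1 a x; lra.
  rewrite RInt_const /scal /= /mult /=; lra.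
pose s := Rmin (e / 2) (Rmin (z / 2) (/ 2)).
have h1 : s <= e / 2 by apply: Rmin_l.
have h2 : s <= Rmin (z / 2) (/ 2) by apply: Rmin_r.
have h3 := Rmin_l (z / 2) (/ 2); have h4 := Rmin_r (z / 2) (/ 2).
have s0 : 0 < s by rewrite /s; do 2 (apply: Rmin_glb_lt; first lra); lra.
have := small s; have := mono s; lra.
Qed.

Lemma const_pos (F : R -> R) :
  (forall y, 0 < y -> is_derive F y 0) -> forall y z, 0 < y -> 0 < z -> F y = F z.
Proof.
move=> hF.
have lt y z : 0 < y -> y < z -> F y = F z.
  move=> hy hyz; apply: (@eq_is_derive R_NormedModule) => // t ht; apply: hF; lra.
move=> y z hy hz; case: (Rtotal_order y z) => [h|[->|h]] //; first exact: lt.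
by symmetry; apply: lt.
Qed.

Let b a := stieltjes a 1.

(** The second term is the integral of [x^(a-1) / (1 + x)] over [(z, oo)] after replacing [x] by
    [1 / x]; the sum is the whole integral, independent of [z]. *)
Lemma stieltjes_inversion a z : 0 < a < 1 -> 0 < z ->
  stieltjes a z + stieltjes (1 - a) (/ z) = b a + b (1 - a).
Proof.
move=> ha hz.
pose F z := stieltjes a z + stieltjes (1 - a) (/ z).
have -> : b a + b (1 - a) = F 1 by rewrite /F Rinv_1.
apply: (@const_pos F _ _ _ hz); last lra.
move=> y hy; have hy' := Rinv_0_lt_compat _ hy.
have h1 := stieltjes_deriv (proj1 ha) hy.
have ha' : 0 < 1 - a by lra.
have h2 : is_derive (fun y => stieltjes (1 - a) (/ y)) y
   (scal (- / y ^ 2) (Rpower (/ y) (1 - a - 1) / (1 + / y))).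
  apply: (is_derive_comp (stieltjes (1 - a)) Rinv); first exact: stieltjes_deriv.
  rewrite (_ : - / y ^ 2 = - (1) / y ^ 2); last by field; lra.
  apply: is_derive_inv; [exact: is_derive_id | lra].
have := is_derive_plus _ _ _ _ _ h1 h2.
suff -> : plus (Rpower y (a - 1) / (1 + y)) (scal (- / y ^ 2) (Rpower (/ y) (1 - a - 1) / (1 + / y))) = 0 by [].
rewrite /plus /scal /= /mult /=.
have -> : Rpower (/ y) (1 - a - 1) = Rpower y (a - 1) * y.
  rewrite -[X in _ * X](Rpower_1 y hy) -Rpower_plus /Rpower ln_Rinv //; congr exp; ring.
field; lra.
Qed.

(** Substitute [x = y^3] on the right and use [1 + y^3 = (1 + y) (1 - y + y^2)]: the three
    integrands add up to [3 y^(a-1) / (1 + y)]. *)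
Lemma stieltjes_tripling a : 0 < a < 1 ->
  3 * b a = b (a / 3) - b ((a + 1) / 3) + b ((a + 2) / 3).
Proof.
move=> ha.
pose F y := stieltjes (a / 3) (y ^ 3) - stieltjes ((a + 1) / 3) (y ^ 3)
  + stieltjes ((a + 2) / 3) (y ^ 3) - 3 * stieltjes a y.
have hF1 : F 1 = b (a / 3) - b ((a + 1) / 3) + b ((a + 2) / 3) - 3 * b a.
  by rewrite /F /b (_ : 1 ^ 3 = 1); [| ring].
suff : F 1 = 0 by lra.
have hconst y : 0 < y -> F y = F 1.
  move=> hy; apply: (@const_pos F _ _ _ hy); last lra.
  move=> {}y {}hy.
  have y3 : 0 < y ^ 3 by apply: pow_lt.
  have hc c : 0 < c -> is_derive (fun y => stieltjes c (y ^ 3)) y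
      (3 * y ^ 2 * (Rpower (y ^ 3) (c - 1) / (1 + y ^ 3))).
    move=> c0; apply: (is_derive_comp (stieltjes c) (fun y => y ^ 3)).
      exact: stieltjes_deriv.
    by auto_derive => //; ring.
  have e c d : d = 3 * c -> 3 * y ^ 2 * (Rpower (y ^ 3) (c - 1) / (1 + y ^ 3)) =
     3 / (1 + y ^ 3) * Rpower y (d - 1).
    move=> ->; have -> : Rpower y (3 * c - 1) = Rpower (y ^ 3) (c - 1) * y ^ 2.
      rewrite -(Rpower_pow 3) // -(Rpower_pow 2) // Rpower_mult -Rpower_plus; congr Rpower.
      by rewrite /=; ring.
    by field; lra.
  have h1 : 0 < a / 3 by lra.
  have h2 : 0 < (a + 1) / 3 by lra.
  have h3 : 0 < (a + 2) / 3 by lra.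
  have H := is_derive_minus _ _ _ _ _
    (is_derive_plus _ _ _ _ _ (is_derive_minus _ _ _ _ _ (hc _ h1) (hc _ h2)) (hc _ h3))
    (is_derive_scal _ _ 3 _ (stieltjes_deriv (proj1 ha) hy)).
  move: H; rewrite (e _ a); last lra. rewrite (e _ (a + 1)); last lra.
  rewrite (e _ (a + 2)); last lra.
  set rhs := minus _ _; suff -> : rhs = 0 by [].
  rewrite /rhs /minus /plus /opp /=.
  have -> : Rpower y (a + 1 - 1) = Rpower y (a - 1) * y.
    by rewrite -[X in _ * X](Rpower_1 y hy) -Rpower_plus; congr Rpower; ring.
  have -> : Rpower y (a + 2 - 1) = Rpower y (a - 1) * y ^ 2.
    by rewrite -(Rpower_pow 2 y hy) -Rpower_plus; congr Rpower; rewrite /=; ring.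
  have ne : 1 + y ^ 3 <> 0 by lra.
  by field; lra.
(* [F] is constant on the positive axis and each of its terms tends to 0 at 0. Their coefficients
   [1, 1, 1, 3] account for the [e / 6] below. *)
have lim : forall e, 0 < e -> Rabs (F 1) <= e.
  move=> e e0.
  have hb c : 0 < c -> exists d, 0 < d /\ forall y, 0 < y < d -> 0 <= stieltjes c y <= e / 6.
    move=> c0; have [d [d0 hd]] := @pw_small c (e / 6 * c) c0 ltac:(nra).
    exists d; split => // y hy; have [h1 h2] := @stieltjes_bound c y c0 ltac:(lra).
    split => //; apply: Rle_trans h2 _.
    apply/Rle_div_l => //; left; apply: hd; lra.
  have [d1 [d10 h1]] := hb (a / 3) ltac:(lra).
  have [d2 [d20 h2]] := hb ((a + 1) / 3) ltac:(lra).
  have [d3 [d30 h3]] := hb ((a + 2) / 3) ltac:(lra).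
  have [d4 [d40 h4]] := hb a ltac:(lra).
  pose y := Rmin (/ 2) (Rmin (Rmin d1 d2) (Rmin d3 d4)) / 2.
  have y0 : 0 < y.
    rewrite /y; apply: Rdiv_lt_0_compat; last lra.
    by repeat (apply: Rmin_glb_lt; try lra).
  have : 2 * y <= / 2 /\ 2 * y <= d1 /\ 2 * y <= d2 /\ 2 * y <= d3 /\ 2 * y <= d4.
    have -> : 2 * y = Rmin (/ 2) (Rmin (Rmin d1 d2) (Rmin d3 d4)) by rewrite /y; field.
    have := Rmin_l (/ 2) (Rmin (Rmin d1 d2) (Rmin d3 d4)).
    have := Rmin_r (/ 2) (Rmin (Rmin d1 d2) (Rmin d3 d4)).
    have := Rmin_l (Rmin d1 d2) (Rmin d3 d4); have := Rmin_r (Rmin d1 d2) (Rmin d3 d4).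
    have := Rmin_l d1 d2; have := Rmin_r d1 d2; have := Rmin_l d3 d4; have := Rmin_r d3 d4.
    lra.
  move=> [g0 [g1 [g2 [g3 g4]]]].
  have y3 : 0 < y ^ 3 <= y.
    split; first exact: pow_lt.
    have : y ^ 2 <= 1 by nra.
    rewrite /=; nra.
  rewrite -(hconst y) // /F; apply: Rabs_le.
  have := h1 (y ^ 3); have := h2 (y ^ 3); have := h3 (y ^ 3); have := h4 y; lra.
apply: NNPP => ne; have := lim (Rabs (F 1) / 2).
have := Rabs_pos_lt _ ne; lra.
Qed.
End Reflection.

(** * Lipschitz estimates on (0, 1) and the cosecant *)

Definition lipschitz01 (f : R -> R) (k : R) : Prop :=
  forall a b, 0 < a < 1 -> 0 < b < 1 -> Rabs (f a - f b) <= k * Rabs (a - b).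

Lemma lipschitz01_plus f g k l :
  lipschitz01 f k -> lipschitz01 g l -> lipschitz01 (fun a => f a + g a) (k + l).
Proof.
move=> hf hg a b ha hb; have := hf a b ha hb; have := hg a b ha hb.
have := Rabs_triang (f a - f b) (g a - g b).
rewrite (_ : f a - f b + (g a - g b) = f a + g a - (f b + g b)); last ring.
lra.
Qed.

Lemma lipschitz01_opp f k : lipschitz01 f k -> lipschitz01 (fun a => - f a) k.
Proof.
move=> hf a b ha hb; rewrite (_ : - f a - - f b = - (f a - f b)); last ring.
by rewrite Rabs_Ropp; apply: hf.
Qed.

Lemma lipschitz01_deriv f df k :
  (forall a, 0 < a < 1 -> is_derive f a (df a)) -> (forall a, 0 < a < 1 -> Rabs (df a) <= k) ->
  lipschitz01 f k.
Proof.
move=> hd hk a b ha hb.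
have := @MVT_gen f b a df; case.
- move=> x hx; apply: hd; move: hx; rewrite /Rmin /Rmax; case: Rle_dec => ?; lra.
- move=> x hx; apply/continuity_pt_filterlim.
  apply: (@ex_derive_continuous R_AbsRing R_NormedModule); exists (df x); apply: hd.
  move: hx; rewrite /Rmin /Rmax; case: Rle_dec => ?; lra.
move=> c [hc ->]; rewrite Rabs_mult; apply: Rmult_le_compat_r; first exact: Rabs_pos.
by apply: hk; move: hc; rewrite /Rmin /Rmax; case: Rle_dec => ?; lra.
Qed.

Lemma lipschitz01_flip f k : lipschitz01 f k -> lipschitz01 (fun a => f (1 - a)) k.
Proof.
move=> hf a b ha hb; rewrite (_ : a - b = - ((1 - a) - (1 - b))); last ring.
by rewrite Rabs_Ropp; apply: hf; lra.
Qed.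

Lemma lipschitz01_wlog f k :
  (forall a b, 0 < a -> a < b -> b < 1 -> Rabs (f a - f b) <= k * (b - a)) -> lipschitz01 f k.
Proof.
move=> h a b ha hb; case: (Rtotal_order a b) => [lt|[->|gt]].
- by rewrite (Rabs_left (a - b)); [have := h a b; lra | lra].
- by rewrite !Rminus_diag Rabs_R0; lra.
- by rewrite Rabs_minus_sym (Rabs_right (a - b)); [have := h b a; lra | lra].
Qed.

Lemma sin_cube_bound x : 0 <= x <= 2 -> x - x ^ 3 / 6 <= sin x <= x.
Proof.
move=> hx; split.
  have [h _] := pre_sin_bound x 0 (proj1 hx) ltac:(lra).
  apply: Rle_trans h; right.
  by rewrite /sin_approx /= /sin_term /=; field.
case: (Rle_lt_or_eq_dec 0 x (proj1 hx)) => [h|<-]; last by rewrite sin_0; lra.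
by left; apply: sin_lt_x.
Qed.

Lemma cos_square_lower x : 0 <= x <= 2 -> 1 - x ^ 2 / 2 <= cos x.
Proof.
move=> hx; have [h _] := pre_cos_bound x 0 ltac:(lra) ltac:(lra).
apply: Rle_trans h; right.
by rewrite /cos_approx /= /cos_term /=; field.
Qed.

(** This is the derivative of [1 / sin x - 1 / x], where the poles at 0 cancel: over a common
    denominator the numerator is at most [x^4 / 2] in absolute value and the denominator at least
    [x^4 / 9], and [9 / 2 <= 5]. *)
Lemma csc_deriv_bound x : 0 < x -> x <= PI / 2 -> Rabs (/ x ^ 2 - cos x / sin x ^ 2) <= 5.
Proof.
move=> h0 h1; have hpi : PI / 2 <= 2 by have := PI_4; lra.
have hx : 0 <= x <= 2 by lra.
have [s1 s2] := sin_cube_bound hx; have c1 := cos_square_lower hx.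
have [_ c2] := COS_bound x.
have c0 : 0 <= cos x by apply: cos_ge_0; lra.
have hx2 : 0 < x ^ 2 by apply: pow_lt.
have hx24 : x ^ 2 <= 4 by nra.
have s3 : x / 3 <= sin x.
  apply: Rle_trans s1; have -> : x ^ 3 = x * x ^ 2 by ring. nra.
have s0 : 0 < sin x by lra.
have hs2 : x ^ 2 / 9 <= sin x ^ 2.
  have -> : x ^ 2 / 9 = (x / 3) ^ 2 by field.
  by apply: pow_incr; lra.
have hs2' : sin x ^ 2 <= x ^ 2 by apply: pow_incr; lra.
have low : x ^ 2 - x ^ 4 / 3 <= sin x ^ 2.
  have h : 0 <= x - x ^ 3 / 6 by have -> : x ^ 3 = x * x ^ 2; [ring | nra].
  apply: Rle_trans (_ : (x - x ^ 3 / 6) ^ 2 <= _); last by apply: pow_incr.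
  have -> : (x - x ^ 3 / 6) ^ 2 = x ^ 2 - x ^ 4 / 3 + (x ^ 3) ^ 2 / 36 by field.
  have := pow2_ge_0 (x ^ 3); lra.
have hx4 : x ^ 4 = x ^ 2 * x ^ 2 by ring.
have e : / x ^ 2 - cos x / sin x ^ 2 = (sin x ^ 2 - x ^ 2 * cos x) / (x ^ 2 * sin x ^ 2).
  by field; split; lra.
rewrite e; apply: Rabs_le; have hd : 0 < x ^ 2 * sin x ^ 2 by apply: Rmult_lt_0_compat; lra.
have n1 : sin x ^ 2 - x ^ 2 * cos x <= x ^ 4 / 2 by nra.
have n2 : - (x ^ 4 / 2) <= sin x ^ 2 - x ^ 2 * cos x.
  have : x ^ 2 * cos x <= x ^ 2 by nra.
  have := pow2_ge_0 (x ^ 2); lra.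
have d1 : x ^ 4 / 9 <= x ^ 2 * sin x ^ 2 by nra.
have h4 : 0 < x ^ 4 by apply: pow_lt.
split; first by apply/Rle_div_r => //; lra.
by apply/Rle_div_l => //; lra.
Qed.

(** Both sides of the reflection formula blow up like [1 / a] and [1 / (1 - a)] at the ends of
    [(0, 1)]; the Lipschitz estimates concern what remains without these poles. *)
Definition csc_defect a := PI / sin (PI * a) - / a - / (1 - a).
Definition csc_defect' a := - (PI * (PI * cos (PI * a))) / sin (PI * a) ^ 2 + / a ^ 2 - / (1 - a) ^ 2.

(** On [(0, 1/2]] the derivative is [PI^2] times the quantity of [csc_deriv_bound] at [PI a], minus
    [1 / (1 - a)^2], which is at most 4. It is odd under [a -> 1 - a], which covers the other
    half. *)
Lemma csc_defect_lipschitz : exists k, lipschitz01 csc_defect k.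
Proof.
have hpi := PI_RGT_0.
have spos a : 0 < a < 1 -> 0 < sin (PI * a) by move=> ha; apply: sin_gt_0; nra.
have half a : 0 < a <= / 2 -> Rabs (csc_defect' a) <= 5 * PI ^ 2 + 4.
  move=> ha; have s0 := spos a ltac:(lra).
  have h := @csc_deriv_bound (PI * a) ltac:(nra) ltac:(nra).
  have e : csc_defect' a = PI ^ 2 * (/ (PI * a) ^ 2 - cos (PI * a) / sin (PI * a) ^ 2) - / (1 - a) ^ 2.
    by rewrite /csc_defect'; field; repeat split; lra.
  rewrite e; apply: Rle_trans (Rabs_triang _ _) _; apply: Rplus_le_compat.
    rewrite Rabs_mult Rabs_pos_eq; last exact: pow2_ge_0.
    by rewrite Rmult_comm; apply: Rmult_le_compat_r => //; apply: pow2_ge_0.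
  rewrite Rabs_Ropp Rabs_pos_eq; last by left; apply: Rinv_0_lt_compat; apply: pow_lt; lra.
  rewrite (_ : 4 = / (/ 2) ^ 2); last by field.
  apply: Rinv_le_contravar; first by apply: pow_lt; lra.
  apply: pow_incr; lra.
exists (5 * PI ^ 2 + 4); apply: (@lipschitz01_deriv _ csc_defect') => a ha.
  rewrite /csc_defect /csc_defect'; have s0 := spos a ha.
  auto_derive; first by repeat split; lra.
  by field; repeat split; lra.
case: (Rle_lt_dec a (/ 2)) => h; first by apply: half; lra.
have -> : csc_defect' a = - csc_defect' (1 - a).
  rewrite /csc_defect' (_ : PI * (1 - a) = PI - PI * a); last ring.
  rewrite cos_minus sin_minus cos_PI sin_PI.
  have s0 := spos a ha; field; repeat split; lra.
by rewrite Rabs_Ropp; apply: half; lra.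
Qed.

(** Reaches [t = 0], since [pw (a + 1)] vanishes to the left of 0 and is [o(t)] to its right; the
    fundamental theorem then applies on the closed interval [[0, 1]]. *)
Lemma pw_deriv_ge0 a t : 0 < a -> 0 <= t -> is_derive (pw (a + 1)) t ((a + 1) * pw a t).
Proof.
move=> ha [ht|<-].
  rewrite [pw a t]pw_pos_def // (_ : Rpower t a = Rpower t (a + 1 - 1)); last by congr Rpower; ring.
  exact: pw_deriv.
rewrite (pw_0 ha) Rmult_0_r; split; first exact: is_linear_scal_l.
move=> x hx; have -> : x = 0 by symmetry; apply: (is_filter_lim_locally_unique (K := R_AbsRing) (V := R_NormedModule)).
move=> e; have [d [d0 hd]] := pw_small ha (cond_pos e).
exists (mkposreal _ d0) => y /=.
rewrite /ball /= /AbsRing_ball /norm /= /abs /minus /plus /opp /scal /= /mult /= => /Rabs_def2 [h1 h2].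
rewrite pw_0; last lra.
rewrite !Ropp_0 Rmult_0_r Ropp_0 !Rplus_0_r.
case: (Rle_lt_dec y 0) => hy.
  have -> : pw (a + 1) y = 0.
    by rewrite /pw; case: Req_EM_T => ? /=; [lra | case: Rle_dec => ? /=; lra].
  rewrite Rabs_R0; apply: Rmult_le_pos; [left; exact: cond_pos | exact: Rabs_pos].
rewrite pw_add; try lra. rewrite (@pw_1 y); last lra.
rewrite Rabs_mult; apply: Rmult_le_compat_r; first exact: Rabs_pos.
rewrite Rabs_pos_eq; last exact: pw_ge0.
by left; apply: hd; lra.
Qed.

Lemma pw_int01 a : 0 < a -> is_RInt (pw a) 0 1 (/ (a + 1)).
Proof.
move=> ha.
have -> : / (a + 1) = minus (/ (a + 1) * pw (a + 1) 1) (/ (a + 1) * pw (a + 1) 0).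
  rewrite pw_0; last lra.
  rewrite pw_pos_def; last lra.
  by rewrite /Rpower ln_1 Rmult_0_r exp_0 /minus /plus /opp /=; ring.
apply: (is_RInt_derive (fun t => / (a + 1) * pw (a + 1) t)) => x; rewrite Rmin_left ?Rmax_right; try lra.
  move=> hx; have := is_derive_scal _ _ (/ (a + 1)) _ (pw_deriv_ge0 ha (proj1 hx)).
  by rewrite -Rmult_assoc Rinv_l ?Rmult_1_l //; lra.
by move=> _; apply: pw_cont; lra.
Qed.

(** For [a < b] the difference of the integrands lies between 0 and [x^a - x^b], whose integral is
    [1 / (a + 1) - 1 / (b + 1) <= b - a]. *)
Lemma kern_int_lipschitz : lipschitz01 (fun a => RInt (fun x => pw a x / (1 + x)) 0 1) 1.
Proof.
apply: lipschitz01_wlog => a b ha hab hb.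
have ia := @kern_int a 0 1 ltac:(lra) ltac:(lra) ltac:(lra).
have ib := @kern_int b 0 1 ltac:(lra) ltac:(lra) ltac:(lra).
have e : RInt (fun x => pw a x / (1 + x)) 0 1 - RInt (fun x => pw b x / (1 + x)) 0 1 =
   RInt (fun x => pw a x / (1 + x) - pw b x / (1 + x)) 0 1.
  by have := RInt_minus _ _ 0 1 ia ib => /= ->.
have hint : ex_RInt (fun x => pw a x / (1 + x) - pw b x / (1 + x)) 0 1.
  exact: (ex_RInt_minus (V := R_NormedModule) _ _ 0 1 ia ib).
have hmono x : 0 < x < 1 -> 0 <= pw a x - pw b x.
  by move=> hx; have := @pw_le_exp a b x; lra.
have hb0 : 0 < b by lra.
have hu := is_RInt_minus _ _ 0 1 _ _ (pw_int01 ha) (pw_int01 hb0).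
rewrite e Rabs_pos_eq; last first.
  apply: RInt_ge_0 => //; first lra.
  move=> x hx; have -> : pw a x / (1 + x) - pw b x / (1 + x) = (pw a x - pw b x) / (1 + x).
    by field; lra.
  by apply: Rdiv_le_0_compat; [apply: hmono | lra].
apply: (Rle_trans _ (/ (a + 1) - / (b + 1))).
  change (/ (a + 1) - / (b + 1)) with (minus (/ (a + 1)) (/ (b + 1))).
  rewrite -(is_RInt_unique _ _ _ _ hu); apply: RInt_le => //; first lra.
    by eexists; exact: hu.
  move=> x hx; rewrite /minus /plus /opp /=; have := hmono x hx => h0.
  have -> : pw a x / (1 + x) - pw b x / (1 + x) = (pw a x - pw b x) / (1 + x).
    by field; lra.
  apply/Rle_div_l; nra.
have -> : / (a + 1) - / (b + 1) = (b - a) / ((a + 1) * (b + 1)) by field; lra.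
have ab : 0 < a * b by apply: Rmult_lt_0_compat.
apply/Rle_div_l; first nra.
have : 0 <= (b - a) * (a * b + a + b) by apply: Rmult_le_pos; lra.
lra.
Qed.

(** [sin (3 x)] is four times the product of the three sines. If [p] and [q] are the last two, then
    [p - q = sin x] and [p q = 3/4 - sin^2 x], so the numerator [p q + sin x (p - q)] of the right
    side is [3/4]. *)
Lemma csc_tripling x : sin x <> 0 -> sin (x + PI / 3) <> 0 -> sin (x + 2 * (PI / 3)) <> 0 ->
  3 / sin (3 * x) = / sin x - / sin (x + PI / 3) + / sin (x + 2 * (PI / 3)).
Proof.
have -> : x + 2 * (PI / 3) = PI - (PI / 3 - x) by field.
rewrite sin_PI_x sin_plus sin_minus sin_PI3 cos_PI3.
have -> : 3 * x = 2 * x + x by ring.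
rewrite sin_plus sin_2a cos_2a.
have := sin2_cos2 x; rewrite /Rsqr.
have : sqrt 3 * sqrt 3 = 3 by apply: sqrt_sqrt; lra.
move: (sqrt 3) (sin x) (cos x) => r S C hr hSC hS hp hq.
have e : 2 * S * C * C + (C * C - S * S) * S =
   4 * S * (S * (1 / 2) + C * (r / 2)) * (r / 2 * C - 1 / 2 * S).
  have -> : 4 * S * (S * (1 / 2) + C * (r / 2)) * (r / 2 * C - 1 / 2 * S) =
    S * (r * r * (C * C) - S * S) by field.
  rewrite hr; have -> : C * C = 1 - S * S by lra. 
  have -> : 2 * S * C * C = 2 * S * (C * C) by ring. have -> : C * C = 1 - S * S by lra. ring.
rewrite e.
have e2 : (S * (1 / 2) + C * (r / 2)) * (r / 2 * C - 1 / 2 * S) = 3 / 4 - S * S.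
  have -> : (S * (1 / 2) + C * (r / 2)) * (r / 2 * C - 1 / 2 * S) =
    r * r / 4 * (C * C) - S * S / 4 by field.
  rewrite hr; have -> : C * C = 1 - S * S by lra. field.
move: hp hq e2; set p := S * _ + _; set q := r / 2 * C - _ => hp hq e2.
have e3 : p - q = S by rewrite /p /q; field.
have -> : 3 / (4 * S * p * q) = (p * q + S * (p - q)) / (S * p * q).
  have -> : p * q + S * (p - q) = 3 / 4 by rewrite e3 e2; ring.
  by field.
by field.
Qed.

(** Herglotz's trick: the difference [D] of the two sides is Lipschitz on (0, 1) and satisfies
    [3 D(a) = D(a/3) - D((a+1)/3) + D((a+2)/3)], which divides its Lipschitz constant by 3. *)
Theorem stieltjes_reflection a z : 0 < a < 1 -> 0 < z ->
  stieltjes a z + stieltjes (1 - a) (/ z) = PI / sin (PI * a).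
Proof.
move=> ha hz; rewrite stieltjes_inversion //.
pose h a := stieltjes a 1 + stieltjes (1 - a) 1.
pose D a := h a - PI / sin (PI * a).
suff hD0 : forall a, 0 < a < 1 -> D a = 0 by have := hD0 a ha; rewrite /D /h; lra.
have hpi := PI_RGT_0.
have [k hk] : exists k, lipschitz01 D k.
  have [k hk] := csc_defect_lipschitz.
  have hl := lipschitz01_plus (lipschitz01_opp (lipschitz01_plus hk kern_int_lipschitz))
     (lipschitz01_opp (lipschitz01_flip kern_int_lipschitz)).
  exists (k + 1 + 1) => x y hx hy; have := hl x y hx hy.
  (* At [z = 1] the boundary terms of the two [stieltjes] are exactly the poles split off in
     [csc_defect]. *)
  have e x' : 0 < x' < 1 -> D x' = - (csc_defect x' + RInt (fun x0 => pw x' x0 / (1 + x0)) 0 1)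
      + - RInt (fun x0 => pw (1 - x') x0 / (1 + x0)) 0 1.
    move=> hx'; rewrite /D /h /stieltjes /csc_defect.
    have p1 b : pw b 1 = 1 by rewrite pw_pos_def; [rewrite /Rpower ln_1 Rmult_0_r exp_0 | lra].
    by rewrite !p1 /Rdiv; ring.
  by rewrite !e.
have hthree x : 0 < x < 1 -> 3 * D x = D (x / 3) - D ((x + 1) / 3) + D ((x + 2) / 3).
  move=> hx.
  have e1 := stieltjes_tripling hx; have e2 := @stieltjes_tripling (1 - x) ltac:(lra).
  have spos y : 0 < y < 1 -> sin (PI * y) <> 0.
    by move=> hy; apply: Rgt_not_eq; apply: sin_gt_0; nra.
  have := @csc_tripling (PI * (x / 3)).
  have -> : PI * (x / 3) + PI / 3 = PI * ((x + 1) / 3) by field.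
  have -> : PI * (x / 3) + 2 * (PI / 3) = PI * ((x + 2) / 3) by field.
  have -> : 3 * (PI * (x / 3)) = PI * x by field.
  move=> /(_ (spos _ _) (spos _ _) (spos _ _)) e3.
  have {}e3 := e3 ltac:(lra) ltac:(lra) ltac:(lra).
  rewrite /D /h.
  have -> : 1 - x / 3 = (1 - x + 2) / 3 by field.
  have -> : 1 - (x + 1) / 3 = (1 - x + 1) / 3 by field.
  have -> : 1 - (x + 2) / 3 = (1 - x) / 3 by field.
  have e4 : 3 * (PI / sin (PI * x)) = PI / sin (PI * (x / 3)) - PI / sin (PI * ((x + 1) / 3))
     + PI / sin (PI * ((x + 2) / 3)).
    have -> : 3 * (PI / sin (PI * x)) = PI * (3 / sin (PI * x)) by rewrite /Rdiv; ring.
    by rewrite e3 /Rdiv; ring.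
  lra.
have contr c : lipschitz01 D c -> lipschitz01 D (c / 3).
  move=> hc x y hx hy.
  have h1 := hc (x / 3) (y / 3) ltac:(lra) ltac:(lra).
  have h2 := hc ((x + 1) / 3) ((y + 1) / 3) ltac:(lra) ltac:(lra).
  have h3 := hc ((x + 2) / 3) ((y + 2) / 3) ltac:(lra) ltac:(lra).
  move: h1 h2 h3.
  have -> : x / 3 - y / 3 = (x - y) * / 3 by field.
  have -> : (x + 1) / 3 - (y + 1) / 3 = (x - y) * / 3 by field.
  have -> : (x + 2) / 3 - (y + 2) / 3 = (x - y) * / 3 by field.
  rewrite Rabs_mult (Rabs_pos_eq (/ 3)); last lra.
  have t1 := hthree x hx; have t2 := hthree y hy.
  have -> : D x - D y = ((D (x / 3) - D (y / 3)) + - (D ((x + 1) / 3) - D ((y + 1) / 3))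
     + (D ((x + 2) / 3) - D ((y + 2) / 3))) * / 3 by lra.
  rewrite Rabs_mult (Rabs_pos_eq (/ 3)); last lra.
  have := Rabs_triang (D (x / 3) - D (y / 3) + - (D ((x + 1) / 3) - D ((y + 1) / 3))) (D ((x + 2) / 3) - D ((y + 2) / 3)).
  have := Rabs_triang (D (x / 3) - D (y / 3)) (- (D ((x + 1) / 3) - D ((y + 1) / 3))).
  rewrite Rabs_Ropp.
  lra.
have iter m : lipschitz01 D (k * (/ 3) ^ m).
  elim: m => [|m /contr ih]; first by rewrite /= Rmult_1_r.
  by rewrite (_ : k * (/ 3) ^ m.+1 = k * (/ 3) ^ m / 3) //=; field.
have Dconst x y : 0 < x < 1 -> 0 < y < 1 -> D x = D y.
  move=> hx hy; apply: NNPP => ne.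
  have p : 0 < Rabs (D x - D y) by apply: Rabs_pos_lt; lra.
  have [N hN] := pow_lt_1_zero (/ 3) ltac:(rewrite Rabs_pos_eq; lra)
     (Rabs (D x - D y) / (Rabs k + 1)) ltac:(apply: Rdiv_lt_0_compat => //; have := Rabs_pos k; lra).
  have {hN} := hN N (le_n _); have := iter N x y hx hy.
  have q : 0 < (/ 3) ^ N by apply: pow_lt; lra.
  rewrite (Rabs_pos_eq ((/ 3) ^ N)); last lra.
  have xy : Rabs (x - y) <= 1 by apply: Rabs_le; lra.
  have h0 := Rabs_pos (x - y); have hk0 := Rle_abs k; have hk1 := Rabs_pos k.
  move=> h1 /Rlt_div_r h2; have {}h2 := h2 ltac:(lra).
  have : k * (/ 3) ^ N * Rabs (x - y) <= Rabs k * (/ 3) ^ N.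
    apply: Rle_trans (_ : Rabs k * (/ 3) ^ N * Rabs (x - y) <= _).
      by apply: Rmult_le_compat_r => //; apply: Rmult_le_compat_r; lra.
    rewrite -[X in _ <= X]Rmult_1_r; apply: Rmult_le_compat_l => //.
    by apply: Rmult_le_pos; lra.
  nra.
(* A constant [D] satisfies [3 D = D - D + D], hence vanishes. *)
move=> x hx; have := hthree x hx.
rewrite (Dconst ((x + 1) / 3) x) ?(Dconst (x / 3) x) ?(Dconst ((x + 2) / 3) x); lra.
Qed.

(** * Continuous functional calculus of a positive contraction *)

(** Uniform continuity in the form used in Bernstein's theorem: the deviation is dominated by a
    quadratic polynomial, and on those Bernstein operators are computed exactly. *)
Definition qcont (m : R) (f : R -> R) : Prop := forall e, 0 < e -> exists k, 0 <= k /\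
  forall s t, 0 <= s <= m -> 0 <= t <= m -> Rabs (f s - f t) <= e + k * (s - t) ^ 2.

Lemma qcont_continuous m f : (forall t, 0 <= t <= m -> continuous f t) -> qcont m f.
Proof.
move=> hf e he; case: (Rlt_le_dec m 0) => hm.
  by exists 0; split=> [|s t hs]; lra.
have hc t : 0 <= t <= m -> continuity_pt f t.
  by move=> ht; apply/continuity_pt_filterlim; apply: hf.
have [d hd] := @Heine_cor2 f 0 m hc (mkposreal e he).
have [x0 [hx0 _]] := continuity_ab_maj f 0 m hm hc.
have [x1 [hx1 _]] := continuity_ab_min f 0 m hm hc.
have d0 := cond_pos d.
set D := Rabs (f x0 - f x1).
have hD : 0 <= D by apply: Rabs_pos.
have d2 : 0 < d ^ 2 by apply: pow_lt.
(* [D] bounds the oscillation of [f]; once [|s - t| >= d], the quadratic term alone is at least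
   [D]. *)
exists (D / d ^ 2); split; first exact: Rdiv_le_0_compat.
move=> s t hs ht; case: (Rlt_le_dec (Rabs (s - t)) d) => h.
  have hA : Rabs (f s - f t) < e := hd s t hs ht h.
  suff : 0 <= D / d ^ 2 * (s - t) ^ 2 by lra.
  apply: Rmult_le_pos; last exact: pow2_ge_0.
  exact: Rdiv_le_0_compat.
have hA : Rabs (f s - f t) <= D.
  have := hx0 s hs; have := hx0 t ht; have := hx1 s hs; have := hx1 t ht.
  have : f x0 - f x1 <= D by apply: Rle_abs.
  by move=> *; apply: Rabs_le; lra.
have h2 : d ^ 2 <= (s - t) ^ 2.
  by rewrite -(pow2_abs (s - t)); apply: pow_incr; lra.
have : D <= D / d ^ 2 * (s - t) ^ 2.
  have {1}-> : D = D / d ^ 2 * d ^ 2 by field; lra.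
  apply: Rmult_le_compat_l => //; exact: Rdiv_le_0_compat.
lra.
Qed.

Section FunctionalCalculus.
Variables (V : CompleteNormedModule R_AbsRing) (ip : V -> V -> R).
Hypothesis ipD : forall x y z, ip (plus x y) z = ip x z + ip y z.
Hypothesis ipZ : forall (c : R) x y, ip (scal c x) y = c * ip x y.
Hypothesis ipC : forall x y, ip x y = ip y x.
Hypothesis ip_norm : forall x, ip x x = norm x ^ 2.

Lemma scal_m1 (x : V) : opp x = scal (-1) x.
Proof. by rewrite -scal_opp_one. Qed.

Lemma ipN x y : ip (opp x) y = - ip x y.
Proof. by rewrite scal_m1 ipZ; ring. Qed.

Lemma ip0 y : ip zero y = 0.
Proof. by have := ipD zero zero y; rewrite plus_zero_l; lra. Qed.

Lemma ipB x y z : ip (minus x y) z = ip x z - ip y z.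
Proof. by rewrite /minus ipD ipN. Qed.

Lemma ip_ext (x y : V) : (forall w, ip x w = ip y w) -> x = y.
Proof.
move=> h; apply: (plus_reg_r (opp y)); rewrite plus_opp_r; apply: norm_eq_zero.
have : norm (plus x (opp y)) ^ 2 = 0.
  by rewrite -ip_norm {1}/plus ipD ipN h; ring.
by rewrite -Rsqr_pow2; exact: Rsqr_0_uniq.
Qed.

Lemma norm_scalR (c : R) (x : V) : norm (scal c x) = Rabs c * norm x.
Proof.
apply: Rsqr_inj; first exact: norm_ge_0.
  by apply: Rmult_le_pos; [exact: Rabs_pos | exact: norm_ge_0].
rewrite !Rsqr_pow2 Rpow_mult_distr pow2_abs -!ip_norm ipZ ipC ipZ; ring.
Qed.

(** Vector identities are tested against an arbitrary vector, which leaves a real identity for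
    [ring]. *)
Ltac vec := apply: ip_ext => ?; rewrite ?(ipD, ipZ, ipN, ipB, ip0).

Variable K : V -> V.
Hypothesis KD : forall x y : V, K (plus x y) = plus (K x) (K y).
Hypothesis KZ : forall (c : R) (x : V), K (scal c x) = scal c (K x).
Hypothesis K_sym : forall x y : V, ip (K x) y = ip x (K y).
Hypothesis K_bd : forall x : V, 0 <= ip (K x) x <= norm x ^ 2.

Lemma KN (x : V) : K (opp x) = opp (K x).
Proof. by rewrite !scal_m1 KZ. Qed.

Lemma KB (x y : V) : K (minus x y) = minus (K x) (K y).
Proof. by rewrite /minus KD KN. Qed.

(* An abstract [K1], which rewriting with [ipD] cannot unfold into a sum. *)
Variable K1 : V -> V.
Hypothesis K1E : forall x : V, K1 x = minus x (K x).

Lemma K1D (x y : V) : K1 (plus x y) = plus (K1 x) (K1 y).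
Proof. by rewrite !K1E KD; vec; ring. Qed.

Lemma K1Z (c : R) (x : V) : K1 (scal c x) = scal c (K1 x).
Proof. by rewrite !K1E KZ; vec; ring. Qed.

Lemma K1_sym (x y : V) : ip (K1 x) y = ip x (K1 y).
Proof. by rewrite !K1E ipB (ipC x (minus _ _)) ipB K_sym (ipC x y) (ipC x (K y)). Qed.

Lemma K1_pos (x : V) : 0 <= ip (K1 x) x.
Proof. by rewrite !K1E ipB ip_norm; have := K_bd x; lra. Qed.

Lemma KK1 (x : V) : K (K1 x) = K1 (K x).
Proof. by rewrite !K1E KB. Qed.

(** The nonnegative combinations of products [K^j (1 - K)^k], given by generators so that
    commutation, symmetry and positivity go by induction. *)
Inductive cone : (V -> V) -> Prop :=
| cone_scal c : 0 <= c -> cone (fun x => scal c x)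
| cone_plus P Q : cone P -> cone Q -> cone (fun x => plus (P x) (Q x))
| cone_K P : cone P -> cone (fun x => K (P x))
| cone_K1 P : cone P -> cone (fun x => K1 (P x)).

Lemma cone_comp P Q : cone P -> cone Q -> cone (fun x => P (Q x)).
Proof.
move=> hP hQ; elim: hP => [c hc|P1 P2 _ h1 _ h2|P1 _ h1|P1 _ h1].
(* Scalars occur only at the leaves of [cone], so an outer scalar is pushed inwards by a second
   induction. *)
- have : forall R0, cone R0 -> cone (fun x => scal c (R0 x)).
    move=> R0; elim=> [d hd|P1 P2 _ h1 _ h2|P1 _ h1|P1 _ h1].
    + rewrite (_ : (fun x => scal c (scal d x)) = (fun x => scal (c * d) x)); last first.
        by apply: FunctionalExtensionality.functional_extensionality => x; rewrite scal_assoc.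
      by apply: cone_scal; apply: Rmult_le_pos.
    + rewrite (_ : (fun x => scal c (plus (P1 x) (P2 x))) =
                   (fun x => plus (scal c (P1 x)) (scal c (P2 x)))); first exact: cone_plus.
      by apply: FunctionalExtensionality.functional_extensionality => x; apply: scal_distr_l.
    + rewrite (_ : (fun x => scal c (K (P1 x))) = (fun x => K (scal c (P1 x)))); first exact: cone_K.
      by apply: FunctionalExtensionality.functional_extensionality => x; rewrite KZ.
    + rewrite (_ : (fun x => scal c (K1 (P1 x))) = (fun x => K1 (scal c (P1 x)))); first exact: cone_K1.
      by apply: FunctionalExtensionality.functional_extensionality => x; rewrite K1Z.
  by apply.
- exact: (cone_plus h1 h2).
- exact: (cone_K h1).
- exact: (cone_K1 h1).
Qed.

Lemma cone_commK P : cone P -> forall x : V, P (K x) = K (P x).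
Proof.
elim=> [c hc|P1 P2 _ h1 _ h2|P1 _ h1|P1 _ h1] x.
- by rewrite KZ.
- by rewrite h1 h2 KD.
- by rewrite h1.
- by rewrite h1 KK1.
Qed.

Lemma cone_commK1 P : cone P -> forall x : V, P (K1 x) = K1 (P x).
Proof.
elim=> [c hc|P1 P2 _ h1 _ h2|P1 _ h1|P1 _ h1] x.
- by rewrite K1Z.
- by rewrite h1 h2 K1D.
- by rewrite h1 KK1.
- by rewrite h1.
Qed.

Lemma cone_sym P : cone P -> forall x y : V, ip (P x) y = ip x (P y).
Proof.
elim=> [c hc|P1 P2 _ h1 _ h2|P1 c1 h1|P1 c1 h1] x y.
- by rewrite ipZ [RHS]ipC ipZ (ipC x y).
- by rewrite ipD h1 h2 [RHS]ipC ipD !(ipC x).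
- by rewrite K_sym h1 cone_commK.
- by rewrite K1_sym h1 cone_commK1.
Qed.

(** The induction carries the products with [K], [K1] and [K K1] along. A repeated factor is shared
    between the two arguments, as in [ip (K (K (P x))) x = ip (P (K x)) (K x)], so the four parities
    of the exponents suffice. *)
Lemma cone_pos P : cone P -> forall x : V, 0 <= ip (P x) x.
Proof.
move=> hP.
suff : forall x : V, 0 <= ip (P x) x /\ 0 <= ip (K (P x)) x /\ 0 <= ip (K1 (P x)) x
     /\ 0 <= ip (K (K1 (P x))) x.
  by move=> h x; have [] := h x.
elim: hP => [c hc|P1 P2 _ h1 _ h2|P1 c1 h1|P1 c1 h1] x.
- rewrite KZ !K1Z KZ !ipZ.
  have p1 := K_bd x; have p2 := K1_pos x; have p3 : 0 <= ip x x by rewrite ip_norm; apply: pow2_ge_0.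
  have p4 : 0 <= ip (K (K1 x)) x.
    (* K(1-K) = K(1-K)K + (1-K)K(1-K) *)
    have -> : K (K1 x) = plus (K (K1 (K x))) (K1 (K (K1 x))).
      by rewrite !K1E !KB; vec; ring.
    rewrite ipD (K_sym (K1 (K x))) (K1_sym (K (K1 x))).
    by have := K1_pos (K x); have := proj1 (K_bd (K1 x)); lra.
  repeat split; apply: Rmult_le_pos; lra.
- rewrite KD !K1D KD !ipD.
  by have [? [? [? ?]]] := h1 x; have [? [? [? ?]]] := h2 x; lra.
- have [q1 [q2 [q3 q4]]] := h1 x; have [r1 [r2 [r3 r4]]] := h1 (K x).
  rewrite -!KK1; split => //; split; [|split].
  + by move: r1; rewrite (cone_commK c1) -K_sym.
  + by [].
  + by move: r3; rewrite (cone_commK c1) -K_sym -KK1.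
- have [q1 [q2 [q3 q4]]] := h1 x; have [r1 [r2 [r3 r4]]] := h1 (K1 x).
  split => //; split; [|split] => //.
  + by move: r1; rewrite (cone_commK1 c1) -K1_sym.
  + by move: r2; rewrite (cone_commK1 c1) -K1_sym -!KK1.
Qed.

(** The squared norms differ by [4 ip (P x) (Q x) = 4 ip (Q (P x)) x >= 0]. For [P = a(K) - d(K)]
    and [Q = a(K) + d(K)] this bounds [d(K) x] by [a(K) x] in norm: it is how [|d| <= a] becomes an
    operator estimate. *)
Lemma cone_dom P Q : cone P -> cone Q -> forall x, norm (minus (Q x) (P x)) <= norm (plus (Q x) (P x)).
Proof.
move=> hP hQ x.
have h := cone_pos (cone_comp hQ hP) x; rewrite cone_sym // in h.
have e1 : norm (minus (Q x) (P x)) ^ 2 = ip (Q x) (Q x) + ip (P x) (P x) - 2 * ip (P x) (Q x).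
  rewrite -ip_norm ipB !(ipC _ (minus _ _)) !ipB (ipC (Q x) (P x)); ring.
have e2 : norm (plus (Q x) (P x)) ^ 2 = ip (Q x) (Q x) + ip (P x) (P x) + 2 * ip (P x) (Q x).
  rewrite -ip_norm ipD !(ipC _ (plus _ _)) !ipD (ipC (Q x) (P x)); ring.
apply: Rsqr_incr_0; rewrite ?Rsqr_pow2; [lra | exact: norm_ge_0 | exact: norm_ge_0].
Qed.

Lemma cone_contr S : (forall x, exists P Q, cone P /\ cone Q /\ minus (Q x) (P x) = scal 2 (S x)
   /\ plus (Q x) (P x) = scal 2 x) -> forall x, norm (S x) <= norm x.
Proof.
move=> h x; have [P [Q [hP [hQ [e1 e2]]]]] := h x.
have := cone_dom hP hQ x; rewrite e1 e2.
have hs (y : V) : norm (scal 2 y) = 2 * norm y.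
  rewrite norm_scalR Rabs_pos_eq //; lra.
rewrite !hs; lra.
Qed.

Lemma one_scal (x : V) : scal 1 x = x.
Proof. exact: scal_one. Qed.

Lemma K_contr (x : V) : norm (K x) <= norm x.
Proof.
apply: cone_contr => {}x.
exists (fun x => K1 (scal 1 x)), (fun x => plus (scal 1 x) (K (scal 1 x))).
split; [|split; [|split]].
- by apply: cone_K1; apply: cone_scal; lra.
- by apply: cone_plus; [|apply: cone_K]; apply: cone_scal; lra.
- by rewrite !one_scal ?K1E; vec; ring.
- by rewrite !one_scal ?K1E; vec; ring.
Qed.

Lemma K1_contr (x : V) : norm (K1 x) <= norm x.
Proof.
apply: cone_contr => {}x.
exists (fun x => K (scal 1 x)), (fun x => plus (scal 1 x) (K1 (scal 1 x))).
split; [|split; [|split]].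
- by apply: cone_K; apply: cone_scal; lra.
- by apply: cone_plus; [|apply: cone_K1]; apply: cone_scal; lra.
- by rewrite !one_scal ?K1E; vec; ring.
- by rewrite !one_scal ?K1E; vec; ring.
Qed.

(** [bern N g] is the sum over [k] of [C(N, k) K^k (1 - K)^(N - k) (g k)]. *)
Fixpoint bern (N : nat) (g : nat -> V) : V :=
  match N with
  | 0%N => g 0%N
  | N'.+1 => plus (K1 (bern N' g)) (K (bern N' (fun k => g k.+1)))
  end.

Lemma bernS N g : bern N.+1 g = plus (K1 (bern N g)) (K (bern N (fun k => g k.+1))).
Proof. by []. Qed.

Lemma bern_ext N g h : (forall k, (k <= N)%N -> g k = h k) -> bern N g = bern N h.
Proof.
elim: N g h => [|N ih] g h e /=; first exact: e.
by congr plus; [congr K1 | congr K]; apply: ih => k hk; apply: e => //; apply: leqW.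
Qed.

Lemma bern_map N (S : V -> V) g : (forall x y, S (plus x y) = plus (S x) (S y)) ->
  (forall x, S (K x) = K (S x)) -> (forall x, S (K1 x) = K1 (S x)) ->
  S (bern N g) = bern N (fun k => S (g k)).
Proof.
move=> h1 h2 h3; elim: N g => [|N ih] g //=.
by rewrite h1 h2 h3 !ih.
Qed.

Lemma bern_plus N g h : bern N (fun k => plus (g k) (h k)) = plus (bern N g) (bern N h).
Proof.
elim: N g h => [|N ih] g h //=; rewrite !ih KD K1D.
by vec; ring.
Qed.

Lemma bern_scal N (c : R) g : bern N (fun k => scal c (g k)) = scal c (bern N g).
Proof.
symmetry; apply: bern_map => *; [exact: scal_distr_l | by rewrite KZ | by rewrite K1Z].
Qed.

Lemma bern_const N (x : V) : bern N (fun _ => x) = x.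
Proof. by elim: N => [|N ih] //=; rewrite ih ?K1E; vec; ring. Qed.

Lemma bern_cone N (G : nat -> V -> V) : (forall k, (k <= N)%N -> cone (G k)) ->
  cone (fun x => bern N (fun k => G k x)).
Proof.
elim: N G => [|N ih] G h /=; first exact: h.
apply: (@cone_plus (fun x => K1 (bern N (fun k => G k x)))
                   (fun x => K (bern N (fun k => G k.+1 x)))).
  by apply: (@cone_K1 (fun x => bern N (fun k => G k x))); apply: ih => k hk; apply: h; apply: leqW.
by apply: (@cone_K (fun x => bern N (fun k => G k.+1 x))); apply: ih => k hk; apply: h.
Qed.

Lemma bern_id N (x : V) : bern N (fun k => scal (INR k) x) = scal (INR N) (K x).
Proof.
elim: N => [|N ih]; first by rewrite /=; vec; ring.
rewrite bernS ih.
rewrite (bern_ext (h := fun k => plus (scal (INR k) x) x)); last first.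
  by move=> k _; rewrite S_INR; vec; ring.
by rewrite bern_plus ih bern_const KD S_INR ?K1E; vec; ring.
Qed.

Lemma bern_sq N (x : V) : bern N (fun k => scal (INR k ^ 2) x) =
  plus (scal (INR N) (K x)) (scal (INR N * (INR N - 1)) (K (K x))).
Proof.
elim: N => [|N ih]; first by rewrite /=; vec; ring.
rewrite bernS ih.
rewrite (bern_ext (g := fun k => scal (INR k.+1 ^ 2) x)
   (h := fun k => plus (plus (scal (INR k ^ 2) x) (scal 2 (scal (INR k) x))) x)); last first.
  by move=> k _; rewrite S_INR; vec; ring.
by rewrite !bern_plus ih bern_const bern_scal bern_id !(KD, KZ) S_INR ?K1E !(KD, KZ); vec; ring.
Qed.

Lemma bern_quad N (p q r : R) (x : V) : bern N (fun k => scal (p + q * INR k + r * INR k ^ 2) x) =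
  plus (scal p x) (plus (scal (q * INR N) (K x))
    (scal r (plus (scal (INR N) (K x)) (scal (INR N * (INR N - 1)) (K (K x)))))).
Proof.
rewrite (bern_ext (h := fun k => plus (scal p x) (plus (scal q (scal (INR k) x)) (scal r (scal (INR k ^ 2) x))))).
  by rewrite !bern_plus bern_const !bern_scal bern_id bern_sq; vec; ring.
by move=> k _; vec; ring.
Qed.

(** The variance of the difference of two independent binomial frequencies, [t (1 - t) (1/N + 1/M)],
    with [K] in place of [t]. *)
Lemma bern_var N M (e k : R) (x : V) : (0 < N)%N -> (0 < M)%N ->
  bern N (fun i => bern M (fun j => scal (e + k * (INR i / INR N - INR j / INR M) ^ 2) x)) =
  plus (scal e x) (scal (k * (/ INR N + / INR M)) (K (K1 x))).
Proof.
move=> hN hM.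
have N0 : INR N <> 0 by apply: not_0_INR; move: hN; case: N.
have M0 : INR M <> 0 by apply: not_0_INR; move: hM; case: M.
pose c := k / INR M ^ 2.
rewrite (bern_ext (h := fun i => plus (scal (e + 0 * INR i + (k / INR N ^ 2) * INR i ^ 2) x)
  (plus (scal (0 + (- 2 * k / INR N) * INR i + 0 * INR i ^ 2) (K x))
     (scal c (plus (scal (INR M) (K x)) (scal (INR M * (INR M - 1)) (K (K x)))))))); last first.
  move=> i _.
  rewrite (bern_ext (h := fun j => scal ((e + k * (INR i / INR N) ^ 2)
     + (- 2 * k * (INR i / INR N) / INR M) * INR j + c * INR j ^ 2) x)); last first.
    move=> j _; apply: (f_equal (fun z : R => scal z x)); rewrite /c; field; split; lra.
  rewrite bern_quad; vec; rewrite /c; field; split; lra.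
rewrite !bern_plus bern_const !bern_quad /c ?K1E !(KB, KD, KZ); vec; field; split; lra.
Qed.

(** With [a] the quadratic majorant, the sums of [a - d] and [a + d] both lie in the cone;
    [cone_dom] replaces [d] by [a], and [bern_var] evaluates the latter. *)
Lemma bern2_bound N M (d : nat -> nat -> R) (e k : R) (x : V) :
  (0 < N)%N -> (0 < M)%N -> 0 <= e -> 0 <= k ->
  (forall i j, (i <= N)%N -> (j <= M)%N ->
     Rabs (d i j) <= e + k * (INR i / INR N - INR j / INR M) ^ 2) ->
  norm (bern N (fun i => bern M (fun j => scal (d i j) x))) <= (e + k * (/ INR N + / INR M)) * norm x.
Proof.
move=> hN hM he hk hd.
pose a i j := e + k * (INR i / INR N - INR j / INR M) ^ 2.
have cP : cone (fun x => bern N (fun i => bern M (fun j => scal (a i j - d i j) x))).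
  apply: (@bern_cone N (fun i x => bern M (fun j => scal (a i j - d i j) x))) => i hi.
  apply: (@bern_cone M (fun j x => scal (a i j - d i j) x)) => j hj; apply: cone_scal.
  by have := hd i j hi hj; have := Rle_abs (d i j); rewrite -/(a i j); lra.
have cQ : cone (fun x => bern N (fun i => bern M (fun j => scal (a i j + d i j) x))).
  apply: (@bern_cone N (fun i x => bern M (fun j => scal (a i j + d i j) x))) => i hi.
  apply: (@bern_cone M (fun j x => scal (a i j + d i j) x)) => j hj; apply: cone_scal.
  by have := hd i j hi hj; have := Rle_abs (- d i j); rewrite Rabs_Ropp -/(a i j); lra.
have := cone_dom cP cQ x; rewrite /minus scal_m1.
rewrite -bern_scal -!bern_plus.
rewrite (bern_ext (h := fun i => scal 2 (bern M (fun j => scal (d i j) x)))); last first.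
  move=> i _; rewrite -bern_scal -bern_plus -bern_scal; apply: bern_ext => j _; vec; ring.
rewrite (bern_ext (g := fun i => plus _ _) (h := fun i => scal 2 (bern M (fun j => scal (a i j) x)))); last first.
  move=> i _; rewrite -bern_plus -bern_scal; apply: bern_ext => j _; vec; ring.
rewrite !bern_scal bern_var //.
have hs (y : V) : norm (scal 2 y) = 2 * norm y.
  rewrite norm_scalR Rabs_pos_eq //; lra.
rewrite !hs => h.
have : norm (plus (scal e x) (scal (k * (/ INR N + / INR M)) (K (K1 x)))) <=
   (e + k * (/ INR N + / INR M)) * norm x.
  apply: Rle_trans (norm_triangle _ _) _; rewrite Rmult_plus_distr_r; apply: Rplus_le_compat.
    by apply: Rle_trans (norm_scal _ _) _; rewrite /abs /= Rabs_pos_eq //; lra.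
  have iN : 0 < / INR N by apply: Rinv_0_lt_compat; apply: lt_0_INR; apply/ltP.
  have iM : 0 < / INR M by apply: Rinv_0_lt_compat; apply: lt_0_INR; apply/ltP.
  have hp : 0 <= k * (/ INR N + / INR M) by apply: Rmult_le_pos; lra.
  apply: Rle_trans (norm_scal _ _) _; rewrite /abs /= Rabs_pos_eq //.
  apply: Rmult_le_compat_l => //; apply: Rle_trans (K_contr _) _; exact: K1_contr.
lra.
Qed.

(** The degree [N.+1] keeps the nodes free of a division by 0. *)
Definition approx (f : R -> R) (N : nat) (x : V) : V :=
  bern N.+1 (fun k => scal (f (INR k / INR N.+1)) x).

Lemma node01 N k : (k <= N.+1)%N -> 0 <= INR k / INR N.+1 <= 1.
Proof.
move=> hk; have h0 : 0 < INR N.+1 by apply: lt_0_INR; apply/ltP.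
have h1 : INR k <= INR N.+1 by apply: le_INR; apply/leP.
have h2 := pos_INR k.
split; first exact: Rdiv_le_0_compat.
by apply/Rle_div_l => //; lra.
Qed.

Lemma approx_plus f N (x y : V) : approx f N (plus x y) = plus (approx f N x) (approx f N y).
Proof. by rewrite /approx -bern_plus; apply: bern_ext => k _; apply: scal_distr_l. Qed.

Lemma approx_scal f N (c : R) (x : V) : approx f N (scal c x) = scal c (approx f N x).
Proof. by rewrite /approx -bern_scal; apply: bern_ext => k _; vec; ring. Qed.

Lemma approx_minus f N (x y : V) : approx f N (minus x y) = minus (approx f N x) (approx f N y).
Proof. by rewrite /minus approx_plus !scal_m1 approx_scal. Qed.

Lemma approx_bound f N c (x : V) : (forall t, 0 <= t <= 1 -> Rabs (f t) <= c) ->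
  norm (approx f N x) <= c * norm x.
Proof.
move=> hf.
have c0 : 0 <= c by apply: Rle_trans (hf 0 ltac:(lra)); apply: Rabs_pos.
(* Here [d i j] does not depend on [j]: the second sum is trivial, and [M = 1], [k = 0] will do. *)
have := @bern2_bound N.+1 1 (fun i j => f (INR i / INR N.+1)) c 0 x erefl erefl c0 (Rle_refl _).
rewrite Rmult_0_l Rplus_0_r (bern_ext (g := fun i => bern 1 _) (h := fun i => scal (f (INR i / INR N.+1)) x)).
  by apply=> i j hi hj; rewrite Rmult_0_l Rplus_0_r; apply: hf; apply: node01.
by move=> i _; rewrite bern_const.
Qed.

(** Since the Bernstein weights sum to 1, the difference is a double sum of [f (i/N) - f (j/M)], to
    which the modulus of continuity applies. *)
Lemma approx_cauchy f e k N M (x : V) : 0 <= e -> 0 <= k ->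
  (forall s t, 0 <= s <= 1 -> 0 <= t <= 1 -> Rabs (f s - f t) <= e + k * (s - t) ^ 2) ->
  norm (minus (approx f N x) (approx f M x)) <= (e + k * (/ INR N.+1 + / INR M.+1)) * norm x.
Proof.
move=> he hk hf.
have -> : minus (approx f N x) (approx f M x) = bern N.+1 (fun i => bern M.+1
    (fun j => scal (f (INR i / INR N.+1) - f (INR j / INR M.+1)) x)).
  rewrite /minus scal_m1 -[X in plus _ X](bern_const N.+1) -[X in plus X _]/(bern _ _) -bern_plus.
  apply: bern_ext => i _.
  rewrite -[X in plus X _](bern_const M.+1) -bern_scal -bern_plus.
  by apply: bern_ext => j _; vec; ring.
apply: bern2_bound => // i j hi hj; apply: hf; exact: node01.
Qed.

(** In the double sum the product contributes [f (i/N) g (j/N)] and the other term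
    [f (i/N) g (i/N)]; only the continuity of [g] and a bound for [f] enter. *)
Lemma approx_mult f g c e k N (x : V) : 0 <= e -> 0 <= k ->
  (forall t, 0 <= t <= 1 -> Rabs (f t) <= c) ->
  (forall s t, 0 <= s <= 1 -> 0 <= t <= 1 -> Rabs (g s - g t) <= e + k * (s - t) ^ 2) ->
  norm (minus (approx f N (approx g N x)) (approx (fun t => f t * g t) N x))
    <= c * (e + k * (/ INR N.+1 + / INR N.+1)) * norm x.
Proof.
move=> he hk hf hg.
have c0 : 0 <= c by apply: Rle_trans (hf 0 ltac:(lra)); apply: Rabs_pos.
have -> : minus (approx f N (approx g N x)) (approx (fun t => f t * g t) N x) =
  bern N.+1 (fun i => bern N.+1
    (fun j => scal (f (INR i / INR N.+1) * (g (INR j / INR N.+1) - g (INR i / INR N.+1))) x)).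
  rewrite /minus scal_m1 /approx -bern_scal -bern_plus; apply: bern_ext => i _.
  rewrite -bern_scal -[X in plus _ X](bern_const N.+1) -bern_plus.
  by apply: bern_ext => j _; vec; ring.
rewrite Rmult_plus_distr_l -Rmult_assoc.
apply: bern2_bound => //; try exact: Rmult_le_pos.
move=> i j hi hj; rewrite Rabs_mult Rabs_minus_sym Rmult_assoc -Rmult_plus_distr_l.
by apply: Rmult_le_compat; try exact: Rabs_pos; [apply: hf | apply: hg]; apply: node01.
Qed.

(** * Limits of the Bernstein polynomials *)

Definition vlim (u : nat -> V) (y : V) := forall e, 0 < e -> exists N0 : nat, forall N : nat,
  (N0 <= N)%coq_nat -> norm (minus (u N) y) < e.

Lemma vlim_filterlim u y : vlim u y <-> filterlim u eventually (locally y).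
Proof.
split.
- move=> h; apply/filterlim_locally => e; have [N0 hN] := h e (cond_pos e).
  by exists N0 => N hN0; apply: norm_compat1; apply: hN.
- move=> /filterlim_locally h e he.
  have nf := @norm_factor_gt_0 _ V.
  have he' : 0 < e / @norm_factor _ V by apply: Rdiv_lt_0_compat.
  have [N0 hN] := h (mkposreal _ he'); exists N0 => N hN0.
  have := norm_compat2 _ _ _ (hN N hN0) => /=.
  by rewrite (_ : @norm_factor _ V * (e / @norm_factor _ V) = e) //; field; lra.
Qed.

Lemma vlim_unique u y z : vlim u y -> vlim u z -> y = z.
Proof. move=> /vlim_filterlim h1 /vlim_filterlim h2.
exact: (@filterlim_locally_unique nat R_AbsRing V eventually _ u y z h1 h2). Qed.

Lemma vlim_plus u v y z : vlim u y -> vlim v z -> vlim (fun N => plus (u N) (v N)) (plus y z).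
Proof.
move=> /vlim_filterlim h1 /vlim_filterlim h2; apply/vlim_filterlim.
exact: filterlim_comp_2 h1 h2 (filterlim_plus _ _).
Qed.

Lemma vlim_small u v y c : 0 <= c -> vlim u y ->
  (forall N, norm (v N) <= c * norm (minus (u N) y)) -> vlim v zero.
Proof.
move=> hc hu hv e he; have he' : 0 < e / (c + 1) by apply: Rdiv_lt_0_compat; lra.
have [N0 hN] := hu _ he'; exists N0 => N hN0.
rewrite minus_zero_r; apply: Rle_lt_trans (hv N) _.
have h := hN N hN0; have h0 := norm_ge_0 (minus (u N) y).
apply: (Rle_lt_trans _ ((c + 1) * norm (minus (u N) y))); first nra.
have := Rmult_lt_compat_l (c + 1) _ _ ltac:(lra) h.
by rewrite (_ : (c + 1) * (e / (c + 1)) = e) //; field; lra.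
Qed.

Lemma vlim_bound u y c : vlim u y -> (forall N, norm (u N) <= c) -> norm y <= c.
Proof.
move=> hu hc; apply: Rnot_lt_le => h.
have [N0 hN] := hu (norm y - c) ltac:(lra).
have := hN N0 (le_n _); have := hc N0.
have := norm_triangle_inv y (u N0).
have -> : norm (minus y (u N0)) = norm (minus (u N0) y) by rewrite -norm_opp opp_minus.
by have := Rle_abs (norm y - norm (u N0)); lra.
Qed.

Lemma inv_small e : 0 < e -> exists N0 : nat, forall N : nat, (N0 <= N)%coq_nat -> / INR N.+1 < e.
Proof.
move=> he; have [N0 [h1 h2]] := archimed_cor1 e he; exists N0 => N hN.
apply: Rle_lt_trans h1; apply: Rinv_le_contravar; first exact: lt_0_INR.
by apply: le_INR; lia.
Qed.

Definition Phi0 (f : R -> R) (x : V) : V :=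
  epsilon (inhabits (zero : V)) (fun y : V => filterlim (fun N => approx f N x) eventually (locally y)).

Lemma Phi0_lim f (x : V) : qcont 1 f -> vlim (fun N => approx f N x) (Phi0 f x).
Proof.
move=> hf; apply/vlim_filterlim.
suff h : exists y : V, filterlim (fun N => approx f N x) eventually (locally y).
  exact: (epsilon_spec (inhabits (zero : V)) (fun y : V => _) h).
apply/filterlim_locally_cauchy => eps.
have e0 := cond_pos eps; have n0 := norm_ge_0 x.
(* [approx_cauchy] contributes one [e] from the modulus and at most [2 e] from the terms in [k], and
   [3 e norm x < eps]. *)
pose e := eps / (4 * (norm x + 1)).
have he : 0 < e by apply: Rdiv_lt_0_compat; lra.
have [k [k0 hk]] := hf e he.
have [N0 hN] := inv_small (e := e / (k + 1)) ltac:(apply: Rdiv_lt_0_compat; lra).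
exists (fun N => (N0 <= N)%coq_nat); split; first by exists N0.
move=> N M h1 h2; apply: norm_compat1.
apply: Rle_lt_trans (@approx_cauchy f e k M N x _ k0 hk) _; first lra.
have q1 := hN N h1; have q2 := hN M h2.
have : k * (/ INR M.+1 + / INR N.+1) <= (k + 1) * (e / (k + 1) + e / (k + 1)).
  have := Rinv_0_lt_compat _ (lt_0_INR N.+1 (Nat.lt_0_succ _)).
  have := Rinv_0_lt_compat _ (lt_0_INR M.+1 (Nat.lt_0_succ _)).
  by move=> *; apply: Rmult_le_compat; lra.
have -> : (k + 1) * (e / (k + 1) + e / (k + 1)) = 2 * e by field; lra.
move=> q3; apply: (Rle_lt_trans _ (3 * e * norm x)).
  by apply: Rmult_le_compat_r; lra.
rewrite /e; have -> : 3 * (eps / (4 * (norm x + 1))) * norm x = eps * (3 * norm x / (4 * (norm x + 1))).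
  by field; lra.
rewrite -[X in _ < X]Rmult_1_r; apply: Rmult_lt_compat_l => //.
by apply/Rlt_div_l; lra.
Qed.

Lemma qcont_bound f : qcont 1 f -> exists c, 0 <= c /\ forall t, 0 <= t <= 1 -> Rabs (f t) <= c.
Proof.
move=> hf; have [k [k0 hk]] := hf 1 ltac:(lra).
exists (Rabs (f 0) + 1 + k); split; first by have := Rabs_pos (f 0); lra.
move=> t ht; have := hk t 0 ht ltac:(lra); rewrite Rminus_0_r.
have := Rabs_triang (f t - f 0) (f 0); rewrite (_ : f t - f 0 + f 0 = f t); last ring.
have : t ^ 2 <= 1 by nra.
nra.
Qed.

Lemma Phi0_plus f (x y : V) : qcont 1 f -> Phi0 f (plus x y) = plus (Phi0 f x) (Phi0 f y).
Proof.
move=> hf; apply: vlim_unique (Phi0_lim _ hf) _ => e he.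
have [N0 hN] := vlim_plus (Phi0_lim x hf) (Phi0_lim y hf) he.
by exists N0 => N /hN; rewrite approx_plus.
Qed.

Lemma Phi0_map f S : qcont 1 f -> (forall x y, S (plus x y) = plus (S x) (S y)) ->
  (forall (c : R) x, S (scal c x) = scal c (S x)) -> (forall x, S (K x) = K (S x)) ->
  (forall x, filterlim S (locally x) (locally (S x))) ->
  forall x, S (Phi0 f x) = Phi0 f (S x).
Proof.
move=> hf h1 h2 h3 hS x.
apply: (@vlim_unique (fun N => S (approx f N x))).
  apply/vlim_filterlim; apply: (filterlim_comp _ _ _ _ S _ _ _ _ (hS _)).
  by apply/vlim_filterlim; apply: Phi0_lim.
have e N : S (approx f N x) = approx f N (S x).
  rewrite /approx (@bern_map _ S) //.
    by apply: bern_ext => k _; rewrite h2.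
  by move=> y; rewrite !K1E /minus h1 !scal_m1 h2 h3.
move=> d hd; have [N0 hN] := Phi0_lim (S x) hf hd.
by exists N0 => N /hN; rewrite e.
Qed.

Lemma Phi0_norm f c (x : V) : qcont 1 f -> (forall t, 0 <= t <= 1 -> Rabs (f t) <= c) ->
  norm (Phi0 f x) <= c * norm x.
Proof. by move=> hf hc; apply: vlim_bound (Phi0_lim x hf) _ => N; apply: approx_bound. Qed.

Lemma Phi0_ext f g (x : V) : (forall t, 0 <= t <= 1 -> f t = g t) -> Phi0 f x = Phi0 g x.
Proof.
move=> h; rewrite /Phi0.
suff -> : (fun N => approx f N x) = (fun N => approx g N x) by [].
apply: FunctionalExtensionality.functional_extensionality => N.
by apply: bern_ext => k hk; rewrite h //; apply: node01.
Qed.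

Lemma Phi0_add f g (x : V) : qcont 1 f -> qcont 1 g -> qcont 1 (fun t => f t + g t) ->
  Phi0 (fun t => f t + g t) x = plus (Phi0 f x) (Phi0 g x).
Proof.
move=> hf hg hfg; apply: vlim_unique (Phi0_lim x hfg) _ => e he.
have [N0 hN] := vlim_plus (Phi0_lim x hf) (Phi0_lim x hg) he.
exists N0 => N /hN; rewrite /approx -bern_plus.
suff -> : bern N.+1 (fun k => scal (f (INR k / INR N.+1) + g (INR k / INR N.+1)) x) =
  bern N.+1 (fun k => plus (scal (f (INR k / INR N.+1)) x) (scal (g (INR k / INR N.+1)) x)) by [].
by apply: bern_ext => k _; vec; ring.
Qed.

(** With [B] for [approx], [B(fg) x] is the sum of [B f (B g x - Phi0 g x)], [B f (Phi0 g x)] and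
    [B(fg) x - B f (B g x)]. The first term tends to 0 because [B f] is bounded uniformly in [N],
    the last by [approx_mult]. *)
Lemma Phi0_mul f g (x : V) : qcont 1 f -> qcont 1 g -> qcont 1 (fun t => f t * g t) ->
  Phi0 (fun t => f t * g t) x = Phi0 f (Phi0 g x).
Proof.
move=> hf hg hfg.
have [c [c0 hc]] := qcont_bound hf.
have l1 : vlim (fun N => approx f N (minus (approx g N x) (Phi0 g x))) zero.
  apply: vlim_small c0 (Phi0_lim x hg) _ => N; exact: approx_bound.
have l2 : vlim (fun N => minus (approx (fun t => f t * g t) N x) (approx f N (approx g N x))) zero.
  move=> e he; have n0 := norm_ge_0 x.
  pose d := e / (4 * (c + 1) * (norm x + 1)).
  have hd : 0 < d.
    by apply: Rdiv_lt_0_compat => //; apply: Rmult_lt_0_compat; lra.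
  have [k [k0 hk]] := hg d hd.
  have [N0 hN] := inv_small (e := d / (k + 1)) ltac:(apply: Rdiv_lt_0_compat; lra).
  exists N0 => N hN0; rewrite minus_zero_r -[norm _]norm_opp opp_minus.
  apply: Rle_lt_trans (@approx_mult f g c d k N x _ k0 hc hk) _; first lra.
  have q1 := hN N hN0.
  have i0 := Rinv_0_lt_compat _ (lt_0_INR N.+1 (Nat.lt_0_succ _)).
  have q2 : k * (/ INR N.+1 + / INR N.+1) <= (k + 1) * (d / (k + 1) + d / (k + 1)).
    by apply: Rmult_le_compat; lra.
  have q3 : (k + 1) * (d / (k + 1) + d / (k + 1)) = 2 * d by field; lra.
  have p0 : 0 <= k * (/ INR N.+1 + / INR N.+1) by apply: Rmult_le_pos; lra.
  apply: (Rle_lt_trans _ ((c + 1) * (3 * d) * (norm x + 1))).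
    apply: Rmult_le_compat; try lra; last by apply: Rmult_le_compat; lra.
    by apply: Rmult_le_pos; lra.
  by rewrite /d; have -> : (c + 1) * (3 * (e / (4 * (c + 1) * (norm x + 1)))) * (norm x + 1) = 3 / 4 * e;
    [field; split; lra | lra].
apply: vlim_unique (Phi0_lim x hfg) _.
have l3 := vlim_plus (vlim_plus l1 (Phi0_lim (Phi0 g x) hf)) l2.
rewrite plus_zero_l plus_zero_r in l3.
move=> e /l3 [N0 hN]; exists N0 => N /hN.
suff -> : plus (plus (approx f N (minus (approx g N x) (Phi0 g x))) (approx f N (Phi0 g x)))
   (minus (approx (fun t => f t * g t) N x) (approx f N (approx g N x))) =
   approx (fun t => f t * g t) N x by [].
by rewrite approx_minus; vec; ring.
Qed.

Lemma Phi0_const (c : R) (x : V) : Phi0 (fun _ => c) x = scal c x.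
Proof.
have h : qcont 1 (fun _ => c).
  by move=> e he; exists 0; split => [|*]; rewrite ?Rminus_diag ?Rabs_R0; lra.
apply: vlim_unique (Phi0_lim x h) _ => e he; exists 0%N => N _.
by rewrite /approx bern_const minus_eq_zero norm_zero.
Qed.

Lemma Phi0_id (x : V) : Phi0 (fun t => t) x = K x.
Proof.
have h : qcont 1 (fun t => t).
  by apply: qcont_continuous => t _; apply: continuous_id.
apply: vlim_unique (Phi0_lim x h) _ => e he; exists 0%N => N _.
have N0 : INR N.+1 <> 0 by apply: not_0_INR.
rewrite /approx (bern_ext (h := fun k => scal (/ INR N.+1) (scal (INR k) x))); last first.
  by move=> k _; vec; field.
rewrite bern_scal bern_id (_ : scal _ _ = K x); last by vec; field.
by rewrite minus_eq_zero norm_zero.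
Qed.
End FunctionalCalculus.

(** * Functional calculus of the inverse of A *)

Section Calculus.
Variables (X : Hilbert) (A : operator X) (hA : positive_selfadjoint A).

Definition rinner (x y : X) : R := Re (inner x y).

Lemma rinner_plus (x y z : X) : rinner (plus x y) z = rinner x z + rinner y z.
Proof. by rewrite /rinner inner_plus. Qed.

Lemma rinner_scal (c : R) (x y : X) : rinner (scal (RtoC c : C_AbsRing) x) y = c * rinner x y.
Proof. by rewrite /rinner inner_scal re_scal_l. Qed.

Lemma rinner_sym (x y : X) : rinner x y = rinner y x.
Proof. by rewrite /rinner (inner_conj x y). Qed.

Lemma rinner_norm (x : X) : rinner x x = norm x ^ 2.
Proof. by rewrite /rinner inner_norm. Qed.

Lemma opp_scal (x : X) : opp x = scal (RtoC (-1) : C_AbsRing) x.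
Proof. by rewrite -scal_opp_one; congr scal; symmetry; apply: (RtoC_opp 1). Qed.

Lemma rinner_zero (y : X) : rinner zero y = 0.
Proof. by have := rinner_plus zero zero y; rewrite plus_zero_l; lra. Qed.

Lemma rinner_CS (x y : X) : rinner x y <= norm x * norm y.
Proof.
have hx := norm_ge_0 x; have hy := norm_ge_0 y.
case: (Req_dec (norm y) 0) => [/norm_eq_zero ->|ny].
  by rewrite rinner_sym rinner_zero; apply: Rmult_le_pos => //; apply: norm_ge_0.
set c := rinner x y.
have := pow2_ge_0 (norm (plus (scal (RtoC (norm y ^ 2) : C_AbsRing) x) (scal (RtoC (- c) : C_AbsRing) y))).
rewrite -rinner_norm rinner_plus !rinner_scal !(rinner_sym _ (plus _ _)) !rinner_plus !rinner_scal.
rewrite (rinner_sym y x) !rinner_norm -/c => h.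
have ny2 : 0 < norm y ^ 2 by apply: pow_lt; lra.
have h2 : c ^ 2 <= (norm x * norm y) ^ 2.
  by apply: (Rmult_le_reg_l (norm y ^ 2)) => //; nra.
apply: Rnot_lt_le => lt.
have p0 : 0 <= norm x * norm y by apply: Rmult_le_pos.
nra.
Qed.

Lemma inverse_exists : exists T : X -> X, is_linear T /\ forall x y, A x y <-> x = T y.
Proof.
have [S [Slin hS]] : resolvent_set A (RtoC 0).
  apply: NNPP => hn; have [l0 [h0 h]] := psa_spectrum hA.
  by have := h _ hn => /=; lra.
have A_lin := psa_linear hA.
(* [resolvent] inverts [l - A], so that at [l = 0] it is [- A^-1]. *)
exists (fun y => opp (S y)); split.
  by apply: is_linear_comp Slin _; apply: is_linear_opp.
move=> x y.
have e : forall u v : X, plus (scal (RtoC 0 : C_AbsRing) u) v = v.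
  by move=> u v; rewrite (_ : RtoC 0 = zero) // scal_zero_l plus_zero_l.
have SN (z : X) : S (opp z) = opp (S z) by apply: linear_opp.
split.
- move=> hxy.
  suff -> : x = S (scal (RtoC (-1) : C_AbsRing) y) by rewrite -opp_scal SN.
  apply: (hS _ _).1.
  exists (scal (RtoC 0 : C_AbsRing) x), (scal (RtoC (-1) : C_AbsRing) y).
  by split; [exists x | split; [exists y | rewrite e]].
- move=> ->; rewrite -SN.
  have [u [v [[u' [_ hu]] [[w [hw hv]] e1]]]] := (hS (opp y) (S (opp y))).2 erefl.
  suff e2 : y = w by rewrite {2}e2.
  by rewrite -[y]opp_opp e1 hv hu e -opp_scal opp_opp.
Qed.

Definition invA : X -> X := proj1_sig (constructive_indefinite_description _ inverse_exists).

Lemma invA_linear : is_linear invA.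
Proof. exact: (proj1 (proj2_sig (constructive_indefinite_description _ inverse_exists))). Qed.

Lemma invAP (x y : X) : A x y <-> x = invA y.
Proof. exact: (proj2 (proj2_sig (constructive_indefinite_description _ inverse_exists))). Qed.

Lemma invA_scal (c : C_AbsRing) (x : X) : invA (scal c x) = scal c (invA x).
Proof. exact: linear_scal invA_linear _ _. Qed.

Lemma invA_plus (x y : X) : invA (plus x y) = plus (invA x) (invA y).
Proof. exact: linear_plus invA_linear _ _. Qed.

Lemma invA_sym (x y : X) : rinner (invA x) y = rinner x (invA y).
Proof.
have hx : A (invA x) x by apply/invAP. have hy : A (invA y) y by apply/invAP.
rewrite /rinner; congr Re; symmetry.
exact: ((psa_selfadjoint hA (invA y) y).2 hy).
Qed.

Lemma invA_inj (x y : X) : invA x = invA y -> x = y.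
Proof.
move=> e; have hx : A (invA x) x by apply/invAP. have hy : A (invA y) y by apply/invAP.
by rewrite e in hx; apply: linear_op_fun (psa_linear hA) _ _ _ hx hy.
Qed.

Lemma bound_exists : exists m, 0 < m /\ forall x, 0 <= rinner (invA x) x <= m * norm x ^ 2.
Proof.
have [m [m0 hm]] := linear_norm _ invA_linear; exists m; split => // x; split.
  have hx : A (invA x) x by apply/invAP.
  case: (classic (invA x = zero)) => [->|nz]; first by rewrite rinner_zero; lra.
  by rewrite rinner_sym; left; apply: psa_definite hA _ _ hx nz.
have n0 := norm_ge_0 x.
apply: Rle_trans (rinner_CS _ _) _; rewrite (_ : m * norm x ^ 2 = m * norm x * norm x); last ring.
by apply: Rmult_le_compat_r.
Qed.

(** The spectrum of [A^-1] is contained in [[0, bd]]. *)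
Definition bd : R := proj1_sig (constructive_indefinite_description _ bound_exists).

Lemma bd_pos : 0 < bd.
Proof. exact: (proj1 (proj2_sig (constructive_indefinite_description _ bound_exists))). Qed.

Lemma bdP x : 0 <= rinner (invA x) x <= bd * norm x ^ 2.
Proof. exact: (proj2 (proj2_sig (constructive_indefinite_description _ bound_exists))). Qed.

(** Continuity is two-sided even at the ends of the interval, which fits the extension of [pw] by 0
    to negative arguments. *)
Definition fcont (f : R -> R) : Prop := forall t, 0 <= t <= bd -> continuous f t.

Lemma fcont_qcont f : fcont f -> qcont 1 (fun t => f (bd * t)).
Proof.
move=> hf; apply: qcont_continuous => t ht; have h := bd_pos.
apply: (continuous_comp (fun t => bd * t) f); last by apply: hf; nra.
by apply: (continuous_mult (fun _ => bd) (fun t => t)); [exact: continuous_const | exact: continuous_id].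
Qed.

Lemma fcont_mult f g : fcont f -> fcont g -> fcont (fun t => f t * g t).
Proof. by move=> hf hg t ht; apply: (continuous_mult f g); [apply: hf | apply: hg]. Qed.

Lemma fcont_plus f g : fcont f -> fcont g -> fcont (fun t => f t + g t).
Proof. by move=> hf hg t ht; apply: (continuous_plus f g); [apply: hf | apply: hg]. Qed.

Lemma fcont_const c : fcont (fun _ => c).
Proof. by move=> t ht; apply: continuous_const. Qed.

Lemma fcont_id : fcont (fun t => t).
Proof. by move=> t ht; apply: continuous_id. Qed.

Lemma fcont_pw b : 0 <= b -> fcont (pw b).
Proof. by move=> hb t ht; apply: pw_cont. Qed.

Local Notation V := (realify_complete X).

(** Division by [bd] brings the spectrum into [[0, 1]], where the Bernstein nodes lie; [fcalc]
    undoes it by evaluating [f] at [bd * t]. *)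
Let K (x : V) : V := scal (/ bd : R_AbsRing) (invA x : V).
Let K1 (x : V) : V := minus x (K x).

(** [Phi f = f(A^-1)] *)
Definition fcalc (f : R -> R) (x : X) : X := @Phi0 V K K1 (fun t => f (bd * t)) x.

Local Notation Phi := fcalc.

Let VD (x y z : V) : rinner (plus x y) z = rinner x z + rinner y z.
Proof. exact: rinner_plus. Qed.

Let VZ (c : R) (x y : V) : rinner (scal c x) y = c * rinner x y.
Proof. exact: rinner_scal. Qed.

Let KD (x y : V) : K (plus x y) = plus (K x) (K y).
Proof.
rewrite /K [invA _](_ : _ = plus (invA x : V) (invA y)); last exact: invA_plus.
exact: scal_distr_l.
Qed.

Let KZ (c : R) (x : V) : K (scal c x) = scal c (K x).
Proof.
rewrite /K [invA _](_ : _ = scal c (invA x : V)); last exact: invA_scal.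
rewrite !scal_assoc; congr scal; exact: Rmult_comm.
Qed.

Let K_sym (x y : V) : rinner (K x) y = rinner x (K y).
Proof. by rewrite /K VZ [RHS]rinner_sym VZ invA_sym rinner_sym. Qed.

Let K_bd (x : V) : 0 <= rinner (K x) x <= norm x ^ 2.
Proof.
rewrite /K VZ; have [h1 h2] := bdP x; have h := bd_pos; have i0 := Rinv_0_lt_compat _ h.
split; first by apply: Rmult_le_pos; lra.
apply: (Rmult_le_reg_l bd) => //; rewrite -Rmult_assoc Rinv_r ?Rmult_1_l; [exact: h2 | lra].
Qed.

Let K1E (x : V) : K1 x = minus x (K x).
Proof. by []. Qed.

Lemma Phi_map f (S : X -> X) : fcont f -> (forall x y, S (plus x y) = plus (S x) (S y)) ->
  (forall (c : R) x, S (scal (RtoC c : C_AbsRing) x) = scal (RtoC c : C_AbsRing) (S x)) ->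
  (forall x, S (invA x) = invA (S x)) ->
  (forall x, filterlim S (locally x) (locally (S x))) ->
  forall x, S (Phi f x) = Phi f (S x).
Proof.
move=> hf h1 h2 h3 h4 x.
apply: (@Phi0_map V rinner VD VZ rinner_sym rinner_norm K KD KZ K_sym K_bd K1 K1E
   (fun t => f (bd * t)) S (fcont_qcont hf) h1 h2 _ h4).
move=> y; rewrite /K; etransitivity; first exact: h2.
by rewrite h3.
Qed.

Lemma Phi_plus f (x y : X) : fcont f -> Phi f (plus x y) = plus (Phi f x) (Phi f y).
Proof.
move=> /fcont_qcont hf.
exact: (@Phi0_plus V rinner VD VZ rinner_sym rinner_norm K KD KZ K_sym K_bd K1 K1E _ x y hf).
Qed.

(** The calculus lives on the underlying real space. Complex homogeneity is an instance of
    [Phi_map]: multiplication by [c] is real-linear, continuous and commutes with [A^-1]. *)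
Lemma Phi_scal f (c : C_AbsRing) (x : X) : fcont f -> Phi f (scal c x) = scal c (Phi f x).
Proof.
move=> hf; symmetry; apply: (@Phi_map f (fun x => scal c x)) => //.
- by move=> *; apply: scal_distr_l.
- by move=> *; rewrite !scal_assoc; congr scal; apply: Cmult_comm.
- by move=> *; rewrite invA_scal.
- by move=> y; apply: filterlim_scal_r.
Qed.

Lemma Phi_norm f c (x : X) : fcont f -> (forall t, 0 <= t <= bd -> Rabs (f t) <= c) ->
  norm (Phi f x) <= c * norm x.
Proof.
move=> /fcont_qcont hf hc.
apply: (@Phi0_norm V rinner VD VZ rinner_sym rinner_norm K KD KZ K_sym K_bd K1 K1E _ c x hf).
by move=> t ht; apply: hc; have := bd_pos; nra.
Qed.

Lemma Phi_ext f g (x : X) : (forall t, 0 <= t <= bd -> f t = g t) -> Phi f x = Phi g x.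
Proof.
move=> h; apply: (@Phi0_ext V K K1) => t ht; apply: h; have := bd_pos; nra.
Qed.

Lemma Phi_add f g (x : X) : fcont f -> fcont g ->
  Phi (fun t => f t + g t) x = plus (Phi f x) (Phi g x).
Proof.
move=> hf hg.
exact: (@Phi0_add V rinner VD VZ rinner_sym rinner_norm K KD KZ K_sym K_bd K1 K1E _ _ x
  (fcont_qcont hf) (fcont_qcont hg) (fcont_qcont (fcont_plus hf hg))).
Qed.

Lemma Phi_mult f g (x : X) : fcont f -> fcont g -> Phi (fun t => f t * g t) x = Phi f (Phi g x).
Proof.
move=> hf hg.
exact: (@Phi0_mul V rinner VD VZ rinner_sym rinner_norm K KD KZ K_sym K_bd K1 K1E _ _ x
  (fcont_qcont hf) (fcont_qcont hg) (fcont_qcont (fcont_mult hf hg))).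
Qed.

Lemma Phi_const (c : R) (x : X) : Phi (fun _ => c) x = scal (RtoC c : C_AbsRing) x.
Proof.
exact: (@Phi0_const V rinner VD VZ rinner_sym rinner_norm K KD KZ K_sym K_bd K1 K1E c x).
Qed.

Lemma Phi_scale (c : R) f (x : X) : fcont f ->
  Phi (fun t => c * f t) x = scal (RtoC c : C_AbsRing) (Phi f x).
Proof. by move=> hf; rewrite (Phi_mult x (@fcont_const c) hf) Phi_const. Qed.

Lemma Phi_id (x : X) : Phi (fun t => t) x = invA x.
Proof.
have e : @Phi0 V K K1 (fun t => t) x = K x.
  exact: (@Phi0_id V rinner VD VZ rinner_sym rinner_norm K KD KZ K_sym K_bd K1 K1E x).
have h : @Phi0 V K K1 (fun t => bd * t) x = scal (RtoC bd : C_AbsRing) (K x).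
  rewrite -e; transitivity (@Phi0 V K K1 (fun _ => bd) (@Phi0 V K K1 (fun t => t) x)).
    apply: (@Phi0_mul V rinner VD VZ rinner_sym rinner_norm K KD KZ K_sym K_bd K1 K1E).
    - by apply: qcont_continuous => t _; apply: continuous_const.
    - by apply: qcont_continuous => t _; apply: continuous_id.
    - by apply: (fcont_qcont fcont_id).
  exact: (@Phi0_const V rinner VD VZ rinner_sym rinner_norm K KD KZ K_sym K_bd K1 K1E bd).
rewrite /fcalc h /K; change (scal (RtoC bd : C_AbsRing) (scal (RtoC (/ bd) : C_AbsRing) (invA x)) = invA x).
rewrite scal_assoc -[RHS]scal_one; congr scal.
rewrite /mult /= -RtoC_mult Rinv_r //; have := bd_pos; lra.
Qed.

Lemma Phi_comm f g (x : X) : fcont f -> fcont g -> Phi f (Phi g x) = Phi g (Phi f x).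
Proof.
move=> hf hg; rewrite -!Phi_mult //; apply: Phi_ext => t _; exact: Rmult_comm.
Qed.

Lemma Phi_minus f (x y : X) : fcont f -> Phi f (minus x y) = minus (Phi f x) (Phi f y).
Proof. by move=> hf; rewrite /minus Phi_plus // !opp_scal Phi_scal. Qed.

Lemma Phi_sub f g (x : X) : fcont f -> fcont g ->
  Phi (fun t => f t - g t) x = minus (Phi f x) (Phi g x).
Proof.
move=> hf hg; rewrite (@Phi_ext _ (fun t => f t + -1 * g t)); last by move=> t _; ring.
have hg' : fcont (fun t => -1 * g t) by apply: fcont_mult => //; apply: fcont_const.
by rewrite Phi_add // Phi_scale // /minus opp_scal.
Qed.

Lemma fcont_bounded f : fcont f -> exists c, 0 < c /\ forall t, 0 <= t <= bd -> Rabs (f t) <= c.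
Proof.
move=> hf; have h0 := bd_pos.
have hc t : 0 <= t <= bd -> continuity_pt f t by move=> ht; apply/continuity_pt_filterlim; apply: hf.
have [x0 [hx0 _]] := continuity_ab_maj f 0 bd ltac:(lra) hc.
have [x1 [hx1 _]] := continuity_ab_min f 0 bd ltac:(lra) hc.
exists (Rabs (f x0) + Rabs (f x1) + 1); split.
  by have := Rabs_pos (f x0); have := Rabs_pos (f x1); lra.
move=> t ht; have := hx0 t ht; have := hx1 t ht.
have := Rle_abs (f x0); have := Rle_abs (- f x1); rewrite Rabs_Ropp.
have := Rabs_pos (f x0); have := Rabs_pos (f x1).
by move=> *; apply: Rabs_le; lra.
Qed.

Lemma Phi_linear f : fcont f -> is_linear (Phi f).
Proof.
move=> hf; split.
- by move=> x y; apply: Phi_plus.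
- by move=> c x; apply: Phi_scal.
- by have [c [c0 hc]] := fcont_bounded hf; exists c; split => // x; apply: Phi_norm.
Qed.

Lemma Phi_zero f : fcont f -> Phi f zero = zero.
Proof. by move=> hf; apply: linear_zero; apply: Phi_linear. Qed.
End Calculus.

(** * Resolvent kernels and their primitives *)

(** [green n (n - k - 1) l] is the function of [A^-1] by which the resolvent [(l + Lambda_n)^-1]
    multiplies the component shifted by [k]. *)
Definition green (n k : nat) (l t : R) : R := l ^ k * pw (INR k.+1 / INR n) t / (1 + l ^ n * t).

Lemma local_lipschitz (q : R -> R) (l0 : R) : ex_derive q l0 ->
  exists c d, 0 <= c /\ 0 < d /\ forall l, Rabs (l - l0) < d -> Rabs (q l - q l0) <= c * Rabs (l - l0).
Proof.
move=> [dq hq].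
have [_ h] := hq.
have {h} := h l0 (fun P h => h) (mkposreal _ Rlt_0_1) => -[d hd].
exists (Rabs dq + 1), d; split; first by have := Rabs_pos dq; lra.
split; first exact: cond_pos.
move=> l hl; have := hd l hl.
rewrite /norm /= /abs /minus /plus /opp /scal /= /mult /= => h.
have -> : q l - q l0 = (q l + - q l0 + - ((l + - l0) * dq)) + (l - l0) * dq by ring.
apply: Rle_trans (Rabs_triang _ _) _; rewrite Rabs_mult.
rewrite /Rminus; lra.
Qed.

Section ScalarKernel.
Variables (n k : nat) (al m : R).
Hypotheses (hk : (k < n)%N) (hal : 0 < al < 1) (hm : 0 < m).

Let n0 : 0 < INR n.
Proof. by apply: lt_0_INR; apply/ltP; apply: leq_ltn_trans hk. Qed.

Let kn : INR k.+1 <= INR n.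
Proof. by apply: le_INR; apply/leP. Qed.

(** The substitution [x = l^n t] turns [l^(-al) green n k l t dl] into
    [x^(green_order - 1) / (1 + x) dx] with the factor [t^(al/n) / n] in front. *)
Definition green_order : R := (INR k.+1 - al) / INR n.

Let k1 : 1 <= INR k.+1.
Proof. by rewrite S_INR; have := pos_INR k; lra. Qed.

Lemma green_order01 : 0 < green_order < 1.
Proof.
rewrite /green_order; split; first by apply: Rdiv_lt_0_compat; lra.
by apply/Rlt_div_l; lra.
Qed.

(** A primitive in [l] of [l^(-al) green n k l t]. *)
Definition green_primitive (l t : R) : R := / INR n * pw (al / INR n) t * stieltjes green_order (l ^ n * t).

Definition green_integrand (l t : R) : R := Rpower l (- al) * green n k l t.

Let aln : 0 < al / INR n.
Proof. by apply: Rdiv_lt_0_compat; lra. Qed.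

Lemma green_primitive_deriv l t : 0 < l -> 0 <= t ->
  is_derive (fun l => green_primitive l t) l (green_integrand l t).
Proof.
move=> hl [ht|<-]; last first.
  rewrite /green_integrand /green pw_0; last by apply: Rdiv_lt_0_compat; lra.
  rewrite Rmult_0_r /Rdiv Rmult_0_l Rmult_0_r.
  apply: (is_derive_ext (fun _ => 0)); last exact: is_derive_const.
  by move=> s; rewrite /green_primitive (pw_0 aln) Rmult_0_r Rmult_0_l.
have hz : 0 < l ^ n * t by apply: Rmult_lt_0_compat => //; apply: pow_lt.
have o0 : 0 < green_order by have := green_order01; lra.
have h1 : is_derive (fun l => l ^ n * t) l (INR n * l ^ n.-1 * t) by auto_derive => //; ring.
have h2 := is_derive_comp _ _ _ _ _ (stieltjes_deriv o0 hz) h1.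
have := is_derive_scal _ _ (/ INR n * pw (al / INR n) t) _ h2.
set d := (X in is_derive _ _ X -> _); suff -> : d = green_integrand l t by [].
rewrite /d /scal /= /mult /= /green_integrand /green !pw_pos_def //.
have -> : l ^ n.-1 = Rpower l (INR n - 1).
  rewrite -Rpower_pow //; congr Rpower.
  by case: (n) hk => // n' _; rewrite S_INR /=; ring.
have -> : Rpower (l ^ n * t) (green_order - 1) = Rpower l (INR n * (green_order - 1)) * Rpower t (green_order - 1).
  by rewrite -Rpower_mult Rpower_pow // Rpower_mult_distr //; apply: pow_lt.
have e1 : Rpower l (- al) * l ^ k = Rpower l (INR n - 1) * Rpower l (INR n * (green_order - 1)).
  rewrite -[l ^ k]Rpower_pow // -!Rpower_plus; congr Rpower.
  by rewrite /green_order S_INR; field; lra.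
have e2 : Rpower t (INR k.+1 / INR n) = Rpower t (al / INR n) * Rpower t (green_order - 1) * t.
  rewrite -[X in _ * X](Rpower_1 t ht) -!Rpower_plus; congr Rpower.
  by rewrite /green_order; field; lra.
rewrite e2.
have -> : Rpower l (- al) * (l ^ k * (Rpower t (al / INR n) * Rpower t (green_order - 1) * t) / (1 + l ^ n * t)) =
  (Rpower l (- al) * l ^ k) * (Rpower t (al / INR n) * Rpower t (green_order - 1) * t) / (1 + l ^ n * t).
  by field; lra.
by rewrite e1; field; lra.
Qed.

(** Uniform in [t] because [l] enters only through [l^(k - al)] and [l^n], while the power of [t]
    stays below [1 + m]. The condition [d <= l0] keeps [l] positive. *)
Lemma green_integrand_lipschitz l0 : 0 < l0 -> exists c d, 0 <= c /\ 0 < d /\ d <= l0 /\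
  forall l t, Rabs (l - l0) < d -> 0 <= t <= m ->
    Rabs (green_integrand l t - green_integrand l0 t) <= c * Rabs (l - l0).
Proof.
move=> hl0.
pose q l := Rpower l (- al) * l ^ k.
have [c1 [d1 [c10 [d10 h1]]]] := @local_lipschitz q l0 ltac:(by
  rewrite /q; apply: ex_derive_mult; [eexists; apply: Rpower_deriv | auto_derive]).
have [c2 [d2 [c20 [d20 h2]]]] := @local_lipschitz (fun l => l ^ n) l0 ltac:(by auto_derive).
have dm : 0 < Rmin d1 (Rmin d2 l0) by do 2 (apply: Rmin_glb_lt => //).
have q0 : 0 < q l0 by apply: Rmult_lt_0_compat; [exact: exp_pos | exact: pow_lt].
exists ((1 + m) * (c1 + q l0 * (m * c2))), (Rmin d1 (Rmin d2 l0)).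
split.
  apply: Rmult_le_pos; first lra.
  have : 0 <= q l0 * (m * c2) by apply: Rmult_le_pos; [lra | apply: Rmult_le_pos; lra].
  lra.
split => //; split; first by apply: Rle_trans (Rmin_r _ _) (Rmin_r _ _).
move=> l t hl ht.
have g1 := Rlt_le_trans _ _ _ hl (Rmin_l _ _).
have g2 := Rlt_le_trans _ _ _ (Rlt_le_trans _ _ _ hl (Rmin_r _ _)) (Rmin_l _ _).
have g3 := Rlt_le_trans _ _ _ (Rlt_le_trans _ _ _ hl (Rmin_r _ _)) (Rmin_r _ _).
have l1 : 0 < l by have [] := Rabs_def2 _ _ g3; lra.
have {}h1 := h1 l g1; have {}h2 := h2 l g2.
have z0 : 0 <= l ^ n * t by apply: Rmult_le_pos; [left; apply: pow_lt | lra].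
have z1 : 0 <= l0 ^ n * t by apply: Rmult_le_pos; [left; apply: pow_lt | lra].
have e : green_integrand l t - green_integrand l0 t = pw (INR k.+1 / INR n) t *
  ((q l - q l0) / (1 + l ^ n * t) + q l0 * (t * (l0 ^ n - l ^ n) / ((1 + l ^ n * t) * (1 + l0 ^ n * t)))).
  by rewrite /green_integrand /green /q; field; split; lra.
have pb : 0 <= pw (INR k.+1 / INR n) t <= 1 + m.
  split; first exact: pw_ge0.
  apply: Rle_trans (@pw_bound _ _ _ _) _; try lra; split.
    by left; apply: Rdiv_lt_0_compat; lra.
  by apply/Rle_div_l; lra.
rewrite e Rabs_mult (Rabs_pos_eq (pw _ _)); last lra.
rewrite Rmult_assoc; apply: Rmult_le_compat; try lra; first exact: Rabs_pos.
have small x y : 0 <= y -> Rabs (x / (1 + y)) <= Rabs x.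
  move=> hy; rewrite /Rdiv Rabs_mult -[X in _ <= X]Rmult_1_r.
  apply: Rmult_le_compat_l; first exact: Rabs_pos.
  rewrite Rabs_inv Rabs_pos_eq; last lra.
  by rewrite -[X in _ <= X]Rinv_1; apply: Rinv_le_contravar; lra.
apply: Rle_trans (Rabs_triang _ _) _; rewrite (Rmult_plus_distr_r c1); apply: Rplus_le_compat.
  by apply: Rle_trans (small _ _ z0) _.
rewrite Rabs_mult (Rabs_pos_eq (q l0)); last lra.
rewrite Rmult_assoc; apply: Rmult_le_compat_l; first lra.
have -> : (1 + l ^ n * t) * (1 + l0 ^ n * t) = 1 + (l ^ n * t + l0 ^ n * t + l ^ n * t * (l0 ^ n * t)) by ring.
apply: Rle_trans (small _ _ _) _.
  by have := Rmult_le_pos _ _ z0 z1; lra.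
rewrite Rabs_mult Rabs_minus_sym (Rabs_pos_eq t); last lra.
rewrite Rmult_assoc; apply: Rmult_le_compat; try lra; exact: Rabs_pos.
Qed.

(** The mean value theorem and the Lipschitz bound on the derivative give a quadratic remainder
    uniform in [t], which lets differentiation in [l] pass through [Phi]. *)
Lemma green_primitive_second_order l0 : 0 < l0 -> exists c d, 0 <= c /\ 0 < d /\
  forall l t, Rabs (l - l0) < d -> 0 <= t <= m ->
    Rabs (green_primitive l t - green_primitive l0 t - (l - l0) * green_integrand l0 t) <= c * Rabs (l - l0) * Rabs (l - l0).
Proof.
move=> hl0; have [c [d [c0 [d0 [dl h]]]]] := green_integrand_lipschitz hl0.
exists c, d; split => //; split => // l t hl ht.
have [h1 h2] := Rabs_def2 _ _ hl.
have between x : Rmin l0 l <= x <= Rmax l0 l -> 0 < x /\ Rabs (x - l0) <= Rabs (l - l0).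
  by rewrite /Rmin /Rmax /Rabs; case: Rle_dec => ?; case: Rcase_abs => ?; case: Rcase_abs => ?; lra.
have := @MVT_gen (fun l => green_primitive l t) l0 l (fun l => green_integrand l t); case.
- by move=> x hx; apply: green_primitive_deriv; [apply: (proj1 (between x _)) | ]; lra.
- move=> x hx; apply/continuity_pt_filterlim.
  have hd := @green_primitive_deriv x t (proj1 (between x ltac:(lra))) (proj1 ht).
  exact: (@ex_derive_continuous R_AbsRing R_NormedModule _ x (ex_intro _ _ hd)).
move=> x [hx ->]; have [x0 hxl] := between x hx.
have -> : green_integrand x t * (l - l0) - (l - l0) * green_integrand l0 t = (green_integrand x t - green_integrand l0 t) * (l - l0) by ring.
rewrite Rabs_mult; apply: Rmult_le_compat_r; first exact: Rabs_pos.
apply: Rle_trans (h x t _ ht) _; first lra.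
by apply: Rmult_le_compat_l.
Qed.

Lemma green_primitive_small e : 0 < e -> exists d, 0 < d /\ forall l t, 0 < l < d -> 0 <= t <= m ->
  Rabs (green_primitive l t) <= e.
Proof.
move=> he; have [o0 o1] := green_order01.
pose c := / INR n * (1 + m) / green_order.
have c0 : 0 < c.
  apply: Rdiv_lt_0_compat => //; apply: Rmult_lt_0_compat; [exact: Rinv_0_lt_compat | lra].
have [d [d0 hd]] := @pw_small green_order (e / c) o0 ltac:(exact: Rdiv_lt_0_compat).
have m1 : 0 < d / (m + 1) by apply: Rdiv_lt_0_compat; lra.
exists (Rmin 1 (d / (m + 1))); split; first by apply: Rmin_glb_lt; lra.
move=> l t [hl h] ht.
have l1 := Rlt_le_trans _ _ _ h (Rmin_l _ _).
have l2 := Rlt_le_trans _ _ _ h (Rmin_r _ _).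
have ln : 0 < l ^ n <= l.
  split; first exact: pow_lt.
  case: (n) hk => // n' _; rewrite /= -[X in _ <= X]Rmult_1_r.
  apply: Rmult_le_compat_l; first lra.
  by rewrite -(pow1 n'); apply: pow_incr; lra.
have z0 : 0 <= l ^ n * t by apply: Rmult_le_pos; lra.
have zd : l ^ n * t < d.
  apply: (Rle_lt_trans _ (l * (m + 1))); first by apply: Rmult_le_compat; lra.
  have := Rmult_lt_compat_r (m + 1) _ _ ltac:(lra) l2.
  by rewrite (_ : d / (m + 1) * (m + 1) = d) //; field; lra.
have [s1 s2] := stieltjes_bound o0 z0.
have pb : 0 <= pw (al / INR n) t <= 1 + m.
  split; first exact: pw_ge0.
  apply: Rle_trans (@pw_bound _ _ _ _) _; try lra; split; first lra.
  by apply/Rle_div_l; lra.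
have i0 := Rinv_0_lt_compat _ n0.
rewrite /green_primitive Rabs_pos_eq; last by apply: Rmult_le_pos => //; apply: Rmult_le_pos; lra.
apply: (Rle_trans _ (/ INR n * (1 + m) * (pw green_order (l ^ n * t) / green_order))).
  apply: Rmult_le_compat => //; first by apply: Rmult_le_pos; lra.
  by apply: Rmult_le_compat_l; lra.
have := Rmult_lt_compat_l _ _ _ c0 (hd _ zd).
have -> : c * (e / c) = e by field; lra.
have -> : c * pw green_order (l ^ n * t) = / INR n * (1 + m) * (pw green_order (l ^ n * t) / green_order).
  by rewrite /c; field; split; lra.
lra.
Qed.

(** The integral of [green_integrand] over [(0, oo)], divided by [t^(al/n)]. *)
Definition green_mass : R := / INR n * (PI / sin (PI * green_order)).

(** With [x = l^n t], the reflection formula leaves the error [t^(al/n) stieltjes (1 - green_order)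
    (1/x) / n]. Write [t^(al/n) = l^(-al) x^(al/n)]: the product of [x^(al/n)] with the [stieltjes]
    factor is bounded, by the full integral [h] if [x <= 1] and by [1 / (1 - green_order)] if
    [x > 1], because [al/n <= 1 - green_order]. So the error is [O(l^(-al))] uniformly in [t]. *)
Lemma green_primitive_large e : 0 < e -> exists d, 0 < d /\ forall l t, d < l -> 0 <= t <= m ->
  Rabs (green_primitive l t - green_mass * pw (al / INR n) t) <= e.
Proof.
move=> he; have [o0 o1] := green_order01.
have i0 := Rinv_0_lt_compat _ n0.
pose h := PI / sin (PI * green_order).
have h0 : 0 < h.
  by apply: Rdiv_lt_0_compat; [exact: PI_RGT_0 | apply: sin_gt_0; have := PI_RGT_0; nra].
pose c := / INR n * (h + / (1 - green_order)).
have c0 : 0 < c.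
  apply: Rmult_lt_0_compat => //; have := Rinv_0_lt_compat (1 - green_order) ltac:(lra); lra.
exists (Rpower (c / e) (/ al)); split; first exact: exp_pos.
move=> l t hl [[ht|<-] htm]; last first.
  by rewrite /green_primitive (pw_0 aln) !Rmult_0_r Rmult_0_l Rminus_0_r Rabs_R0; lra.
have l0 : 0 < l by apply: Rlt_trans hl; apply: exp_pos.
have z0 : 0 < l ^ n * t by apply: Rmult_lt_0_compat => //; apply: pow_lt.
have zi := Rinv_0_lt_compat _ z0.
have hr := stieltjes_reflection green_order01 z0.
have [s1 s2] := @stieltjes_bound (1 - green_order) (/ (l ^ n * t)) ltac:(lra) ltac:(lra).
have [s3 _] := @stieltjes_bound green_order (l ^ n * t) ltac:(lra) ltac:(lra).
have p0 : 0 < pw (al / INR n) t by rewrite pw_pos_def //; apply: exp_pos.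
have -> : green_primitive l t - green_mass * pw (al / INR n) t =
   - (/ INR n * (pw (al / INR n) t * stieltjes (1 - green_order) (/ (l ^ n * t)))).
  rewrite /green_primitive /green_mass -hr; ring.
rewrite Rabs_Ropp Rabs_pos_eq; last first.
  by apply: Rmult_le_pos; [lra | apply: Rmult_le_pos; lra].
have e1 : pw (al / INR n) t = Rpower l (- al) * pw (al / INR n) (l ^ n * t).
  rewrite !pw_pos_def // -Rpower_mult_distr //; last exact: pow_lt.
  rewrite -Rmult_assoc -(Rpower_pow n l l0) Rpower_mult -Rpower_plus.
  have -> : - al + INR n * (al / INR n) = 0 by field; lra.
  by rewrite Rpower_O // Rmult_1_l.
have bound : pw (al / INR n) (l ^ n * t) * stieltjes (1 - green_order) (/ (l ^ n * t)) <= h + / (1 - green_order).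
  have j0 := Rinv_0_lt_compat (1 - green_order) ltac:(lra).
  case: (Rle_lt_dec (l ^ n * t) 1) => hz.
    have q1 := @pw_le1 (al / INR n) (l ^ n * t) ltac:(lra) ltac:(lra).
    have q2 := pw_ge0 (al / INR n) (l ^ n * t).
    have q3 : stieltjes (1 - green_order) (/ (l ^ n * t)) <= h by rewrite /h; lra.
    have : pw (al / INR n) (l ^ n * t) * stieltjes (1 - green_order) (/ (l ^ n * t)) <= 1 * h by apply: Rmult_le_compat.
    lra.
  rewrite pw_inv // in s2.
  have q0 : 0 < pw (1 - green_order) (l ^ n * t) by rewrite pw_pos_def //; apply: exp_pos.
  have q1 : pw (al / INR n) (l ^ n * t) <= pw (1 - green_order) (l ^ n * t).
    rewrite !pw_pos_def //; apply: Rle_Rpower; first lra.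
    rewrite /green_order; apply/Rle_div_l; first lra.
    by rewrite Rmult_minus_distr_r (_ : (INR k.+1 - al) / INR n * INR n = INR k.+1 - al); [lra | field; lra].
  have q2 := pw_ge0 (al / INR n) (l ^ n * t).
  apply: (Rle_trans _ (pw (1 - green_order) (l ^ n * t) * (/ pw (1 - green_order) (l ^ n * t) / (1 - green_order)))).
    exact: Rmult_le_compat.
  have -> : pw (1 - green_order) (l ^ n * t) * (/ pw (1 - green_order) (l ^ n * t) / (1 - green_order)) = / (1 - green_order).
    by field; split; lra.
  lra.
have r0 := exp_pos (- al * ln l); rewrite -/(Rpower l (- al)) in r0.
apply: (Rle_trans _ (c * Rpower l (- al))).
  have -> : c * Rpower l (- al) = / INR n * (Rpower l (- al) * (h + / (1 - green_order))) by rewrite /c; ring.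
  apply: Rmult_le_compat_l; first lra.
  by rewrite e1 Rmult_assoc; apply: Rmult_le_compat_l => //; lra.
have ce : 0 < c / e by apply: Rdiv_lt_0_compat.
have : c / e <= Rpower l al.
  rewrite -[X in X <= _](Rpower_1 _ ce) -(Rinv_l al); last lra.
  rewrite -Rpower_mult; apply: Rle_Rpower_l; first lra.
  by split; [exact: exp_pos | lra].
move=> /Rle_div_l h5; have {}h5 := h5 he.
rewrite Rpower_Ropp.
have r1 : 0 < Rpower l al by exact: exp_pos.
apply: (Rmult_le_reg_r (Rpower l al)) => //; rewrite Rmult_assoc Rinv_l ?Rmult_1_r; lra.
Qed.
End ScalarKernel.

(** * Integrals of functions of the inverse of A *)

Lemma at_right0_pos d : 0 < d -> at_right 0 (fun t => 0 < t < d).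
Proof.
move=> hd; exists (mkposreal d hd) => t ht t0; split => //.
by move: ht; rewrite /ball /= /AbsRing_ball /abs /minus /plus /opp /= => /Rabs_def2 []; lra.
Qed.

Section ImproperFTC.
Variables (V : CompleteNormedModule R_AbsRing) (F f : R -> V) (y : V).
Hypothesis Fd : forall l, 0 < l -> is_derive F l (f l).
Hypothesis fc : forall l, 0 < l -> continuous f l.
Hypothesis F0 : forall e, 0 < e -> exists d, 0 < d /\ forall l, 0 < l < d -> norm (F l) <= e.
Hypothesis Finf : forall e, 0 < e -> exists d, 0 < d /\ forall l, d < l -> norm (minus (F l) y) <= e.

Lemma is_RInt_gen_primitive : is_RInt_gen f (at_right 0) (Rbar_locally p_infty) y.
Proof.
move=> Q [e he]; have e0 := cond_pos e.
have [d1 [d10 h1]] := F0 (e := e / 4) ltac:(lra).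
have [d2 [d20 h2]] := Finf (e := e / 4) ltac:(lra).
apply: (Filter_prod _ _ _ (fun a => 0 < a < d1) (fun b => d2 < b)).
- exact: at_right0_pos.
- by exists d2.
move=> a b [ha1 ha2] hb; exists (minus (F b) (F a)); split.
  apply: is_RInt_derive => x /= [hx _].
    by apply: Fd; apply: Rlt_le_trans hx; apply: Rmin_glb_lt; lra.
  by apply: fc; apply: Rlt_le_trans hx; apply: Rmin_glb_lt; lra.
apply: he; apply: norm_compat1.
have -> : minus (minus (F b) (F a)) y = plus (minus (F b) y) (opp (F a)).
  by rewrite /minus -!plus_assoc; congr plus; apply: plus_comm.
apply: Rle_lt_trans (norm_triangle _ _) _; rewrite norm_opp.
have := h1 a (conj ha1 ha2); have := h2 b hb; lra.
Qed.
End ImproperFTC.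

Section CalculusIntegrals.
Variables (X : Hilbert) (A : operator X) (hA : positive_selfadjoint A).
Local Notation Phi := (fcalc hA).
Local Notation bd := (bd hA).
Local Notation fcont := (fcont hA).
Local Notation V := (realify_complete X).

Lemma Phi_is_derive (P p : R -> R -> R) (l0 c d : R) (x : X) :
  (forall l, Rabs (l - l0) < d -> fcont (P l)) -> fcont (p l0) -> 0 <= c -> 0 < d ->
  (forall l t, Rabs (l - l0) < d -> 0 <= t <= bd ->
     Rabs (P l t - P l0 t - (l - l0) * p l0 t) <= c * Rabs (l - l0) * Rabs (l - l0)) ->
  @is_derive R_AbsRing V (fun l => Phi (P l) x) l0 (Phi (p l0) x).
Proof.
move=> hP hp c0 d0 h; split; first exact: is_linear_scal_l.
move=> l1 hl1; have -> : l1 = l0.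
  by symmetry; apply: (is_filter_lim_locally_unique (K := R_AbsRing) (V := R_NormedModule)).
move=> e; have e0 := cond_pos e; have n0 := norm_ge_0 x.
have hd : 0 < Rmin d (e / ((c + 1) * (norm x + 1))).
  apply: Rmin_glb_lt => //; apply: Rdiv_lt_0_compat => //; apply: Rmult_lt_0_compat; lra.
exists (mkposreal _ hd) => l /= hl.
have {}hl : Rabs (l - l0) < Rmin d (e / ((c + 1) * (norm x + 1))) by exact: hl.
have g1 := Rlt_le_trans _ _ _ hl (Rmin_l _ _).
have g2 := Rlt_le_trans _ _ _ hl (Rmin_r _ _).
have a0 := Rabs_pos (l - l0).
have hP0 : fcont (P l0) by apply: hP; rewrite Rminus_diag Rabs_R0.
have e1 : (minus (minus (Phi (P l) x : V) (Phi (P l0) x)) (scal (minus l l0 : R_AbsRing) (Phi (p l0) x : V))) =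
   Phi (fun t => P l t - P l0 t - (l - l0) * p l0 t) x.
  rewrite Phi_sub; first last.
  - by apply: fcont_mult => //; apply: fcont_const.
  - move=> t ht; apply: (continuous_minus (P l) (P l0)); [apply: hP | apply: hP0] => //.
  by rewrite Phi_sub //; [rewrite Phi_scale | apply: hP].
rewrite [X in _ X <= _]e1.
apply: Rle_trans (@Phi_norm _ _ hA _ (c * Rabs (l - l0) * Rabs (l - l0)) x _ _) _.
- move=> t ht; apply: (continuous_minus (fun t => P l t - P l0 t) (fun t => (l - l0) * p l0 t)).
    by apply: (continuous_minus (P l) (P l0)); [apply: hP | apply: hP0].
  by apply: (continuous_mult (fun _ => l - l0) (p l0)); [apply: continuous_const | apply: hp].
- by move=> t ht; apply: h.
change (norm (minus l l0)) with (Rabs (l - l0)).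
have q : c * Rabs (l - l0) * norm x <= e.
  have : (c + 1) * (norm x + 1) * Rabs (l - l0) <= e.
    have p0 : 0 < (c + 1) * (norm x + 1) by apply: Rmult_lt_0_compat; lra.
    have := Rmult_lt_compat_l _ _ _ p0 g2.
    have -> : (c + 1) * (norm x + 1) * (e / ((c + 1) * (norm x + 1))) = e by field; lra.
    lra.
  have : 0 <= Rabs (l - l0) * (c + norm x + 1) by apply: Rmult_le_pos => //; lra.
  lra.
have -> : c * Rabs (l - l0) * Rabs (l - l0) * norm x = c * Rabs (l - l0) * norm x * Rabs (l - l0) by ring.
exact: Rmult_le_compat_r.
Qed.

Lemma Phi_continuous (p : R -> R -> R) (l0 c d : R) (x : X) :
  (forall l, Rabs (l - l0) < d -> fcont (p l)) -> 0 <= c -> 0 < d ->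
  (forall l t, Rabs (l - l0) < d -> 0 <= t <= bd -> Rabs (p l t - p l0 t) <= c * Rabs (l - l0)) ->
  @continuous R_UniformSpace V (fun l => Phi (p l) x) l0.
Proof.
move=> hp c0 d0 h; apply/filterlim_locally => e.
have e0 := cond_pos e; have n0 := norm_ge_0 x.
have hd : 0 < Rmin d (e / ((c + 1) * (norm x + 1))).
  apply: Rmin_glb_lt => //; apply: Rdiv_lt_0_compat => //; apply: Rmult_lt_0_compat; lra.
exists (mkposreal _ hd) => l /= hl.
have {}hl : Rabs (l - l0) < Rmin d (e / ((c + 1) * (norm x + 1))) by exact: hl.
have g1 := Rlt_le_trans _ _ _ hl (Rmin_l _ _).
have g2 := Rlt_le_trans _ _ _ hl (Rmin_r _ _).
have a0 := Rabs_pos (l - l0).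
have hp0 : fcont (p l0) by apply: hp; rewrite Rminus_diag Rabs_R0.
apply: (@norm_compat1 _ X); rewrite -Phi_sub //; last exact: hp.
apply: (Rle_lt_trans _ (c * Rabs (l - l0) * norm x)).
  apply: Phi_norm; last by move=> t ht; apply: h.
  by move=> t ht; apply: (continuous_minus (p l) (p l0)); [apply: hp | apply: hp0].
have p0 : 0 < (c + 1) * (norm x + 1) by apply: Rmult_lt_0_compat; lra.
have := Rmult_lt_compat_l _ _ _ p0 g2.
have -> : (c + 1) * (norm x + 1) * (e / ((c + 1) * (norm x + 1))) = e by field; lra.
have : 0 <= Rabs (l - l0) * (c + norm x + 1) by apply: Rmult_le_pos => //; lra.
lra.
Qed.

Lemma fcont_div f (l : R) n : fcont f -> 0 <= l -> fcont (fun t => f t / (1 + l ^ n * t)).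
Proof.
move=> hf hl; apply: fcont_mult => // t ht.
have h : 0 <= l ^ n * t by apply: Rmult_le_pos; [apply: pow_le | lra].
apply: continuous_Rinv_comp; last lra.
apply: (continuous_plus (fun _ => 1) (fun t => l ^ n * t)); first exact: continuous_const.
by apply: (continuous_mult (fun _ => l ^ n) (fun t => t)); [exact: continuous_const | exact: continuous_id].
Qed.

Lemma frac_ge0 m n : 0 <= INR m / INR n.
Proof.
case: n => [|n]; first by rewrite /Rdiv [INR 0]/= Rinv_0; lra.
by apply: Rdiv_le_0_compat; [exact: pos_INR | apply: lt_0_INR; lia].
Qed.

Lemma green_fcont n k l : 0 <= l -> fcont (green n k l).
Proof.
move=> hl; apply: fcont_div => //; apply: fcont_mult; first exact: fcont_const.
by apply: fcont_pw; apply: frac_ge0.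
Qed.

(** [Tp b = A^(-b)]. *)
Definition inv_power (b : R) (x : X) : X := Phi (pw b) x.

Local Notation Tp := inv_power.

(** [Phi] of the scalar primitive is a primitive of the integrand, and the uniform estimates at 0
    and at infinity give its limits. *)
Lemma green_integral n k al (x : X) : (k < n)%N -> 0 < al < 1 ->
  @is_RInt_gen (realify X)
    (fun l => scal (RtoC (Rpower l (- al)) : C_AbsRing) (Phi (green n k l) x))
    (at_right 0) (Rbar_locally p_infty)
    (scal (RtoC (green_mass n k al) : C_AbsRing) (Tp (al / INR n) x)).
Proof.
move=> hk hal; have hbd := bd_pos hA; have n0 := norm_ge_0 x.
have nn : 0 < INR n by apply: lt_0_INR; apply/ltP; apply: leq_ltn_trans hk.
have aln : 0 <= al / INR n by apply: Rdiv_le_0_compat; lra.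
have o01 := green_order01 hk hal.
have hP l : 0 < l -> fcont (green_primitive n k al l).
  move=> hl; apply: fcont_mult.
    by apply: fcont_mult; [exact: fcont_const | exact: fcont_pw].
  move=> t ht; apply: (continuous_comp (fun t => l ^ n * t) (stieltjes (green_order n k al))).
    by apply: (continuous_mult (fun _ => l ^ n) (fun t => t)); [exact: continuous_const | exact: continuous_id].
  apply: stieltjes_cont; first lra.
  have : 0 <= l ^ n * t by apply: Rmult_le_pos; [apply: pow_le | ]; lra.
  lra.
have hp l : 0 < l -> fcont (green_integrand n k al l).
  by move=> hl; apply: fcont_mult; [exact: fcont_const | apply: green_fcont; lra].
have near l0 l d : 0 < l0 -> Rabs (l - l0) < Rmin d l0 -> 0 < l /\ Rabs (l - l0) < d.
  move=> h0 h; have := Rlt_le_trans _ _ _ h (Rmin_l _ _).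
  by have [] := Rabs_def2 _ _ (Rlt_le_trans _ _ _ h (Rmin_r _ _)); lra.
have H : @is_RInt_gen V (fun l => Phi (green_integrand n k al l) x) (at_right 0) (Rbar_locally p_infty)
    (Phi (fun t => green_mass n k al * pw (al / INR n) t) x).
  apply: (@is_RInt_gen_primitive V (fun l => Phi (green_primitive n k al l) x)).
  - move=> l0 hl0; have [c [d [c0 [d0 h]]]] := green_primitive_second_order hk hal hbd hl0.
    apply: (@Phi_is_derive _ _ _ c (Rmin d l0)) => //.
    + by move=> l /(near _ _ _ hl0) [h1 _]; apply: hP.
    + exact: hp.
    + exact: Rmin_glb_lt.
    + by move=> l t /(near _ _ _ hl0) [h1 h2]; apply: h.
  - move=> l0 hl0; have [c [d [c0 [d0 [dl h]]]]] := green_integrand_lipschitz hk hal hbd hl0.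
    apply: (@Phi_continuous _ _ c d) => //.
    by move=> l hl; apply: hp; have [] := Rabs_def2 _ _ hl; lra.
  - move=> e he; have [d [d0 h]] := green_primitive_small hk hal hbd (e := e / (norm x + 1)) ltac:(apply: Rdiv_lt_0_compat; lra).
    exists d; split => // l hl.
    apply: Rle_trans (@Phi_norm _ _ hA _ (e / (norm x + 1)) x _ _) _.
    + by apply: hP; lra.
    + by move=> t ht; apply: h.
    + rewrite (_ : e / (norm x + 1) * norm x = e * norm x / (norm x + 1)); last by field; lra.
      by apply/Rle_div_l; nra.
  - move=> e he; have [d [d0 h]] := green_primitive_large bd hk hal (e := e / (norm x + 1)) ltac:(apply: Rdiv_lt_0_compat; lra).
    exists d; split => // l hl.
    have hc : fcont (fun t => green_mass n k al * pw (al / INR n) t).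
      by apply: fcont_mult; [exact: fcont_const | exact: fcont_pw].
    have l0 : 0 < l by lra.
    have := @Phi_sub _ _ hA _ _ x (hP l l0) hc => e1.
    rewrite [X in norm X <= _](_ : _ = Phi (fun t => green_primitive n k al l t - green_mass n k al * pw (al / INR n) t) x); last by rewrite e1.
    apply: Rle_trans (@Phi_norm _ _ hA _ (e / (norm x + 1)) x _ _) _.
    + by move=> t ht; apply: (continuous_minus (green_primitive n k al l)); [apply: hP | apply: hc].
    + by move=> t ht; apply: h.
    + rewrite (_ : e / (norm x + 1) * norm x = e * norm x / (norm x + 1)); last by field; lra.
      by apply/Rle_div_l; nra.
rewrite Phi_scale in H; last exact: fcont_pw.
refine (@is_RInt_gen_ext (realify X) _ _ _ _ _ _ _ _ H).
apply: (Filter_prod _ _ _ (fun a => 0 < a < 1) (fun b => 1 < b)).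
- by apply: at_right0_pos; lra.
- by exists 1.
move=> a b /= ha hb t; rewrite Rmin_left ?Rmax_right; try lra; move=> ht.
rewrite -Phi_scale //; apply: green_fcont; lra.
Qed.
End CalculusIntegrals.

(** * Fractional powers of A *)

Lemma is_RInt_gen_ext_pos (V : NormedModule R_AbsRing) (f g : R -> V) (y : V) :
  (forall l, 0 < l -> f l = g l) ->
  is_RInt_gen f (at_right 0) (Rbar_locally p_infty) y ->
  is_RInt_gen g (at_right 0) (Rbar_locally p_infty) y.
Proof.
move=> h; apply: is_RInt_gen_ext.
apply: (Filter_prod _ _ _ (fun a => 0 < a < 1) (fun b => 1 < b)).
- by apply: at_right0_pos; lra.
- by exists 1.
move=> a b /= ha hb t; rewrite Rmin_left ?Rmax_right; try lra; move=> ht; apply: h; lra.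
Qed.

Section FractionalPowers.
Variables (X : Hilbert) (A : operator X) (hA : positive_selfadjoint A).
Local Notation Phi := (fcalc hA).
Local Notation bd := (bd hA).
Local Notation fcont := (fcont hA).
Local Notation Tp := (inv_power hA).
Local Notation V := (realify_complete X).

Lemma Tp_O x : Tp 0 x = x.
Proof.
rewrite /inv_power (@Phi_ext _ _ hA _ (fun _ => 1)); last by move=> t _; apply: pw_O.
by rewrite Phi_const; apply: scal_one.
Qed.

Lemma Tp_1 x : Tp 1 x = invA hA x.
Proof.
rewrite /inv_power (@Phi_ext _ _ hA _ (fun t => t)); first exact: Phi_id.
by move=> t ht; apply: pw_1; lra.
Qed.

Lemma Tp_add b c x : 0 <= b -> 0 <= c -> Tp (b + c) x = Tp b (Tp c x).
Proof.
move=> hb hc; rewrite /inv_power -Phi_mult; try exact: fcont_pw.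
by apply: Phi_ext => t ht; apply: pw_add; lra.
Qed.

Lemma Tp_comm b f x : 0 <= b -> fcont f -> Tp b (Phi f x) = Phi f (Tp b x).
Proof. by move=> hb hf; apply: Phi_comm => //; apply: fcont_pw. Qed.

Lemma Tp_plus b x y : 0 <= b -> Tp b (plus x y) = plus (Tp b x) (Tp b y).
Proof. by move=> hb; apply: Phi_plus; apply: fcont_pw. Qed.

Lemma Tp_scal b (c : C_AbsRing) x : 0 <= b -> Tp b (scal c x) = scal c (Tp b x).
Proof. by move=> hb; apply: Phi_scal; apply: fcont_pw. Qed.

Lemma Tp_opp b x : 0 <= b -> Tp b (opp x) = opp (Tp b x).
Proof. by move=> hb; rewrite !opp_scal Tp_scal. Qed.

Lemma Tp_linear b : 0 <= b -> is_linear (Tp b).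
Proof. by move=> hb; apply: Phi_linear; apply: fcont_pw. Qed.

(** [T^(1-b) T^b = T] is injective. *)
Lemma Tp_inj b x y : 0 <= b <= 1 -> Tp b x = Tp b y -> x = y.
Proof.
move=> hb e; apply: (@invA_inj _ _ hA); rewrite -!Tp_1.
have h z : Tp 1 z = Tp (1 - b) (Tp b z) by rewrite -Tp_add; [congr inv_power; ring | lra | lra].
by rewrite !h e.
Qed.

(** The range of [T^b] contains that of [T], which is [D(A)]. *)
Lemma Tp_dense b x e : 0 <= b <= 1 -> 0 < e -> exists y, norm (minus (Tp b y) x) < e.
Proof.
move=> hb he; have nf := @norm_factor_gt_0 _ X.
have he' : 0 < e / @norm_factor _ X by apply: Rdiv_lt_0_compat.
have [x' [[z hz] hx]] := psa_dense hA x (mkposreal _ he').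
exists (Tp (1 - b) z); rewrite -Tp_add; try lra.
rewrite (_ : b + (1 - b) = 1); last ring.
rewrite Tp_1 -((invAP hA x' z).1 hz).
have := norm_compat2 _ _ _ hx => /=.
by rewrite (_ : @norm_factor _ X * (e / @norm_factor _ X) = e) //; field; lra.
Qed.

Lemma resolvent_cancel n l x : 0 <= l ->
  Phi (fun t => 1 / (1 + l ^ n * t)) (Phi (fun t => 1 + l ^ n * t) x) = x.
Proof.
move=> hl; have c1 : fcont (fun t => 1 / (1 + l ^ n * t)).
  by apply: fcont_div => //; apply: fcont_const.
have c2 : fcont (fun t => 1 + l ^ n * t).
  apply: (@fcont_plus _ _ hA (fun _ => 1)); first exact: fcont_const.
  by apply: fcont_mult; [exact: fcont_const | exact: fcont_id].
rewrite -Phi_mult // (@Phi_ext _ _ hA _ (fun _ => 1)); first by rewrite Phi_const; apply: scal_one.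
move=> t ht; have : 0 <= l ^ n * t by apply: Rmult_le_pos; [apply: pow_le | lra].
by move=> h; field; lra.
Qed.

(** On [D(A)], the range of [T], one has [A (l + A)^-1 T = T (1 + l T)^-1], the kernel [green] with
    [n = 1] and [k = 0]. *)
Lemma shift_split l y g : 0 <= l ->
  op_comp A (shift_inv A l) (invA hA y) g <-> g = Phi (green 1 0 l) y.
Proof.
move=> hl.
have cg := @green_fcont _ _ hA 1 0 l hl.
have c2 : fcont (fun t => 1 + l ^ 1 * t).
  apply: (@fcont_plus _ _ hA (fun _ => 1)); first exact: fcont_const.
  by apply: fcont_mult; [exact: fcont_const | exact: fcont_id].
have c3 : fcont (fun t => 1 / (1 + l ^ 1 * t)) by apply: fcont_div => //; apply: fcont_const.
have e1 x : Phi (fun t => 1 + l ^ 1 * t) x = plus (scal (RtoC l : C_AbsRing) (invA hA x)) x.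
  rewrite Phi_add; [|exact: fcont_const|by apply: fcont_mult; [exact: fcont_const | exact: fcont_id]].
  rewrite Phi_const Phi_scale; last exact: fcont_id.
  by rewrite Phi_id pow_1 plus_comm; congr plus; apply: scal_one.
have eg t : 0 <= t -> green 1 0 l t = 1 / (1 + l ^ 1 * t) * t.
  move=> ht; have : 0 <= l ^ 1 * t by apply: Rmult_le_pos; [apply: pow_le | lra].
  rewrite /green (_ : INR 1 / INR 1 = 1); last by rewrite /=; field.
  by move=> h; rewrite pw_1 // [l ^ 0]/=; field; lra.
have e2 : Phi (green 1 0 l) y = Phi (fun t => 1 / (1 + l ^ 1 * t)) (invA hA y).
  rewrite -Phi_id -Phi_mult //; last exact: fcont_id.
  by apply: Phi_ext => t ht; apply: eg; lra.
split.
- move=> [f [[u [v [[w [hw hu]] [hv e]]]] hg]].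
  have evg := linear_op_fun (psa_linear hA) hv hg; subst v.
  rewrite hw in hu.
  have ef : f = invA hA g := (invAP hA f g).1 hg.
  by rewrite e2 e hu ef -e1 resolvent_cancel.
- move=> ->; exists (invA hA (Phi (green 1 0 l) y)); split; last by apply/invAP.
  exists (scal (RtoC l : C_AbsRing) (invA hA (Phi (green 1 0 l) y))), (Phi (green 1 0 l) y).
  split; first by exists (invA hA (Phi (green 1 0 l) y)).
  split; first by apply/invAP.
  rewrite -e1 -Phi_mult // -Phi_id; apply: Phi_ext => t ht; rewrite eg; last lra.
  have : 0 <= l ^ 1 * t by apply: Rmult_le_pos; [apply: pow_le | lra].
  by move=> h; field; lra.
Qed.

(** This is [green_integral] with [n = 1], [k = 0] and [al = 1 - a]. Then [green_order] is [a], and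
    the prefactor [sin (a PI) / PI] cancels the mass. *)
Lemma balakrishnan_range a y z : 0 < a < 1 ->
  balakrishnan A a (invA hA y) z <-> z = Tp (1 - a) y.
Proof.
move=> ha.
have s0 : 0 < sin (PI * a) by apply: sin_gt_0; have := PI_RGT_0; nra.
have hint := @green_integral _ _ hA 1 0 (1 - a) y erefl ltac:(lra).
have em : green_mass 1 0 (1 - a) = PI / sin (PI * a).
  rewrite /green_mass /green_order [INR 1]/= (_ : (1 - (1 - a)) / 1 = a); last by field.
  by field; lra.
rewrite em (_ : (1 - a) / INR 1 = 1 - a) in hint; last by rewrite /=; field.
have ec (w : X) : scal (RtoC (sin (a * PI) / PI) : C_AbsRing) (scal (RtoC (PI / sin (PI * a)) : C_AbsRing) w) = w.
  rewrite scal_assoc -[RHS]scal_one; congr scal; rewrite /mult /= -RtoC_mult /one /=.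
  congr RtoC; rewrite (Rmult_comm a); have := PI_RGT_0 => ?; field; lra.
split.
- move=> [I [[f [hf hI]] ->]].
  have hI' := @is_RInt_gen_ext_pos (realify X) _ (fun l => scal (RtoC (Rpower l (- (1 - a))) : C_AbsRing) (Phi (green 1 0 l) y)) _ _ hI.
  have {}hI' := hI' _.
  rewrite -[X in scal _ X](@is_RInt_gen_unique V _ _ _ _ _ I (hI' _)); last first.
    move=> l hl; rewrite ((shift_split y (f l) (Rlt_le _ _ hl)).1 (hf l hl)).
    by rewrite (_ : - (1 - a) = a - 1) //; ring.
  by rewrite (@is_RInt_gen_unique V _ _ _ _ _ _ hint) ec.
- move=> ->; exists (scal (RtoC (PI / sin (PI * a)) : C_AbsRing) (Tp (1 - a) y)); split; last by rewrite ec.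
  exists (fun l => Phi (green 1 0 l) y); split.
    by move=> l hl; apply/shift_split => //; lra.
  by rewrite (_ : - (1 - a) = a - 1) in hint; last ring.
Qed.

Lemma Tp_closed b x z : 0 <= b <= 1 ->
  (forall e : posreal, exists x' z', x' = Tp b z' /\ ball x e x' /\ ball z e z') -> x = Tp b z.
Proof.
move=> hb h.
have nf := @norm_factor_gt_0 _ X.
have [m [m0 hm]] := linear_norm _ (Tp_linear (proj1 hb)).
apply: (plus_reg_r (opp (Tp b z))); rewrite plus_opp_r; apply: norm_eq_zero.
apply: Rle_antisym; last exact: norm_ge_0.
apply: Rnot_lt_le => lt.
set q := norm _ in lt.
have hd : 0 < q / (2 * (1 + m) * @norm_factor _ X).
  by apply: Rdiv_lt_0_compat => //; apply: Rmult_lt_0_compat => //; lra.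
have [x' [z' [hx [h1 h2]]]] := h (mkposreal _ hd).
have {}h1 := norm_compat2 _ _ _ h1; have {}h2 := norm_compat2 _ _ _ h2.
rewrite /= in h1 h2.
have e1 : @norm_factor _ X * (q / (2 * (1 + m) * @norm_factor _ X)) = q / (2 * (1 + m)).
  by field; split; lra.
rewrite e1 in h1 h2.
have : q <= norm (minus x' x) + m * norm (minus z' z).
  have -> : q = norm (plus (opp (minus x' x)) (Tp b (minus z' z))).
    rewrite /q /minus Tp_plus ?Tp_opp; try lra.
    rewrite opp_plus opp_opp hx [plus (opp _) x]plus_comm -!plus_assoc; congr (norm (plus _ _)).
    by rewrite plus_assoc plus_opp_l plus_zero_l.
  apply: Rle_trans (norm_triangle _ _) _; rewrite norm_opp; apply: Rplus_le_compat_l; exact: hm.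
have e2 : q / (2 * (1 + m)) + m * (q / (2 * (1 + m))) = q / 2 by field; lra.
move=> h3; have h4 := Rmult_lt_compat_l _ _ _ m0 h2.
have h5 := Rplus_lt_compat _ _ _ _ h1 h4; rewrite e2 in h5.
have := Rle_lt_trans _ _ _ h3 h5; lra.
Qed.

(** On [D(A)] the Balakrishnan graph consists of the pairs [(T y, T^(1-a) y)], which lie in the
    closed graph [x = T^a z]. They are dense in it because [T^(1-a)] has dense range. *)
Lemma frac_power0_char a x z : 0 <= a <= 1 -> frac_power0 A a x z <-> x = Tp a z.
Proof.
move=> ha; rewrite /frac_power0; case: Rle_dec => h0 /=.
  have -> : a = 0 by lra.
  by rewrite Tp_O; split=> ->.
case: Rle_dec => h1 /=.
  have -> : a = 1 by lra.
  by rewrite Tp_1; apply: invAP.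
have ha' : 0 < a < 1 by lra.
have hB x' z' : op_restrict (dom A) (balakrishnan A a) x' z' -> x' = Tp a z'.
  move=> [[y /(invAP hA) ->] /(balakrishnan_range _ _ ha') ->].
  by rewrite -Tp_add; try lra; rewrite -Tp_1; congr inv_power; ring.
split.
- move=> h; apply: Tp_closed => // e; have [x' [z' [/hB hx [h2 h3]]]] := h e.
  by exists x', z'.
- move=> -> e; have e0 := cond_pos e.
  have [m [m0 hm]] := linear_norm _ (Tp_linear (proj1 ha)).
  have [y hy] := @Tp_dense (1 - a) z (e / (1 + m)) ltac:(lra) ltac:(apply: Rdiv_lt_0_compat; lra).
  exists (invA hA y), (Tp (1 - a) y); split.
    by split; [exists y; apply/invAP | apply/balakrishnan_range].
  have n0 := norm_ge_0 (minus (Tp (1 - a) y) z).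
  have q1 : (1 + m) * norm (minus (Tp (1 - a) y) z) < e.
    have := Rmult_lt_compat_l (1 + m) _ _ ltac:(lra) hy.
    by rewrite (_ : (1 + m) * (e / (1 + m)) = e) //; field; lra.
  have q2 : norm (minus (Tp (1 - a) y) z) < e.
    by apply: Rle_lt_trans q1; have := Rmult_le_pos _ _ (Rlt_le _ _ m0) n0; lra.
  have q3 : m * norm (minus (Tp (1 - a) y) z) < e by apply: Rle_lt_trans q1; lra.
  split; apply: norm_compat1; last exact: q2.
  have -> : minus (invA hA y) (Tp a z) = Tp a (minus (Tp (1 - a) y) z).
    rewrite /minus Tp_plus ?Tp_opp; try lra; congr plus.
    by rewrite -Tp_add; try lra; rewrite -Tp_1; congr inv_power; ring.
  exact: Rle_lt_trans (hm _) q3.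
Qed.

Lemma frac_power_ge0 a x z : 0 <= a <= 1 -> frac_power A a x z <-> x = Tp a z.
Proof. by move=> ha; rewrite /frac_power; case: Rle_dec => h /=; [apply: frac_power0_char | lra]. Qed.

Lemma frac_power_le0 a x z : -1 <= a <= 0 -> frac_power A a x z <-> z = Tp (- a) x.
Proof.
move=> ha; rewrite /frac_power; case: Rle_dec => h /=; last by apply: frac_power0_char; lra.
have -> : a = 0 by lra.
by rewrite frac_power0_char; [rewrite Ropp_0 !Tp_O; split => -> | lra].
Qed.
End FractionalPowers.

(** * Trigonometric sums *)

HB.instance Definition _ := Monoid.isComLaw.Build R 0 Rplus
  (fun x y z => esym (Rplus_assoc x y z)) Rplus_comm Rplus_0_l.

HB.instance Definition _ (G : AbelianMonoid) := Monoid.isComLaw.Build G (@zero G) (@plus G)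
  (@plus_assoc G) (@plus_comm G) (@plus_zero_l G).

Lemma rsum_distr n (c : R) (F : 'I_n -> R) : c * \big[Rplus/0]_(r < n) F r = \big[Rplus/0]_(r < n) (c * F r).
Proof. by apply: (big_morph (fun x => c * x)) => [x y|]; ring. Qed.

Lemma rsum_const n (c : R) : \big[Rplus/0]_(r < n) c = INR n * c.
Proof.
elim: n => [|n ih]; first by rewrite big_ord0 /=; ring.
by rewrite big_ord_recr ih S_INR /=; ring.
Qed.

(** The quotient [sin (m x) / sin x], that is [U_(m-1)(cos x)], as a sum that also makes sense where
    [sin x = 0]. *)
Definition cosine_sum (m : nat) (x : R) : R := \big[Rplus/0]_(r < m) cos ((INR m - 1 - 2 * INR r) * x).

Lemma cosine_sum_rec m x :
  cosine_sum m.+2 x = 2 * cos x * cosine_sum m.+1 x - cosine_sum m x.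
Proof.
rewrite /cosine_sum rsum_distr.
rewrite (eq_bigr (fun r : 'I_m.+1 => cos ((INR m.+2 - 1 - 2 * INR r) * x) + cos ((INR m - 1 - 2 * INR r) * x))); last first.
  move=> r _; rewrite !S_INR.
  have -> : (INR m + 1 + 1 - 1 - 2 * INR r) * x = (INR m + 1 - 1 - 2 * INR r) * x + x by ring.
  have -> : (INR m - 1 - 2 * INR r) * x = (INR m + 1 - 1 - 2 * INR r) * x - x by ring.
  by rewrite cos_plus cos_minus; ring.
rewrite big_split /= big_ord_recr /=.
rewrite (eq_bigr (fun r : 'I_m.+1 => cos ((INR m.+2 - 1 - 2 * INR r) * x))) //.
rewrite [X in _ = _ + X - _]big_ord_recr /=.
(* The term still missing from the sum of length [m + 2] equals the surplus term over the sum of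
   length [m]. *)
have -> : (INR m.+2 - 1 - 2 * INR m.+1) * x = (INR m - 1 - 2 * INR m) * x by rewrite !S_INR; ring.
by ring.
Qed.

Lemma chebyshevU_cos m x : chebyshevU m (RtoC (cos x)) = RtoC (cosine_sum m.+1 x).
Proof.
have h0 : cosine_sum 1 x = 1.
  by rewrite /cosine_sum big_ord_recr big_ord0 /= (_ : (1 - 1 - 2 * 0) * x = 0) ?cos_0; ring.
have h1 : cosine_sum 2 x = 2 * cos x.
  rewrite cosine_sum_rec h0 /cosine_sum big_ord0; ring.
have h2 : cosine_sum 3 x = 4 * cos x ^ 2 - 1 by rewrite cosine_sum_rec h0 h1; ring.
have h3 : cosine_sum 4 x = 8 * cos x ^ 3 - 4 * cos x by rewrite cosine_sum_rec h2 h1; ring.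
suff : forall m, chebyshevU m (RtoC (cos x)) = RtoC (cosine_sum m.+1 x) /\
    chebyshevU m.+1 (RtoC (cos x)) = RtoC (cosine_sum m.+2 x) by move=> /(_ m) [].
elim=> [|{}m [ih1 ih2]].
  split; first by rewrite h0.
  by rewrite h1 RtoC_mult.
(* Degrees 2 and 3 are explicit cases of [chebyshevU]; its recurrence starts at degree 4. *)
split => //; case: m ih1 ih2 => [|[|m]] ih1 ih2.
- by rewrite h2 /= RtoC_minus !RtoC_mult Cmult_1_r.
- by rewrite h3 /= RtoC_minus !RtoC_mult !Cmult_1_r.
- rewrite (cosine_sum_rec m.+3) RtoC_minus !RtoC_mult -ih1 -ih2 //.
Qed.

Lemma cosine_sum_sin m x : cosine_sum m x * sin x = sin (INR m * x).
Proof.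
have h k : (\big[Rplus/0]_(r < k) cos ((INR m - 1 - 2 * INR r) * x)) * (2 * sin x) =
    sin (INR m * x) - sin ((INR m - 2 * INR k) * x).
  elim: k => [|k ih].
    by rewrite big_ord0 /= (_ : (INR m - 2 * 0) * x = INR m * x); ring.
  rewrite big_ord_recr /= Rmult_plus_distr_r ih.
  set y := (INR m - 1 - 2 * INR k) * x.
  have -> : (INR m - 2 * INR k) * x = y + x by rewrite /y; ring.
  have -> : (INR m - 2 * INR k.+1) * x = y - x by rewrite /y S_INR; ring.
  by rewrite sin_plus sin_minus; ring.
have := h m; rewrite -/(cosine_sum m x).
have -> : (INR m - 2 * INR m) * x = - (INR m * x) by ring.
rewrite sin_neg; lra.
Qed.

Section Kernel.
Variable n : nat.
Hypothesis n0 : (0 < n)%N.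

Let nR : 0 < INR n.
Proof. by apply: lt_0_INR; apply/ltP. Qed.

(** The [exp (i th_r)] are the [n]-th roots of [(-1)^(n-1)], and the frequencies are symmetric about
    0. *)
Let th (r : 'I_n) : R := (INR n - 1 - 2 * INR r) * PI / INR n.

(** [skernel y = U_{n-1}(cos(pi y / n)) / n]. *)
Definition skernel (y : R) : R := / INR n * cosine_sum n (PI * y / INR n).

Let skernelE y : skernel y = / INR n * \big[Rplus/0]_(r < n) cos (th r * y).
Proof.
rewrite /skernel /cosine_sum; congr (_ * _); apply: eq_bigr => r _; congr cos.
by rewrite /th /Rdiv; ring.
Qed.

Lemma skernel_0 : skernel 0 = 1.
Proof.
rewrite skernelE (eq_bigr (fun _ => 1)); last by move=> r _; rewrite Rmult_0_r cos_0.
by rewrite rsum_const; field; lra.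
Qed.

Lemma skernel_sin y : skernel y * (INR n * sin (PI * y / INR n)) = sin (PI * y).
Proof.
rewrite /skernel (_ : PI * y = INR n * (PI * y / INR n)); last by field; lra.
rewrite -cosine_sum_sin (_ : INR n * (PI * y / INR n) / INR n = PI * y / INR n); last by field; lra.
by field; lra.
Qed.

Lemma sin_nat (m : nat) : sin (PI * INR m) = 0.
Proof.
elim: m => [|m ih]; first by rewrite /= Rmult_0_r sin_0.
by rewrite S_INR Rmult_plus_distr_l Rmult_1_r neg_sin ih Ropp_0.
Qed.

(** In [skernel_sin] the right side vanishes at integers, while [sin (PI m / n)] does not for
    [0 < m < n]. *)
Lemma skernel_nat (m : nat) : (0 < m)%N -> (m < n)%N -> skernel (INR m) = 0 /\ skernel (- INR m) = 0.
Proof.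
move=> hm hmn.
have m0 : 0 < INR m by apply: lt_0_INR; apply/ltP.
have mn : INR m < INR n by apply: lt_INR; apply/ltP.
have hpi := PI_RGT_0.
have hs : 0 < sin (PI * INR m / INR n).
  apply: sin_gt_0; first by apply: Rdiv_lt_0_compat => //; apply: Rmult_lt_0_compat.
  by apply/Rlt_div_l => //; apply: Rmult_lt_compat_l.
have hq : INR n * sin (PI * INR m / INR n) <> 0 by apply: Rgt_not_eq; apply: Rmult_lt_0_compat.
have h1 := skernel_sin (INR m); have h2 := skernel_sin (- INR m).
rewrite sin_nat in h1.
have e : PI * - INR m / INR n = - (PI * INR m / INR n) by field; lra.
rewrite e sin_neg (_ : PI * - INR m = - (PI * INR m)) ?sin_neg ?sin_nat in h2; last ring.
split; first by case: (Rmult_integral _ _ h1).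
apply: (Rmult_eq_reg_r (INR n * sin (PI * INR m / INR n))) => //; lra.
Qed.

Lemma cos_nat (m : nat) y : cos (y + PI * INR m) = (-1) ^ m * cos y.
Proof.
elim: m => [|m ih]; first by rewrite /= Rmult_0_r Rplus_0_r; ring.
rewrite S_INR Rmult_plus_distr_l Rmult_1_r -Rplus_assoc neg_cos ih /=; ring.
Qed.

Lemma sign_sq (m : nat) : (-1) ^ m * (-1) ^ m = 1.
Proof. by rewrite -pow_add (_ : (m + m)%coq_nat = (2 * m)%coq_nat); [apply: pow_1_even | lia]. Qed.

(** Since [th_r n = (n - 1 - 2 r) PI], every cosine acquires the same sign [(-1)^(n-1)]. *)
Lemma skernel_period y : skernel (y + INR n) = - (-1) ^ n * skernel y.
Proof.
rewrite !skernelE.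
set S := (X in _ = _ * (_ * X)).
rewrite (_ : - (-1) ^ n * (/ INR n * S) = / INR n * (- (-1) ^ n * S)); last by ring.
congr (_ * _); rewrite /S rsum_distr.
apply: eq_bigr => r _.
have -> : th r * (y + INR n) = th r * y - PI * INR (r + r.+1) + PI * INR n.
  by rewrite -plusE plus_INR S_INR /th; field; lra.
rewrite cos_nat.
have := cos_nat (r + r.+1) (th r * y - PI * INR (r + r.+1)).
rewrite (_ : th r * y - PI * INR (r + r.+1) + PI * INR (r + r.+1) = th r * y); last ring.
rewrite -plusE pow_add [(-1) ^ r.+1]/=.
have := sign_sq r => h.
have -> : (-1) ^ r * (-1 * (-1) ^ r) = -1 by lra.
by move=> ->; ring.
Qed.

Let th_rev r : th (rev_ord r) = - th r.
Proof.
rewrite /th /= -minusE minus_INR; last by apply/leP.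
by rewrite S_INR; field; lra.
Qed.

(** The symmetry of the frequencies cancels the sines in pairs. *)
Let sin_th b : \big[Rplus/0]_(r < n) sin (th r * b) = 0.
Proof.
have h : \big[Rplus/0]_(r < n) sin (th r * b) = - \big[Rplus/0]_(r < n) sin (th r * b).
  rewrite {1}(reindex_inj rev_ord_inj) /=.
  rewrite (_ : - (\big[Rplus/0]_(r < n) sin (th r * b)) = -1 * \big[Rplus/0]_(r < n) sin (th r * b)); last by ring.
  rewrite rsum_distr; apply: eq_bigr => r _.
  have -> : th (rev_ord r) * b = - (th r * b) by rewrite th_rev; ring.
  by rewrite sin_neg; ring.
lra.
Qed.

Let geometric k (c d : R) : 2 * sin (d / 2) * \big[Rplus/0]_(j < k) cos (c + INR j * d) =
  sin (c + INR k * d - d / 2) - sin (c - d / 2).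
Proof.
elim: k => [|k ih]; first by rewrite big_ord0 /= Rmult_0_l Rplus_0_r; ring.
rewrite big_ord_recr /= Rmult_plus_distr_l ih.
have -> : c + INR k.+1 * d - d / 2 = c + INR k * d + d / 2 by rewrite S_INR; field.
by rewrite sin_plus sin_minus; ring.
Qed.

(** The step [2 PI (r - r') / n] is not a multiple of [2 PI], and [n] steps make whole turns: the
    geometric sum closes up to 0. *)
Let orthogonal (r r' : 'I_n) (c : R) : r != r' ->
  \big[Rplus/0]_(j < n) cos (c + INR j * (th r' - th r)) = 0.
Proof.
move=> ne; have hpi := PI_RGT_0.
have e : th r' - th r = 2 * PI * (INR r - INR r') / INR n by rewrite /th; field; lra.
have hr : INR r < INR n by apply: lt_INR; apply/ltP.
have hr' : INR r' < INR n by apply: lt_INR; apply/ltP.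
have r0 := pos_INR r; have r0' := pos_INR r'.
have := geometric n c (th r' - th r).
have -> : c + INR n * (th r' - th r) - (th r' - th r) / 2 =
   (c - (th r' - th r) / 2 - 2 * INR r' * PI) + 2 * INR r * PI by rewrite e; field; lra.
rewrite sin_period -(sin_period (_ - 2 * INR r' * PI) r').
have -> : c - (th r' - th r) / 2 - 2 * INR r' * PI + 2 * INR r' * PI = c - (th r' - th r) / 2 by ring.
rewrite Rminus_diag => h.
case: (Rmult_integral _ _ h) => // h2.
have {h2} : sin ((th r' - th r) / 2) = 0 by lra.
have -> : (th r' - th r) / 2 = PI * (INR r - INR r') / INR n by rewrite e; field; lra.
have pos x : 0 < x < INR n -> 0 < sin (PI * x / INR n).
  move=> hx; apply: sin_gt_0; first by apply: Rdiv_lt_0_compat => //; apply: Rmult_lt_0_compat; lra.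
  by apply/Rlt_div_l => //; apply: Rmult_lt_compat_l; lra.
case: (ltngtP r r') => [lt|lt|eq].
- have l : INR r < INR r' by apply: lt_INR; apply/ltP.
  have -> : PI * (INR r - INR r') / INR n = - (PI * (INR r' - INR r) / INR n) by field; lra.
  by rewrite sin_neg; have := pos (INR r' - INR r); lra.
- have l : INR r' < INR r by apply: lt_INR; apply/ltP.
  by have := pos (INR r - INR r'); lra.
- by move: ne; rewrite (val_inj eq) eqxx.
Qed.

(** The matrices with entries [(-1)^(i+j) skernel(al + i - j)] form a one-parameter group: in the
    Fourier basis they are diagonal, with entries [exp(i al th_r)] up to sign. *)
Lemma skernel_convolution (a b : R) :
  \big[Rplus/0]_(j < n) (skernel (a - INR j) * skernel (b + INR j)) = skernel (a + b).
Proof.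
have e1 (j : 'I_n) : skernel (a - INR j) * skernel (b + INR j) =
  / INR n * / INR n * \big[Rplus/0]_(r < n) \big[Rplus/0]_(r' < n)
     cos ((th r * a + th r' * b) + INR j * (th r' - th r)).
  rewrite !skernelE.
  rewrite (_ : forall u v : R, / INR n * u * (/ INR n * v) = / INR n * / INR n * (v * u)); last by move=> u v; ring.
  congr (_ * _); rewrite rsum_distr; apply: eq_bigr => r _.
  rewrite Rmult_comm rsum_distr.
  (* The product of cosines differs from the cosine of the sum by a product of sines, which
     disappears after summation over [i] by [sin_th]. *)
  have h : \big[Rplus/0]_(i < n) (cos (th r * (a - INR j)) * cos (th i * (b + INR j))) =
    \big[Rplus/0]_(i < n) cos (th r * a + th i * b + INR j * (th i - th r)) +
    sin (th r * (a - INR j)) * \big[Rplus/0]_(i < n) sin (th i * (b + INR j)).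
    rewrite rsum_distr -big_split /=; apply: eq_bigr => i _.
    have -> : th r * a + th i * b + INR j * (th i - th r) = th r * (a - INR j) + th i * (b + INR j) by ring.
    by rewrite cos_plus; ring.
  by rewrite h sin_th; ring.
rewrite (eq_bigr _ (fun j _ => e1 j)) -rsum_distr exchange_big /=.
rewrite (eq_bigr (fun r : 'I_n => INR n * cos (th r * (a + b)))).
  rewrite -rsum_distr skernelE; field; lra.
(* Only the diagonal [r' = r] survives the summation over [j]. *)
move=> r _; rewrite exchange_big /= (bigD1 r) //=.
rewrite (eq_bigr (fun _ => cos (th r * (a + b)))); last first.
  by move=> j _; congr cos; ring.
rewrite rsum_const big1; first ring.
by move=> r' ne; apply: orthogonal; rewrite eq_sym.
Qed.
End Kernel.

(** * Antiperiodic sequences *)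

Local Notation "c ** x" := (scal (RtoC c : C_AbsRing) x) (at level 40, left associativity).
Local Notation "'\vsum_' ( i < n ) F" := (\big[plus/zero]_(i < n) F)
  (at level 41, F at level 41, i, n at level 50).

Section RealScalars.
Variable U : ModuleSpace C_Ring.
Implicit Types x y : U.

Lemma rscal_1 x : 1 ** x = x.
Proof. exact: scal_one. Qed.

Lemma rscal_0 x : 0 ** x = zero.
Proof. by rewrite (_ : RtoC 0 = zero) // scal_zero_l. Qed.

Lemma rscal_assoc a b x : a ** (b ** x) = (a * b) ** x.
Proof. by rewrite scal_assoc; congr scal; rewrite RtoC_mult. Qed.

Lemma rscal_plus a b x : (a + b) ** x = plus (a ** x) (b ** x).
Proof. by rewrite -scal_distr_r; congr scal; rewrite RtoC_plus. Qed.

Lemma rscal_opp x : opp x = (-1) ** x.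
Proof. by rewrite -scal_opp_one; congr scal; symmetry; apply: (RtoC_opp 1). Qed.

Lemma vsum_scal n (c : C_Ring) (F : 'I_n -> U) : scal c (\vsum_(i < n) F i) = \vsum_(i < n) scal c (F i).
Proof.
apply: (big_morph (fun x => scal c x)) => [x y|]; [exact: scal_distr_l | exact: scal_zero_r].
Qed.

Lemma vsum_rscal n (c : 'I_n -> R) x : (\big[Rplus/0]_(i < n) c i) ** x = \vsum_(i < n) (c i ** x).
Proof. by apply: (big_morph (fun c => c ** x)) => [a b|]; [exact: rscal_plus | exact: rscal_0]. Qed.
End RealScalars.

Lemma vsum_telescope (G : AbelianGroup) n (f : nat -> G) :
  \vsum_(k < n) minus (f k) (f k.+1) = minus (f 0%N) (f n).
Proof.
elim: n => [|n ih]; first by rewrite big_ord0 minus_eq_zero.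
by rewrite big_ord_recr ih /= -minus_trans.
Qed.

Lemma vsum_periodic (G : AbelianMonoid) n (f : nat -> G) : (forall k, f (k + n)%N = f k) ->
  forall i, \vsum_(k < n) f (i + k)%N = \vsum_(k < n) f k.
Proof.
move=> h; elim=> [|i ih]; first by apply: eq_bigr => k _; rewrite add0n.
rewrite -ih; case: n h ih => [|n] h ih; first by rewrite !big_ord0.
rewrite big_ord_recr [RHS]big_ord_recl /= plus_comm; congr plus.
  by rewrite addn0 addSnnS h.
by apply: eq_bigr => k _; rewrite /bump /= add1n addSnnS.
Qed.

Lemma is_linear_vsum n (U V : NormedModule C_AbsRing) (S : U -> V) (F : 'I_n -> U) : is_linear S ->
  S (\vsum_(i < n) F i) = \vsum_(i < n) S (F i).
Proof.
by move=> hS; apply: (big_morph S) => [x y|]; [apply: linear_plus | apply: linear_zero].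
Qed.

Lemma vsum_norm n (U : NormedModule C_AbsRing) (F : 'I_n -> U) c : (forall i, norm (F i) <= c) ->
  norm (\vsum_(i < n) F i) <= INR n * c.
Proof.
elim: n F => [|n ih] F h; first by rewrite big_ord0 norm_zero /=; lra.
rewrite S_INR big_ord_recr /=; apply: Rle_trans (norm_triangle _ _) _.
rewrite Rmult_plus_distr_r Rmult_1_l; apply: Rplus_le_compat; last exact: h.
by apply: ih => i; apply: h.
Qed.

Section Antiperiodic.
Variables (X : NormedModule C_AbsRing) (n : nat).
Hypothesis n0 : (0 < n)%N.
Implicit Types u v : 'I_n -> X.

Definition cyc (k : nat) : 'I_n := Ordinal (ltn_pmod k n0).

(** The extension of [u] to all indices with [u (k + n) = - u k]. *)
Definition ext u (k : nat) : X := (-1) ^ (k %/ n) ** u (cyc k).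

Lemma ext_ord u (i : 'I_n) : ext u i = u i.
Proof.
rewrite /ext divn_small // rscal_1; congr u; apply: val_inj => /=; exact: modn_small.
Qed.

Lemma ext_period u k : ext u (k + n) = opp (ext u k).
Proof.
rewrite /ext divnDr // divnn n0 addn1 rscal_opp rscal_assoc; congr (_ ** _).
by congr u; apply: val_inj; rewrite /= modnDr.
Qed.

Lemma ext_unique (F : nat -> X) : (forall k, F (k + n)%N = opp (F k)) ->
  forall k, ext (fun i => F i) k = F k.
Proof.
move=> h k; rewrite /ext /= {3}(divn_eq k n).
elim: (k %/ n)%N => [|q ih]; first by rewrite mul0n add0n rscal_1.
rewrite mulSn -addnA addnC h -ih rscal_opp rscal_assoc; congr (_ ** _).
Qed.

Lemma ext_fun u v k : (forall i, u i = v i) -> ext u k = ext v k.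
Proof. by rewrite /ext => ->. Qed.

Lemma ext_plus u v k : ext (fun i => plus (u i) (v i)) k = plus (ext u k) (ext v k).
Proof. by rewrite /ext scal_distr_l. Qed.

Lemma ext_scal (c : C_AbsRing) u k : ext (fun i => scal c (u i)) k = scal c (ext u k).
Proof. rewrite /ext !scal_assoc; congr scal; exact: Cmult_comm. Qed.

Lemma ext_norm u k r : (forall i, norm (u i) <= r) -> norm (ext u k) <= r.
Proof.
move=> h; apply: Rle_trans (norm_scal _ _) _; rewrite /abs /= Cmod_R -RPow_abs.
by rewrite Rabs_Ropp Rabs_R1 pow1 Rmult_1_l.
Qed.

(** The constant factor of [Lambda^al]: the matrix of the theorem without the powers of [A]. The
    sign [(-1)^(i+j)] is [(-1)^(i-j)] with a natural exponent. *)
Definition cycpow (al : R) u (i : 'I_n) : X :=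
  \vsum_(j < n) ((-1) ^ (i + j) * skernel n (al + INR i - INR j)) ** u j.

Lemma cycpow_comp a b u i : cycpow a (cycpow b u) i = cycpow (a + b) u i.
Proof.
rewrite /cycpow.
rewrite (eq_bigr (fun j : 'I_n => \vsum_(k < n)
   (((-1) ^ (i + j) * skernel n (a + INR i - INR j)) * ((-1) ^ (j + k) * skernel n (b + INR j - INR k))) ** u k)); last first.
  by move=> j _; rewrite vsum_scal; apply: eq_bigr => k _; rewrite rscal_assoc.
rewrite exchange_big /=; apply: eq_bigr => k _; rewrite -vsum_rscal; congr (_ ** _).
rewrite (eq_bigr (fun j : 'I_n => (-1) ^ (i + k) *
    (skernel n (a + INR i - INR j) * skernel n (b - INR k + INR j)))).
  by rewrite -rsum_distr skernel_convolution //; congr (_ * skernel n _); ring.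
move=> j _; rewrite (_ : b + INR j - INR k = b - INR k + INR j); last ring.
have -> : (-1) ^ (i + j) * skernel n (a + INR i - INR j) * ((-1) ^ (j + k) * skernel n (b - INR k + INR j)) =
  (-1) ^ (i + j) * (-1) ^ (j + k) * (skernel n (a + INR i - INR j) * skernel n (b - INR k + INR j)) by ring.
congr (_ * _); rewrite -!plusE !pow_add; have := sign_sq j => h.
have -> : (-1) ^ i * (-1) ^ j * ((-1) ^ j * (-1) ^ k) = (-1) ^ i * (-1) ^ k * ((-1) ^ j * (-1) ^ j) by ring.
by rewrite h Rmult_1_r.
Qed.

Lemma skernel_diff (i j : nat) : (i < n)%N -> (j < n)%N -> i != j -> skernel n (INR i - INR j) = 0.
Proof.
move=> hi hj; case: (ltngtP i j) => // lt _.
- have -> : INR i - INR j = - INR (j - i) by rewrite -minusE minus_INR; [ring | apply/leP; apply: ltnW].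
  by apply: (proj2 (@skernel_nat _ n0 (j - i) _ _)); rewrite ?subn_gt0 //; apply: leq_ltn_trans (leq_subr _ _) hj.
- have -> : INR i - INR j = INR (i - j) by rewrite -minusE minus_INR //; apply/leP; apply: ltnW.
  by apply: (proj1 (@skernel_nat _ n0 (i - j) _ _)); rewrite ?subn_gt0 //; apply: leq_ltn_trans (leq_subr _ _) hi.
Qed.

Lemma cycpow_0 u i : cycpow 0 u i = u i.
Proof.
rewrite /cycpow (bigD1 i) //= big1; last first.
  by move=> j ne; rewrite Rplus_0_l skernel_diff ?Rmult_0_r ?rscal_0 // eq_sym.
rewrite plus_zero_r (_ : 0 + INR i - INR i = 0); last ring.
by rewrite skernel_0 // -plusE pow_add sign_sq Rmult_1_r rscal_1.
Qed.

(** By [skernel_period] and the antiperiodicity of [ext] the summand is [n]-periodic in [j], so the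
    summation may start at [j = i]: the matrix acts by convolution, as the resolvent does. *)
Lemma cycpow_ext al u i : cycpow al u i = \vsum_(k < n) ((-1) ^ k * skernel n (al - INR k)) ** ext u (i + k).
Proof.
pose F j := ((-1) ^ (i + j) * skernel n (al + INR i - INR j)) ** ext u j.
have hF j : F (j + n)%N = F j.
  rewrite /F ext_period rscal_opp rscal_assoc; congr (_ ** _).
  have -> : INR (j + n)%N = INR j + INR n by rewrite -plusE plus_INR.
  have h := skernel_period n0 (al + INR i - (INR j + INR n)).
  rewrite (_ : al + INR i - (INR j + INR n) + INR n = al + INR i - INR j) in h; last ring.
  rewrite h -!plusE !pow_add; ring.
rewrite /cycpow (eq_bigr (fun j : 'I_n => F j)); last by move=> j _; rewrite /F ext_ord.
rewrite -(vsum_periodic hF i); apply: eq_bigr => k _; rewrite /F; congr (_ ** _).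
congr (_ * _); last by congr skernel; rewrite -plusE plus_INR; ring.
by rewrite -!plusE !pow_add -Rmult_assoc sign_sq Rmult_1_l.
Qed.

Lemma cycpow_1 (n1 : (1 < n)%N) u i : cycpow 1 u i = opp (ext u i.+1).
Proof.
rewrite cycpow_ext (bigD1 (Ordinal n1)) //= big1 ?plus_zero_r; last first.
  move=> k ne; rewrite (_ : 1 - INR k = INR 1 - INR k) // skernel_diff ?Rmult_0_r ?rscal_0 //.
  by rewrite eq_sym; apply: contra ne => /eqP e; apply/eqP; apply: val_inj.
rewrite (_ : 1 - 1 = 0); last ring.
by rewrite skernel_0 // addn1 rscal_opp /=; congr (_ ** _); ring.
Qed.

Lemma cycpow_map (S : X -> X) al u i : is_linear S -> cycpow al (fun j => S (u j)) i = S (cycpow al u i).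
Proof.
by move=> hS; rewrite /cycpow is_linear_vsum //; apply: eq_bigr => j _; rewrite linear_scal.
Qed.

Lemma cycpow_fun al u v i : (forall j, u j = v j) -> cycpow al u i = cycpow al v i.
Proof. by move=> h; apply: eq_bigr => j _; rewrite h. Qed.
End Antiperiodic.

(** * The phase space as a power of X *)

Section PhaseSpaceCoordinates.
Variables (X : Hilbert) (A : operator X) (hA : positive_selfadjoint A) (n : nat).
Hypothesis n1 : (1 < n)%N.
Local Notation Tp := (inv_power hA).
Local Notation Y := (phase_space hA n).

Let n0 : (0 < n)%N. Proof. exact: ltnW. Qed.

Lemma INR_gt1 : 1 < INR n.
Proof. by apply: (lt_INR 1); apply/ltP. Qed.

Definition weight (i : 'I_n) : R := (INR n - INR i.+1) / INR n.

Lemma weight01 (i : 'I_n) : 0 <= weight i <= 1.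
Proof.
have := INR_gt1; have : INR i.+1 <= INR n by apply: le_INR; apply/leP.
have := pos_INR i.+1; move=> h1 h2 h3; split.
  by apply: Rdiv_le_0_compat; lra.
by apply/Rle_div_l; lra.
Qed.

(** [(A^(n-1)/n v_1, ..., A^(1/n) v_(n-1), v_n)], an isometry of [Y] onto [X^n]. *)
Definition flat (v : Y) (i : 'I_n) : X := op_val (frac_power0 A (weight i)) (coord v i).

Lemma flatP (v : Y) i : coord v i = Tp (weight i) (flat v i).
Proof.
apply/frac_power0_char; first exact: weight01.
exact: (op_valP (proj2_sig (v i))).
Qed.

Definition unflat (u : 'I_n -> X) : Y := fun i =>
  exist _ (Tp (weight i) (u i))
    (ex_intro _ (u i) ((frac_power0_char hA (Tp (weight i) (u i)) (u i) (weight01 i)).2 erefl)).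

Lemma coord_unflat u i : coord (unflat u) i = Tp (weight i) (u i).
Proof. by []. Qed.

Lemma flat_unflat u i : flat (unflat u) i = u i.
Proof. by apply: (@Tp_inj _ _ hA _ _ _ (weight01 i)); rewrite -flatP coord_unflat. Qed.

Lemma flat_inj (v w : Y) : (forall i, flat v i = flat w i) -> v = w.
Proof.
move=> h; apply: functional_extensionality_dep => i; apply: dom_car_eq.
by have := flatP v i; have := flatP w i; rewrite h /coord => -> ->.
Qed.

Lemma flat_eq (v : Y) i x : coord v i = Tp (weight i) x -> flat v i = x.
Proof. by move=> h; apply: (@Tp_inj _ _ hA _ _ _ (weight01 i)); rewrite -flatP. Qed.

Lemma flat_plus (v w : Y) i : flat (plus v w) i = plus (flat v i) (flat w i).
Proof.
apply: flat_eq; rewrite Tp_plus; last by have := weight01 i; lra.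
by rewrite -!flatP.
Qed.

Lemma flat_scal (c : C_AbsRing) (v : Y) i : flat (scal c v) i = scal c (flat v i).
Proof.
apply: flat_eq; rewrite Tp_scal; last by have := weight01 i; lra.
by rewrite -!flatP.
Qed.

Lemma flat_zero i : flat zero i = zero.
Proof. by apply: flat_eq; rewrite /inv_power Phi_zero //; apply: fcont_pw; have := weight01 i; lra. Qed.

Lemma flat_opp (v : Y) i : flat (opp v) i = opp (flat v i).
Proof. by rewrite -scal_opp_one flat_scal scal_opp_one. Qed.

Lemma norm_flat (v : Y) : norm v = l2 (fun i => norm (flat v i)).
Proof. by []. Qed.

Lemma norm_flat_le (v : Y) i : norm (flat v i) <= norm v.
Proof.
rewrite norm_flat /l2 -[X in X <= _]sqrt_pow2; last exact: norm_ge_0.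
apply: sqrt_le_1_alt; rewrite (bigD1 i) //=.
set s := \big[_/_]_(_ < _ | _) _.
have : 0 <= s.
  by apply: big_ind => [|x y|j _]; [lra | lra | apply: (pow2_ge_0 (norm (flat v j)))].
by rewrite /=; lra.
Qed.

Lemma norm_le_flat (v : Y) c : (forall i, norm (flat v i) <= c) -> norm v <= INR n * c.
Proof.
move=> h; rewrite norm_flat.
have c0 : 0 <= c by apply: Rle_trans (h (Ordinal n0)); apply: norm_ge_0.
have hn := INR_gt1.
rewrite /l2 -[X in _ <= X]sqrt_pow2; last by apply: Rmult_le_pos; lra.
apply: sqrt_le_1_alt.
apply: (Rle_trans _ (\big[Rplus/0]_(i < n) c ^ 2)).
  apply: (big_ind2 Rle); [lra | by move=> *; apply: Rplus_le_compat |].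
  by move=> i _; apply: pow_incr; split; [exact: norm_ge_0 | exact: h].
rewrite rsum_const Rpow_mult_distr; apply: Rmult_le_compat_r; first exact: pow2_ge_0.
by rewrite /=; nra.
Qed.

(** Bounds refer to the largest component norm, which [norm_flat_le] and [norm_le_flat] compare with
    the norm of [Y] up to the factor [n]; matrices can then be estimated entrywise. *)
Record bounded_map (F : ('I_n -> X) -> 'I_n -> X) (c : R) : Prop := BoundedMap {
  bm_plus : forall u v i, F (fun j => plus (u j) (v j)) i = plus (F u i) (F v i);
  bm_scal : forall (a : C_AbsRing) u i, F (fun j => scal a (u j)) i = scal a (F u i);
  bm_bound : forall u r, (forall j, norm (u j) <= r) -> forall i, norm (F u i) <= c * r
}.

Lemma bounded_map_linear F c : bounded_map F c -> is_linear (fun v : Y => unflat (F (flat v))).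
Proof.
move=> [h1 h2 h3]; split.
- move=> x y; apply: flat_inj => i; rewrite flat_plus !flat_unflat -h1; congr (F _ i).
  by apply: functional_extensionality => j; rewrite flat_plus.
- move=> a x; apply: flat_inj => i; rewrite flat_scal !flat_unflat -h2; congr (F _ i).
  by apply: functional_extensionality => j; rewrite flat_scal.
- exists (INR n * (Rabs c + 1)); have hn := INR_gt1; split.
    by apply: Rmult_lt_0_compat; have := Rabs_pos c; lra.
  move=> x; rewrite Rmult_assoc; apply: norm_le_flat => i; rewrite flat_unflat.
  apply: Rle_trans (h3 _ _ (norm_flat_le x) i) _.
  by apply: Rmult_le_compat_r; [exact: norm_ge_0 | have := Rle_abs c; lra].
Qed.

Lemma bounded_map_norm F c (v : Y) : bounded_map F c -> norm (unflat (F (flat v))) <= INR n * (c * norm v).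
Proof. by move=> h; apply: norm_le_flat => i; rewrite flat_unflat; apply: (bm_bound h); apply: norm_flat_le. Qed.

Lemma bounded_map_comp F G c d : bounded_map F c -> bounded_map G d ->
  bounded_map (fun u => F (G u)) (c * d).
Proof.
move=> [f1 f2 f3] [g1 g2 g3]; split.
- move=> u v i; rewrite -f1; congr (F _ i).
  by apply: functional_extensionality => j; rewrite g1.
- move=> a u i; rewrite -f2; congr (F _ i).
  by apply: functional_extensionality => j; rewrite g2.
- by move=> u r h i; rewrite Rmult_assoc; apply: f3; apply: g3.
Qed.

Lemma bounded_map_sum m (F : 'I_m -> ('I_n -> X) -> 'I_n -> X) c :
  (forall k, bounded_map (F k) c) -> bounded_map (fun u i => \vsum_(k < m) F k u i) (INR m * c).
Proof.
move=> h; split.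
- by move=> u v i; rewrite -big_split; apply: eq_bigr => k _; rewrite (bm_plus (h k)).
- by move=> a u i; rewrite vsum_scal; apply: eq_bigr => k _; rewrite (bm_scal (h k)).
- by move=> u r hu i; rewrite Rmult_assoc; apply: vsum_norm => k; apply: (bm_bound (h k)).
Qed.

Lemma bounded_map_each (S : X -> X) : is_linear S ->
  exists c, 0 <= c /\ bounded_map (fun u i => S (u i)) c.
Proof.
move=> hS; have [c [c0 hc]] := linear_norm _ hS; exists c; split; first lra.
split=> [u v i|a u i|u r h i]; [exact: linear_plus | exact: linear_scal |].
by apply: Rle_trans (hc _) _; apply: Rmult_le_compat_l; [lra | exact: h].
Qed.

Lemma bounded_map_le F c d : bounded_map F c -> c <= d -> bounded_map F d.
Proof.
move=> [h1 h2 h3] hcd; split=> // u r hr i.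
have r0 : 0 <= r by apply: Rle_trans (hr i); apply: norm_ge_0.
by apply: Rle_trans (h3 u r hr i) _; apply: Rmult_le_compat_r.
Qed.

Lemma bounded_map_cycpow al : exists c, bounded_map (cycpow (X := X) (n := n) al) c.
Proof.
pose a (i j : 'I_n) := (-1) ^ (i + j) * skernel n (al + INR i - INR j).
have [m hm] : exists m, forall i j, Rabs (a i j) <= m.
  exists (\big[Rplus/0]_(i < n) \big[Rplus/0]_(j < n) Rabs (a i j)) => i j.
  rewrite (bigD1 i) //= (bigD1 j) //=.
  set s := \big[_/_]_(_ < _ | _ != j) _; set t := \big[_/_]_(_ < _ | _ != i) _.
  have : 0 <= s by apply: big_ind => [|x y|k _]; [lra | lra | exact: Rabs_pos].
  have : 0 <= t.
    apply: big_ind => [|x y|k _]; [lra | lra |].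
    by apply: big_ind => [|x y|k' _]; [lra | lra | exact: Rabs_pos].
  lra.
exists (INR n * m); split.
- move=> u v i; rewrite /cycpow -big_split; apply: eq_bigr => j _; exact: scal_distr_l.
- move=> c u i; rewrite /cycpow vsum_scal; apply: eq_bigr => j _; rewrite !scal_assoc; congr scal; exact: Cmult_comm.
- move=> u r hu i; rewrite Rmult_assoc; apply: vsum_norm => j.
  apply: Rle_trans (norm_scal _ _) _; rewrite /abs /= Cmod_R.
  by apply: Rmult_le_compat; [exact: Rabs_pos | exact: norm_ge_0 | exact: hm | exact: hu].
Qed.

(** [Lambda^a] in flat coordinates, parametrized by [u = A^(a/n) (flat v)] so that only bounded
    operators occur. *)
Definition power_graph (a : R) (v w : Y) : Prop := exists u : 'I_n -> X,
  (forall i, flat v i = Tp (a / INR n) (u i)) /\ (forall i, flat w i = cycpow a u i).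

Lemma index01 a : 0 <= a <= 1 -> 0 <= a / INR n <= 1.
Proof.
move=> ha; have := INR_gt1 => hn; split; first by apply: Rdiv_le_0_compat; lra.
by apply/Rle_div_l; lra.
Qed.

Lemma power_graph_inv a (v w : Y) : 0 <= a <= 1 ->
  power_graph a v w <-> forall i, flat v i = Tp (a / INR n) (cycpow (- a) (flat w) i).
Proof.
move=> ha; split.
- move=> [u [h1 h2]] i; rewrite h1; congr (inv_power _ _).
  rewrite (@cycpow_fun _ _ _ _ (cycpow a u)); last exact: h2.
  by rewrite cycpow_comp // (_ : - a + a = 0) ?cycpow_0 //; ring.
- move=> h; exists (cycpow (- a) (flat w)); split => // i.
  by rewrite cycpow_comp // (_ : a + - a = 0) ?cycpow_0 //; ring.
Qed.

Lemma dom_coord (v : Y) a (i : 'I_n) : 0 <= a <= 1 ->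
  dom (frac_power A ((a + INR n - INR i.+1) / INR n)) (coord v i) <->
  exists x, flat v i = Tp (a / INR n) x.
Proof.
move=> ha; have hn := INR_gt1; have hi := weight01 i; have h1 := index01 ha.
have e : (a + INR n - INR i.+1) / INR n = weight i + a / INR n by rewrite /weight; field; lra.
have h2 : 0 <= weight i + a / INR n <= 1.
  rewrite -e; split; first by rewrite e; lra.
  apply/Rle_div_l; first lra.
  by rewrite S_INR; have := pos_INR i; lra.
rewrite e; split=> [[x /(frac_power_ge0 hA _ _ h2) hx]|[x hx]]; exists x.
  by apply: flat_eq; rewrite hx Tp_add //; lra.
by apply/(frac_power_ge0 hA _ _ h2); rewrite flatP hx Tp_add //; lra.
Qed.

Lemma choose_coord (P : 'I_n -> X -> Prop) : (forall i, exists x, P i x) -> exists u, forall i, P i (u i).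
Proof.
move=> h; exists (fun i => epsilon (inhabits (zero : X)) (P i)) => i.
by apply: epsilon_spec.
Qed.

Lemma power_graph_dom a (v : Y) : 0 <= a <= 1 -> dom (power_graph a) v <->
  forall i : 'I_n, dom (frac_power A ((a + INR n - INR i.+1) / INR n)) (coord v i).
Proof.
move=> ha; split.
- by move=> [w [u [h1 h2]]] i; apply/dom_coord => //; exists (u i).
- move=> h; have [u hu] := choose_coord (fun i => (dom_coord v i ha).1 (h i)).
  by exists (unflat (cycpow a u)), u; split => // i; rewrite flat_unflat.
Qed.

Lemma weight_succ (i j : 'I_n) : j = i.+1 :> nat -> weight i = weight j + 1 / INR n.
Proof. by move=> e; rewrite /weight e !S_INR; field; have := INR_gt1; lra. Qed.

Lemma weight_last (i : 'I_n) : i.+1 = n -> weight i = 0.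
Proof. by move=> e; rewrite /weight e Rminus_diag /Rdiv Rmult_0_l. Qed.

Lemma weight_first (i : 'I_n) : i = 0%N :> nat -> weight i + 1 / INR n = 1.
Proof. by move=> e; rewrite /weight e /=; field; have := INR_gt1; lra. Qed.

Lemma Lambda_dom (v : Y) :
  (forall i : 'I_n, dom (frac_power A ((INR n - INR i) / INR n)) (coord v i)) <->
  exists u : 'I_n -> X, forall i, flat v i = Tp (1 / INR n) (u i).
Proof.
have e (i : 'I_n) : (INR n - INR i) / INR n = (1 + INR n - INR i.+1) / INR n.
  by congr (_ / _); rewrite S_INR; ring.
have h1 : 0 <= 1 <= 1 by lra.
split.
- move=> h; apply: (@choose_coord (fun i x => flat v i = Tp (1 / INR n) x)) => i; apply/(dom_coord v i h1); rewrite -e; exact: h.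
- by move=> [u hu] i; rewrite e; apply/(dom_coord v i h1); exists (u i).
Qed.

(** Weights of neighbouring factors differ by [1/n], the exponent in [flat v = T^(1/n) u], so each
    row becomes a shift of [u]. In the last row antiperiodicity supplies the sign:
    [- ext u n = u 0], which is the row [A v_1]. *)
Lemma LambdaE (v w : Y) : Lambda v w <-> power_graph 1 v w.
Proof.
have hn := INR_gt1; have h01 := @index01 1 ltac:(lra).
have body (u : 'I_n -> X) : (forall i, flat v i = Tp (1 / INR n) (u i)) ->
  ((forall i j : 'I_n, nat_of_ord j = i.+1 -> coord w i = opp (coord v j)) /\
   (forall i j : 'I_n, nat_of_ord i = 0%N -> j.+1 = n -> A (coord v i) (coord w j))) <->
  (forall i, flat w i = cycpow 1 u i).
  move=> hu.
  have s1 (i j : 'I_n) : nat_of_ord j = i.+1 -> opp (coord v j) = Tp (weight i) (opp (u j)).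
    move=> e; have := weight01 j => wj.
    by rewrite (weight_succ e) Tp_opp ?Tp_add ?flatP ?hu //; lra.
  have s2 (i : 'I_n) : nat_of_ord i = 0%N -> coord v i = invA hA (u i).
    move=> e; have := weight01 i => wi.
    by rewrite flatP hu -Tp_add ?weight_first ?Tp_1 //; lra.
  have ex (i j : 'I_n) : nat_of_ord j = i.+1 -> ext n0 u i.+1 = u j.
    by move=> <-; apply: ext_ord.
  have el (i j : 'I_n) : nat_of_ord i = 0%N -> j.+1 = n -> ext n0 u j.+1 = opp (u i).
    by move=> e ej; rewrite (_ : j.+1 = (i + n)%N) ?ext_period ?ext_ord // e add0n.
  split.
  - move=> [h1 h2] i; rewrite (cycpow_1 n0) //.
    case: (ltnP i.+1 n) => hi.
      rewrite (ex i (Ordinal hi)) //; apply: flat_eq; rewrite -s1 //; exact: h1.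
    have ei : i.+1 = n by apply/eqP; rewrite eqn_leq ltn_ord.
    rewrite (el (Ordinal n0) i) // opp_opp; apply: flat_eq.
    rewrite weight_last // Tp_O; apply: (@invA_inj _ _ hA).
    by rewrite -(s2 (Ordinal n0)) //; symmetry; apply: (invAP hA _ _).1; apply: h2.
  - move=> h; split=> i j e.
      by rewrite flatP h (cycpow_1 n0) // (ex i j e) -(s1 i j e).
    move=> ej; apply/(invAP hA); rewrite (s2 i e); congr invA.
    by rewrite flatP h (cycpow_1 n0) // (el i j e ej) opp_opp weight_last // Tp_O.
split.
- move=> [/Lambda_dom [u hu] h]; exists u; split => //; exact: (body u hu).1.
- move=> [u [hu h]]; split; last exact: (body u hu).2.
  by apply/Lambda_dom; exists u.
Qed.
End PhaseSpaceCoordinates.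

(** * Resolvent and fractional powers of Lambda *)

Lemma graph_linear_op (V : NormedModule C_AbsRing) (R : V -> V) : is_linear R ->
  (forall x y, R x = R y -> x = y) -> linear_op (fun x y => x = R y).
Proof.
move=> hR hi; split.
- by move=> x y y' -> /hi.
- by rewrite linear_zero.
- by move=> x y x' y' -> ->; rewrite linear_plus.
- by move=> c x y ->; rewrite linear_scal.
Qed.

Lemma linear_op_eq (V : ModuleSpace C_Ring) (S T : operator V) : op_eq S T -> linear_op S -> linear_op T.
Proof.
move=> h [h1 h2 h3 h4]; split.
- by move=> x y y' /h a /h b; apply: h1 a b.
- exact/h.
- by move=> x y x' y' /h a /h b; apply/h; apply: h3.
- by move=> c x y /h a; apply/h; apply: h4.
Qed.

Lemma graph_closed (V : NormedModule C_AbsRing) (R : V -> V) : is_linear R ->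
  closed_op (fun x y => x = R y).
Proof.
move=> hR [x y] h /=; apply: NNPP => ne; apply: h.
have d0 : 0 < norm (minus x (R y)).
  case: (norm_ge_0 (minus x (R y))) => // e; case: ne.
  by apply: (plus_reg_r (opp (R y))); rewrite plus_opp_r; apply: norm_eq_zero.
have [m [m0 hm]] := linear_norm _ hR.
have nf := @norm_factor_gt_0 _ V.
set d := norm _ in d0.
have e0 : 0 < d / (2 * (1 + m) * @norm_factor _ V).
  by apply: Rdiv_lt_0_compat => //; apply: Rmult_lt_0_compat => //; lra.
exists (mkposreal _ e0) => -[x' y'] [/= h1 h2] e.
have {}h1 := @norm_compat2 _ V x x' (mkposreal _ e0) h1; have {}h2 := @norm_compat2 _ V y y' (mkposreal _ e0) h2.
have e1 : @norm_factor _ V * (d / (2 * (1 + m) * @norm_factor _ V)) = d / (2 * (1 + m)).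
  by field; split; lra.
rewrite /= e1 in h1 h2.
have h3 : d <= norm (minus x' x) + m * norm (minus y' y).
  have -> : d = norm (plus (opp (minus x' x)) (R (minus y' y))).
    rewrite /d /minus (linear_plus R hR) (linear_opp R _ hR) opp_plus opp_opp e [plus (opp _) x]plus_comm -!plus_assoc.
    by congr (norm (plus _ _)); rewrite plus_assoc plus_opp_l plus_zero_l.
  by apply: Rle_trans (norm_triangle _ _) _; rewrite norm_opp; apply: Rplus_le_compat_l; apply: hm.
have e2 : d / (2 * (1 + m)) + m * (d / (2 * (1 + m))) = d / 2 by field; lra.
have h4 := Rmult_lt_compat_l _ _ _ m0 h2.
have h5 := Rplus_lt_compat _ _ _ _ h1 h4; rewrite e2 in h5.
have := Rle_lt_trans _ _ _ h3 h5; lra.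
Qed.

Lemma closed_op_eq (V : NormedModule C_AbsRing) (S T : operator V) : op_eq S T -> closed_op S -> closed_op T.
Proof.
move=> h hS x hx; apply/h; apply: hS => hl; apply: hx.
by apply: filter_imp hl => y hy /h.
Qed.

Lemma bounded_op_graph (V : NormedModule C_AbsRing) (T : operator V) R : is_linear R ->
  (forall x y, T x y <-> y = R x) -> bounded_op T.
Proof. by move=> h1 h2; exists R. Qed.

Lemma is_RInt_gen_vsum (V : NormedModule R_AbsRing) Fa Fb (FFa : Filter Fa) (FFb : Filter Fb) m
    (f : 'I_m -> R -> V) (y : 'I_m -> V) :
  (forall i, is_RInt_gen (f i) Fa Fb (y i)) ->
  is_RInt_gen (fun l => \vsum_(i < m) f i l) Fa Fb (\vsum_(i < m) y i).
Proof.
elim: m f y => [|m ih] f y h.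
  rewrite big_ord0.
  apply: (@is_RInt_gen_ext V Fa Fb _ _ (fun _ => zero)).
    by apply: filter_forall => ab t _; rewrite big_ord0.
  move=> P hP; rewrite /filtermapi; apply: filter_forall => ab; exists zero; split; last exact: locally_singleton.
  have := @is_RInt_const V ab.1 ab.2 zero; by rewrite scal_zero_r.
rewrite big_ord_recr /=.
apply: (@is_RInt_gen_ext V Fa Fb _ _
  (fun l => plus (\vsum_(i < m) f (widen_ord (leqnSn m) i) l) (f ord_max l))).
  by apply: filter_forall => ab t _; rewrite big_ord_recr.
apply: is_RInt_gen_plus => //.
by apply: (ih (fun i => f (widen_ord (leqnSn m) i)) (fun i => y (widen_ord (leqnSn m) i))) => i.
Qed.

Section LambdaCalculus.
Variables (X : Hilbert) (A : operator X) (hA : positive_selfadjoint A) (n : nat).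
Hypothesis n1 : (1 < n)%N.
Local Notation Phi := (fcalc hA).
Local Notation fcont := (fcont hA).
Local Notation Tp := (inv_power hA).
Local Notation Y := (phase_space hA n).
Local Notation L := (@Lambda X A hA n).
Local Notation flat := (@flat X A hA n).
Local Notation unflat := (@unflat X A hA n n1).

Let n0 : (0 < n)%N. Proof. exact: ltnW. Qed.
Let hn : 1 < INR n. Proof. exact: INR_gt1. Qed.

Local Notation ext := (ext n0).

Let S (x : X) : X := Tp (1 / INR n) x.

Let in1 : 0 <= 1 / INR n <= 1.
Proof. by apply: index01 => //; lra. Qed.

Let S_linear : is_linear S.
Proof. by apply: Tp_linear; lra. Qed.

(** With [x = l t^(1/n)] this is [x^(n-k) / (1 + x^n)]. Hence [reso k = x reso (k+1)] and
    [reso 0 + reso n = 1], the two facts behind the telescoping sum. *)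
Definition reso (k : nat) (l t : R) : R := l ^ (n - k) * pw (INR (n - k) / INR n) t / (1 + l ^ n * t).

Lemma reso_fcont k l : 0 <= l -> fcont (reso k l).
Proof.
move=> hl; apply: fcont_div => //; apply: fcont_mult; first exact: fcont_const.
by apply: fcont_pw; apply: frac_ge0.
Qed.

Lemma reso_pw k t : (k < n)%N -> 0 <= t ->
  pw (INR (n - k) / INR n) t = pw (1 / INR n) t * pw (INR (n - k.+1) / INR n) t.
Proof.
move=> hk ht; rewrite -pw_add //; [|lra|exact: frac_ge0].
congr (pw _ t); rewrite -(subnSK hk) S_INR; field; lra.
Qed.

Lemma green_reso k l x : (k < n)%N -> 0 <= l -> Phi (green n (n - k.+1) l) x = S (Phi (reso k.+1 l) x).
Proof.
move=> hk hl; rewrite /S /inv_power -Phi_mult; [|by apply: fcont_pw; lra|exact: reso_fcont].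
apply: Phi_ext => t ht; rewrite /green /reso subnSK // reso_pw //; last lra.
by rewrite /Rdiv; ring.
Qed.

Lemma reso_step k l x : (k < n)%N -> 0 <= l -> Phi (reso k l) x = l ** S (Phi (reso k.+1 l) x).
Proof.
move=> hk hl; rewrite /S /inv_power -Phi_mult; [|by apply: fcont_pw; lra|exact: reso_fcont].
rewrite -Phi_scale; last by apply: fcont_mult; [apply: fcont_pw; lra | exact: reso_fcont].
apply: Phi_ext => t ht; rewrite /reso reso_pw //; last lra.
by rewrite -[(n - k)%N]subnSK //= /Rdiv; ring.
Qed.

Lemma reso_ends l x : 0 <= l -> plus (Phi (reso 0 l) x) (Phi (reso n l) x) = x.
Proof.
move=> hl; rewrite -Phi_add; try exact: reso_fcont.
rewrite (@Phi_ext _ _ hA _ (fun _ => 1)); first by rewrite Phi_const; apply: rscal_1.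
move=> t ht; rewrite /reso subnn subn0 /= /Rdiv Rmult_0_l pw_O Rinv_r; last lra.
have h : 0 <= l ^ n * t by apply: Rmult_le_pos; [apply: pow_le | lra].
by rewrite pw_1; [field; lra | lra].
Qed.

(** Inverts [l S u - shift u] by the factorization of [(l S)^n - shift^n], where [shift^n = -1]. *)
Lemma reso_telescope l (u : 'I_n -> X) (i : 'I_n) : 0 <= l ->
  \vsum_(k < n) Phi (reso k.+1 l) (minus (l ** S (ext u (i + k))) (ext u (i + k).+1)) = u i.
Proof.
move=> hl.
rewrite (eq_bigr (fun k : 'I_n => minus (Phi (reso k l) (ext u (i + k))) (Phi (reso k.+1 l) (ext u (i + k.+1))))).
  rewrite (vsum_telescope (G := X) n (fun k => Phi (reso k l) (ext u (i + k)))).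
  (* The sign in [ext u (i + n) = - u i] turns the difference of the two ends into the sum
     [reso 0 + reso n]. *)
  rewrite addn0 ext_period ext_ord /minus.
  rewrite -[X in plus _ (opp X)]/(Phi (reso n l) (opp (u i))).
  have -> : Phi (reso n l) (opp (u i)) = opp (Phi (reso n l) (u i)).
    by rewrite !opp_scal Phi_scal //; apply: reso_fcont.
  by rewrite opp_opp reso_ends.
move=> k _; have cf := @reso_fcont k.+1 l hl.
rewrite Phi_minus // addnS Phi_scal // (@reso_step k l) //.
by rewrite /S Tp_comm //; lra.
Qed.

Definition Lambda_resolvent (l : R) (u : 'I_n -> X) (i : 'I_n) : X :=
  \vsum_(k < n) Phi (green n (n - k.+1) l) (ext u (i + k)).

(** If [flat y = S u], the equation reads [flat phi = l S u - shift u], and [reso_telescope] solves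
    it for [u]. Conversely the solution formula commutes with the shift and with functions of [T],
    so the same telescoping verifies it. *)
Lemma shift_invE l (phi y : Y) : 0 <= l ->
  shift_inv L l phi y <-> forall i, flat y i = Lambda_resolvent l (flat phi) i.
Proof.
move=> hl.
have res u i : Lambda_resolvent l u i = S (\vsum_(k < n) Phi (reso k.+1 l) (ext u (i + k))).
  by rewrite (is_linear_vsum _ S_linear); apply: eq_bigr => k _; apply: green_reso.
split.
- move=> [a [b [[y' [hy' ha]] [hb e]]]] i.
  rewrite hy' in ha; have [u [h1 h2]] := (LambdaE n1 y b).1 hb.
  have ephi j : ext (flat phi) j = minus (l ** S (ext u j)) (ext u j.+1).
    rewrite -[RHS](@ext_unique _ _ n0 (fun k => minus (l ** S (ext u k)) (ext u k.+1))).
      by apply: ext_fun => k; rewrite e flat_plus // ha flat_scal // h1 h2 (cycpow_1 n0) // ext_ord.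
    move=> k; rewrite -addSn !ext_period /minus opp_plus; congr plus.
    by rewrite /S Tp_opp ?scal_opp_r //; lra.
  rewrite res h1; congr S; rewrite -[LHS](reso_telescope u i hl).
  by apply: eq_bigr => k _; rewrite ephi.
- move=> h.
  pose F j := \vsum_(k < n) Phi (reso k.+1 l) (ext (flat phi) (j + k)).
  pose u (i : 'I_n) := F i.
  have eu j : ext u j = F j.
    apply: ext_unique => k.
    rewrite [RHS](is_linear_vsum _ is_linear_opp); apply: eq_bigr => k' _.
    rewrite -addnA [(n + k')%N]addnC addnA ext_period !opp_scal Phi_scal //; exact: reso_fcont.
  pose b : Y := unflat (fun i => opp (ext u i.+1)).
  exists (scal (RtoC l : C_AbsRing) y), b; split; first by exists y.
  split.
    apply/(LambdaE n1); exists u; split=> i; first by rewrite h res.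
    by rewrite flat_unflat (cycpow_1 n0).
  apply: (flat_inj n1) => i; rewrite flat_plus // flat_scal // flat_unflat h res.
  rewrite -[LHS](reso_telescope (flat phi) i hl) -/(F i) -/(minus _ _) !eu.
  rewrite /F (is_linear_vsum _ S_linear) vsum_scal /minus.
  rewrite [X in plus _ X](is_linear_vsum _ is_linear_opp) -big_split; apply: eq_bigr => k _.
  have cf := @reso_fcont k.+1 l hl.
  rewrite /minus Phi_plus // Phi_scal // -/(S _) addSn; congr plus; last by rewrite !opp_scal Phi_scal.
  by rewrite /S Tp_comm //; lra.
Qed.

(** With [x = l t^(1/n)], [green] is [t^(1/n) x^m / (1 + x^n)] and [l green] is
    [x^(m+1) / (1 + x^n)]. Both fractions are at most 1, and [t^(1/n) <= 1 + t]. *)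
Lemma green_bound m l t : (m < n)%N -> 0 <= l -> 0 <= t -> (1 + l) * Rabs (green n m l t) <= 2 + t.
Proof.
move=> hm hl ht.
set x := l * pw (1 / INR n) t.
have p0 : 0 <= pw (1 / INR n) t by apply: pw_ge0.
have x0 : 0 <= x by apply: Rmult_le_pos.
have xn : x ^ n = l ^ n * t.
  rewrite /x Rpow_mult_distr pw_pow //; last lra.
  by rewrite (_ : INR n * (1 / INR n) = 1) ?pw_1 //; field; lra.
have xk k : (k <= n)%N -> 0 <= x ^ k / (1 + x ^ n) <= 1.
  move=> hk; have h0 : 0 <= x ^ n by apply: pow_le.
  have h1 : 0 <= x ^ k by apply: pow_le.
  split; first by apply: Rdiv_le_0_compat; lra.
  apply/Rle_div_l; first lra.
  case: (Rle_lt_dec x 1) => hx.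
    have : x ^ k <= 1 by rewrite -(pow1 k); apply: pow_incr; lra.
    lra.
  have : x ^ k <= x ^ n by apply: Rle_pow; [lra | apply/leP].
  lra.
have e1 : green n m l t = pw (1 / INR n) t * (x ^ m / (1 + x ^ n)).
  have -> : x ^ m = l ^ m * pw (INR m * (1 / INR n)) t by rewrite /x Rpow_mult_distr pw_pow //; lra.
  rewrite /green -xn.
  rewrite (_ : INR m.+1 / INR n = 1 / INR n + INR m * (1 / INR n)); last by rewrite S_INR; field; lra.
  rewrite pw_add //; [by rewrite /Rdiv; ring | lra |].
  by apply: Rmult_le_pos; [exact: pos_INR | lra].
have e2 : l * green n m l t = x ^ m.+1 / (1 + x ^ n) by rewrite e1 /x /= /Rdiv; ring.
have [a1 a2] := xk m (ltnW hm); have [b1 b2] := xk m.+1 hm.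
have g0 : 0 <= green n m l t by rewrite e1; apply: Rmult_le_pos.
rewrite Rabs_pos_eq // Rmult_plus_distr_r Rmult_1_l e2 e1.
have := @pw_bound (1 / INR n) t ltac:(lra) ht.
have : pw (1 / INR n) t * (x ^ m / (1 + x ^ n)) <= pw (1 / INR n) t * 1 by apply: Rmult_le_compat_l.
lra.
Qed.

Local Notation bd := (bd hA).

Lemma Lambda_resolvent_bounded l : 0 <= l -> bounded_map (Lambda_resolvent l) (INR n * ((2 + bd) / (1 + l))).
Proof.
move=> hl; apply: bounded_map_sum => k.
have hg : fcont (green n (n - k.+1) l) by apply: green_fcont.
split=> [u v i|a u i|u r h i].
- by rewrite ext_plus Phi_plus.
- by rewrite ext_scal Phi_scal.
- have hm : (n - k.+1 < n)%N by rewrite ltn_subrL n0.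
  apply: Rle_trans (@Phi_norm _ _ hA _ ((2 + bd) / (1 + l)) _ hg _) _.
    move=> t ht; apply/Rle_div_r; first lra.
    rewrite Rmult_comm; apply: Rle_trans (green_bound hm hl (proj1 ht)) _; lra.
  apply: Rmult_le_compat_l; last exact: ext_norm.
  by apply: Rdiv_le_0_compat; have := bd_pos hA; lra.
Qed.

Lemma power_bounded a : 0 <= a -> exists c, bounded_map (fun (u : 'I_n -> X) i => Tp (a / INR n) (cycpow (- a) u i)) c.
Proof.
move=> ha; have [c hc] := @bounded_map_cycpow X n (- a).
have [d [d0 hd]] := @bounded_map_each X n _ (Tp_linear hA (b := a / INR n) ltac:(apply: Rdiv_le_0_compat; lra)).
exists (d * c); exact: (bounded_map_comp hd hc).
Qed.

Definition power_inv (a : R) (v : Y) : Y := unflat (fun i => Tp (a / INR n) (cycpow (- a) (flat v) i)).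

Lemma power_inv_linear a : 0 <= a -> is_linear (power_inv a).
Proof. by move=> ha; have [c hc] := power_bounded ha; exact: (@bounded_map_linear X A hA n n1 _ c hc). Qed.

Lemma power_invE a v w : 0 <= a <= 1 -> power_graph a v w <-> v = power_inv a w.
Proof.
move=> ha; rewrite (power_graph_inv n1 _ _ ha); split.
- by move=> h; apply: (flat_inj n1) => i; rewrite h flat_unflat.
- by move=> -> i; rewrite flat_unflat.
Qed.

Lemma cycpow_opp a (u : 'I_n -> X) i : cycpow a (cycpow (- a) u) i = u i.
Proof. by rewrite (cycpow_comp n0) (_ : a + - a = 0) ?(cycpow_0 n0) //; ring. Qed.

Lemma power_inv_inj a v w : 0 <= a <= 1 -> power_inv a v = power_inv a w -> v = w.
Proof.
move=> ha e; apply: (flat_inj n1) => i.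
rewrite -(cycpow_opp a (flat v) i) -(cycpow_opp a (flat w) i); apply: cycpow_fun => j.
apply: (@Tp_inj _ _ hA _ _ _ (index01 n1 ha)).
have := f_equal (fun z => flat z j) e.
by rewrite !flat_unflat.
Qed.

Lemma power_inv_comp a b v : 0 <= a -> 0 <= b -> power_inv a (power_inv b v) = power_inv (a + b) v.
Proof.
move=> ha hb; apply: (flat_inj n1) => i; rewrite !flat_unflat.
have a0 : 0 <= a / INR n by apply: Rdiv_le_0_compat; lra.
have b0 : 0 <= b / INR n by apply: Rdiv_le_0_compat; lra.
rewrite (_ : (a + b) / INR n = a / INR n + b / INR n); last by field; lra.
rewrite Tp_add //; congr (inv_power _ _ _).
rewrite (@cycpow_fun _ _ _ _ (fun j => Tp (b / INR n) (cycpow (- b) (flat v) j))); last by move=> j; rewrite flat_unflat.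
rewrite cycpow_map; last exact: Tp_linear.
by rewrite (cycpow_comp n0); congr (inv_power _ _ (cycpow _ _ _)); ring.
Qed.

Lemma Lambda_inv v w : L v w <-> v = power_inv 1 w.
Proof. by rewrite (LambdaE n1) power_invE //; lra. Qed.

Lemma shift_inv_unflat l (phi y : Y) : 0 <= l -> shift_inv L l phi y <-> y = unflat (Lambda_resolvent l (flat phi)).
Proof.
move=> hl; rewrite shift_invE //; split.
- by move=> h; apply: (flat_inj n1) => i; rewrite h flat_unflat.
- by move=> -> i; rewrite flat_unflat.
Qed.

Lemma Lambda_dense : dense (dom L).
Proof.
move=> v e; have e0 := cond_pos e.
have he : 0 < e / (2 * INR n) by apply: Rdiv_lt_0_compat; lra.
have hx : forall i : 'I_n, exists x, norm (minus (Tp (1 / INR n) x) (flat v i)) < e / (2 * INR n).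
  by move=> i; apply: Tp_dense.
have [u hu] := choose_coord hx.
exists (unflat (fun i => Tp (1 / INR n) (u i))); split.
  exists (unflat (cycpow 1 u)); apply/(LambdaE n1); exists u; split=> i; by rewrite flat_unflat.
apply: (Rle_lt_trans _ (INR n * (e / (2 * INR n)))).
  apply: (norm_le_flat n1) => i; rewrite /minus flat_plus // flat_opp // flat_unflat; left; exact: hu.
by rewrite (_ : INR n * (e / (2 * INR n)) = e / 2); [lra | field; lra].
Qed.

Lemma Lambda_positive_type : positive_type L.
Proof.
have e : op_eq (fun v w => v = power_inv 1 w) L by move=> v w; symmetry; apply: Lambda_inv.
have lin := @power_inv_linear 1 ltac:(lra).
split.
- apply: linear_op_eq e _; apply: graph_linear_op => // v w; apply: power_inv_inj; lra.
- by apply: closed_op_eq e _; apply: graph_closed.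
- exact: Lambda_dense.
- move=> l hl; apply: (bounded_op_graph (@bounded_map_linear X A hA n n1 _ _ (Lambda_resolvent_bounded hl))) => x y.
  exact: shift_inv_unflat.
- exists (INR n * (INR n * (2 + bd))) => l x y hl /(shift_inv_unflat _ _ hl) ->.
  have h := bounded_map_norm n1 x (Lambda_resolvent_bounded hl).
  apply: Rle_trans (Rmult_le_compat_l _ _ _ _ h) _; first lra.
  right; field; lra.
Qed.

(** Here the Chebyshev values appear: the mass contains [1 / sin (PI (a + k) / n)], and
    [sin (a PI) = (-1)^k sin (PI (a + k))], which together form [sin (n x) / sin x] at
    [x = PI (a + k) / n]. *)
Lemma green_coef k a : (k < n)%N -> 0 < a < 1 ->
  sin (a * PI) / PI * green_mass n (n - k.+1) a = (-1) ^ k * skernel n (- a - INR k).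
Proof.
move=> hk ha; have hpi := PI_RGT_0.
have kn : INR k + 1 <= INR n by rewrite -S_INR; apply: le_INR; apply/leP.
have k0 := pos_INR k.
rewrite /green_mass /green_order subnSK // -minusE minus_INR; last by apply/leP; apply: ltnW.
have -> : PI * ((INR n - INR k - a) / INR n) = PI - PI * (a + INR k) / INR n by field; lra.
rewrite sin_PI_x.
have hs : 0 < sin (PI * (a + INR k) / INR n).
  apply: sin_gt_0; first by apply: Rdiv_lt_0_compat; [apply: Rmult_lt_0_compat; lra | lra].
  by apply/Rlt_div_l; [lra | apply: Rmult_lt_compat_l; lra].
have h := skernel_sin n0 (- a - INR k).
have e1 : PI * (- a - INR k) / INR n = - (PI * (a + INR k) / INR n) by field; lra.
have e2 : PI * (- a - INR k) = - (PI * (a + INR k)) by ring.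
rewrite e1 e2 !sin_neg in h.
have e3 : sin (PI * (a + INR k)) = (-1) ^ k * sin (a * PI).
  elim: (k) => [|q ih]; first by rewrite /= Rplus_0_r Rmult_1_l Rmult_comm.
  rewrite S_INR (_ : PI * (a + (INR q + 1)) = PI * (a + INR q) + PI); last ring.
  by rewrite neg_sin ih /=; ring.
have e4 : skernel n (- a - INR k) = (-1) ^ k * sin (a * PI) / (INR n * sin (PI * (a + INR k) / INR n)).
  apply: (Rmult_eq_reg_r (INR n * sin (PI * (a + INR k) / INR n))).
    have -> : (-1) ^ k * sin (a * PI) / (INR n * sin (PI * (a + INR k) / INR n)) * (INR n * sin (PI * (a + INR k) / INR n)) = (-1) ^ k * sin (a * PI).
      by field; split; lra.
    by rewrite -e3; lra.
  by apply: Rgt_not_eq; apply: Rmult_lt_0_compat; lra.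
rewrite e4 (_ : (-1) ^ k * ((-1) ^ k * sin (a * PI) / (INR n * sin (PI * (a + INR k) / INR n))) =
   ((-1) ^ k * (-1) ^ k) * (sin (a * PI) / (INR n * sin (PI * (a + INR k) / INR n)))); last by rewrite /Rdiv; ring.
by rewrite sign_sq; field; repeat split; lra.
Qed.

(** * Negative powers of Lambda as integrals in Y *)

Let unit_vec (i : 'I_n) (x : X) : Y := unflat (fun j => if j == i then x else zero).

Let unit_vec_linear i : @is_linear R_AbsRing (realify X) (realify Y) (unit_vec i).
Proof.
split.
- move=> x y; apply: (flat_inj n1) => j; rewrite flat_unflat.
  change (flat (plus (unit_vec i x) (unit_vec i y)) j) with (flat (plus (unit_vec i x : Y) (unit_vec i y)) j).
  rewrite (flat_plus n1 (unit_vec i x) (unit_vec i y)) !flat_unflat; case: eqP => // _.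
  by rewrite plus_zero_l.
- move=> c x; apply: (flat_inj n1) => j; rewrite flat_unflat.
  rewrite (flat_scal n1 (RtoC c) (unit_vec i x)) flat_unflat; case: eqP => // _.
  by rewrite scal_zero_r.
- exists (INR n); split; first lra.
  move=> x; apply: (norm_le_flat n1) => j; rewrite flat_unflat.
  by case: eqP => _; [apply: Rle_refl | rewrite norm_zero; apply: norm_ge_0].
Qed.

Let flat_linear i : @is_linear R_AbsRing (realify Y) (realify X) (fun v => flat v i).
Proof.
split.
- by move=> x y; apply: flat_plus.
- by move=> c x; apply: flat_scal.
- by exists 1; split; [lra | move=> x; rewrite Rmult_1_l; apply: norm_flat_le].
Qed.

Lemma flat_vsum m (F : 'I_m -> Y) i : flat (\vsum_(k < m) F k) i = \vsum_(k < m) flat (F k) i.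
Proof. by apply: (big_morph (fun v => flat v i)) => [x y|]; [apply: flat_plus | apply: flat_zero]. Qed.

Lemma unflat_integral (g : R -> 'I_n -> X) (I : 'I_n -> X) :
  (forall i, @is_RInt_gen (realify X) (fun l => g l i) (at_right 0) (Rbar_locally p_infty) (I i)) ->
  @is_RInt_gen (realify Y) (fun l => unflat (g l)) (at_right 0) (Rbar_locally p_infty) (unflat I).
Proof.
move=> h.
have e (u : 'I_n -> X) : unflat u = \big[@plus (realify Y)/@zero (realify Y)]_(i < n) unit_vec i (u i).
  apply: (flat_inj n1) => j; rewrite flat_unflat.
  change (u j = flat (\vsum_(i < n) unit_vec i (u i)) j).
  rewrite flat_vsum (bigD1 j) //= flat_unflat eqxx big1 ?plus_zero_r // => i ne.
  by rewrite flat_unflat eq_sym (negbTE ne).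
rewrite e.
apply: (@is_RInt_gen_ext_pos (realify Y) (fun l => \big[@plus (realify Y)/@zero (realify Y)]_(i < n) unit_vec i (g l i))).
  by move=> l _; rewrite e.
apply: (@is_RInt_gen_vsum (realify Y)) => i.
exact: (@is_RInt_gen_linear _ _ _ _ _ _ _ _ _ (unit_vec_linear i) (h i)).
Qed.

Lemma Lambda_resolvent_integral a (phi : Y) : 0 < a < 1 ->
  exists I : Y, @is_RInt_gen (realify Y)
    (fun l => scal (RtoC (Rpower l (- a)) : C_AbsRing) (unflat (Lambda_resolvent l (flat phi))))
    (at_right 0) (Rbar_locally p_infty) I /\
  scal (RtoC (sin (a * PI) / PI) : C_AbsRing) I = power_inv a phi.
Proof.
move=> ha.
pose I i := \vsum_(k < n) green_mass n (n - k.+1) a ** Tp (a / INR n) (ext (flat phi) (i + k)).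
have a0 : 0 <= a / INR n by apply: Rdiv_le_0_compat; lra.
exists (unflat I); split.
  apply: (@is_RInt_gen_ext_pos (realify Y) (fun l => unflat (fun i => Rpower l (- a) ** Lambda_resolvent l (flat phi) i))).
    move=> l hl; apply: (flat_inj n1) => i.
    by rewrite (flat_scal n1 (RtoC (Rpower l (- a))) (unflat (Lambda_resolvent l (flat phi)))) !flat_unflat.
  apply: unflat_integral => i.
  apply: (@is_RInt_gen_ext_pos (realify X) (fun l => \big[@plus (realify X)/@zero (realify X)]_(k < n)
      (Rpower l (- a) ** Phi (green n (n - k.+1) l) (ext (flat phi) (i + k))))).
    by move=> l hl; rewrite /Lambda_resolvent vsum_scal.
  apply: (@is_RInt_gen_vsum (realify X)) => k; apply: green_integral => //.
  by rewrite ltn_subrL n0.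
apply: (flat_inj n1) => i; rewrite flat_scal // !flat_unflat /I vsum_scal.
rewrite (cycpow_ext n0) (is_linear_vsum _ (Tp_linear hA a0)); apply: eq_bigr => k _.
by rewrite rscal_assoc green_coef // [RHS]Tp_scal.
Qed.

(** Uniqueness is read off coordinate by coordinate in the complete space [X]. *)
Lemma integral_unique (g : R -> Y) (I J : Y) :
  @is_RInt_gen (realify Y) g (at_right 0) (Rbar_locally p_infty) I ->
  @is_RInt_gen (realify Y) g (at_right 0) (Rbar_locally p_infty) J -> I = J.
Proof.
move=> hI hJ; apply: (flat_inj n1) => i.
have Fr0 : Filter (at_right 0) by exact _.
have Fri : Filter (Rbar_locally p_infty) by exact _.
have P0 : ProperFilter' (at_right 0) by apply: Proper_StrongProper.
have Pi : ProperFilter' (Rbar_locally p_infty) by apply: Proper_StrongProper.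
have h1 := @is_RInt_gen_linear _ _ _ _ _ _ _ Fr0 Fri (flat_linear i) hI.
have h2 := @is_RInt_gen_linear _ _ _ _ _ _ _ Fr0 Fri (flat_linear i) hJ.
have e1 := @is_RInt_gen_unique (realify_complete X) _ _ P0 Pi _ _ h1.
have e2 := @is_RInt_gen_unique (realify_complete X) _ _ P0 Pi _ _ h2.
by rewrite e1 in e2.
Qed.

Lemma neg_powerE a (phi y : Y) : 0 < a < 1 -> neg_power L a phi y <-> y = power_inv a phi.
Proof.
move=> ha; have [I [hI eI]] := Lambda_resolvent_integral phi ha.
split.
- move=> [J [[f [hf hJ]] ->]]; rewrite -eI; congr (scal _ _).
  have hJ' := @is_RInt_gen_ext_pos (realify Y) _
    (fun l => scal (RtoC (Rpower l (- a)) : C_AbsRing) (unflat (Lambda_resolvent l (flat phi)))) _ _ hJ.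
  apply: integral_unique (hJ' _) hI => l hl.
  by rewrite ((shift_inv_unflat phi (f l) (Rlt_le _ _ hl)).1 (hf l hl)).
- move=> ->; exists I; split; last by rewrite eI.
  exists (fun l => unflat (Lambda_resolvent l (flat phi))); split => // l hl.
  by apply/shift_inv_unflat => //; lra.
Qed.
End LambdaCalculus.

(** On [D(T)], [T (l + T)^-1 v = (l + T)^-1 T v]. This turns Balakrishnan's integral at [v] into the
    integral of a negative power at [T v]. *)
Lemma shift_inv_comm (V : NormedModule C_AbsRing) (T : operator V) (R : V -> V) l v p f :
  is_linear R -> (forall x y, R x = R y -> x = y) -> (forall x y, T x y <-> x = R y) -> T v p ->
  op_comp T (shift_inv T l) v f <-> shift_inv T l p f.
Proof.
move=> hR hi hT hv; split.
- move=> [y [[a [b [[y' [-> ->]] [hb e]]]] hf]].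
  have eb : b = f by apply: hi; move: hb hf; rewrite !hT => <-.
  exists (l ** f), (minus p (l ** f)); split; first by exists f.
  split; last by rewrite /minus plus_comm -plus_assoc plus_opp_l plus_zero_r.
  apply/hT; move: hv hf; rewrite !hT => hv hf.
  rewrite /minus (linear_plus R hR) (linear_opp R _ hR) (linear_scal R hR) -hv -hf e eb.
  by rewrite [plus (l ** y) f]plus_comm -plus_assoc plus_opp_r plus_zero_r.
- move=> [a [g [[f' [-> ->]] [hg e]]]].
  exists (R f); split; last exact/hT.
  exists (l ** R f), f; split; first by exists (R f).
  split; first exact/hT.
  move: hv hg; rewrite !hT => -> hg.
  by rewrite e (linear_plus R hR) (linear_scal R hR) -hg.
Qed.

Lemma powerRZ_sign (i j : nat) : powerRZ (-1) (Z.of_nat i - Z.of_nat j) = (-1) ^ (i + j).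
Proof.
rewrite /Z.sub powerRZ_add; last lra.
rewrite powerRZ_neg' -!pow_powerRZ -plusE pow_add; congr (_ * _).
have h := sign_sq j; have n0 : (-1) ^ j <> 0 by apply: pow_nonzero; lra.
by apply: (Rmult_eq_reg_r ((-1) ^ j)) => //; rewrite h Rinv_l.
Qed.

(** * The operator matrices of the theorem *)

Section Operators.
Variables (X : Hilbert) (A : operator X) (hA : positive_selfadjoint A) (n : nat).
Hypothesis n1 : (1 < n)%N.
Local Notation Tp := (inv_power hA).
Local Notation Y := (phase_space hA n).
Local Notation L := (@Lambda X A hA n).
Local Notation flat := (@flat X A hA n).
Local Notation unflat := (@unflat X A hA n n1).
Local Notation power_inv := (@power_inv X A hA n n1).

Let n0 : (0 < n)%N. Proof. exact: ltnW. Qed.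
Let hn : 1 < INR n. Proof. exact: INR_gt1. Qed.

Lemma power_inv_0 v : power_inv 0 v = v.
Proof.
apply: (flat_inj n1) => i; rewrite flat_unflat /Rdiv Rmult_0_l Tp_O Ropp_0.
exact: cycpow_0.
Qed.

Lemma positive_powerE a v w : 0 <= a <= 1 -> positive_power L a v w <-> v = power_inv a w.
Proof.
move=> ha; rewrite /positive_power; case: Req_EM_T => h0 /=.
  by rewrite h0 power_inv_0; split=> ->.
case: Req_EM_T => h1 /=; first by rewrite h1; apply: Lambda_inv.
by apply: neg_powerE; lra.
Qed.

(** [Lambda^a v = Lambda^-(1-a) Lambda v]: the integrals agree because [a - 1 = -(1 - a)], and the
    constants because [sin (a PI) = sin ((1 - a) PI)]. *)
Lemma balakrishnanE a v p w : 0 < a < 1 -> L v p -> balakrishnan L a v w <-> w = power_inv (1 - a) p.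
Proof.
move=> ha hv.
have hc l f : op_comp L (shift_inv L l) v f <-> shift_inv L l p f.
  apply: (@shift_inv_comm _ _ (power_inv 1)) => //.
  - by apply: power_inv_linear; lra.
  - by move=> x y; apply: power_inv_inj; lra.
  - exact: Lambda_inv.
rewrite -neg_powerE; last lra.
rewrite /neg_power /balakrishnan.
have -> : sin ((1 - a) * PI) = sin (a * PI).
  by rewrite (_ : (1 - a) * PI = PI - a * PI) ?sin_PI_x //; ring.
have -> : - (1 - a) = a - 1 by ring.
by split=> -[I [[f [h1 h2]] h3]]; exists I; split => //; exists f; split => // l hl; apply/hc; apply: h1.
Qed.

(** From right to left, the domain condition follows from [p] lying in [Y]: a shift to the next
    factor gains [1/n] in the exponent, and [A^-1] gains 1 in the first one. *)
Lemma Lambda_explicit (v p : Y) : L v p <->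
  (forall i j : 'I_n, nat_of_ord i = 0%N -> j.+1 = n -> op_inv A (coord p j) (coord v i)) /\
  (forall i j : 'I_n, nat_of_ord i = j.+1 -> coord v i = opp (coord p j)).
Proof.
split.
- move=> [_ [h1 h2]]; split=> i j; first exact: h2.
  by move=> e; rewrite (h1 j i e) opp_opp.
- move=> [h1 h2]; split; last first.
    by split=> i j; [move=> e; rewrite (h2 j i e) opp_opp | exact: h1].
  have i01 := @index01 n n1 1 ltac:(lra).
  apply/(Lambda_dom n1); apply: (@choose_coord X n (fun i x => flat v i = Tp (1 / INR n) x)) => i.
  have wi := weight01 n1 i.
  case: (posnP i) => [e|ip].
    have hl : (n.-1 < n)%N by rewrite prednK.
    exists (coord p (Ordinal hl)); apply: (flat_eq n1).
    rewrite -Tp_add; try lra; rewrite weight_first // Tp_1; apply: (invAP hA _ _).1; apply: h1 => //=.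
    by rewrite prednK.
  have hl : (i.-1 < n)%N by apply: leq_ltn_trans (leq_pred _) (ltn_ord i).
  have e : nat_of_ord i = (Ordinal hl).+1 by rewrite /= prednK.
  exists (opp (flat p (Ordinal hl))); apply: (flat_eq n1).
  rewrite (h2 i (Ordinal hl) e) (flatP n1) (weight_succ n1 e) -Tp_add; try lra.
  by rewrite Tp_opp //; lra.
Qed.

Lemma Lambda_inv_matrix (p v : Y) :
  op_matrix (@Lambda_inv_entry X A n) (coord p) (coord v) <-> L v p.
Proof.
rewrite Lambda_explicit; split.
- move=> [z [hz hv]]; split=> [i j ei ej|i j ei].
    have := hz i j; rewrite /Lambda_inv_entry ei ej !eqxx /=.
    suff -> : coord v i = z i j by [].
    rewrite hv (bigD1 j) //= big1 ?plus_zero_r // => k ne.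
    have := hz i k; rewrite /Lambda_inv_entry ei /=.
    case: eqP => //= ek; case/eqP: ne; apply: val_inj.
    by apply: succn_inj; rewrite ek.
  have := hz i j; rewrite /Lambda_inv_entry ei /= eqxx => -[x [-> ez]].
  rewrite rscal_opp -ez hv (bigD1 j) //= big1 ?plus_zero_r // => k ne.
  have := hz i k; rewrite /Lambda_inv_entry ei /=.
  by case: eqP => //= -[ek]; case/eqP: ne; apply: val_inj.
- move=> [h1 h2].
  exists (fun (i j : 'I_n) => if (nat_of_ord i == 0%N) && (j.+1 == n) then coord v i
      else if nat_of_ord i == j.+1 then opp (coord p j) else zero); split.
    move=> i j; rewrite /Lambda_inv_entry.
    case: andP => [[/eqP ei /eqP ej]|_]; first exact: h1.
    by case: eqP => // _; exists (coord p j); rewrite -rscal_opp.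
  move=> i; case: (posnP i) => [e|ip].
    have hl : (n.-1 < n)%N by rewrite prednK.
    rewrite (bigD1 (Ordinal hl)) //= big1 ?plus_zero_r ?e ?prednK ?eqxx //.
    move=> k ne /=; case: eqP => //= ek; case/eqP: ne; apply: val_inj.
    exact: (f_equal predn ek).
  have hl : (i.-1 < n)%N by apply: leq_ltn_trans (leq_pred _) (ltn_ord i).
  have e : nat_of_ord i = (Ordinal hl).+1 by rewrite /= prednK.
  have ei : (nat_of_ord i == 0%N) = false by rewrite eqn0Ngt ip.
  rewrite (bigD1 (Ordinal hl)) //= big1 ?plus_zero_r ?ei ?prednK ?eqxx //.
    by rewrite (h2 i (Ordinal hl) e).
  move=> k ne /=; case: eqP => // ek; case/eqP: ne; apply: val_inj.
  by rewrite /= ek.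
Qed.

Lemma entry_coef a (i j : 'I_n) :
  (RtoC (powerRZ (-1) (Z.of_nat i - Z.of_nat j) / INR n) *
     chebyshevU n.-1 (RtoC (cos ((a + INR i - INR j) * PI / INR n))))%C =
  RtoC ((-1) ^ (i + j) * skernel n (a + INR i - INR j)).
Proof.
rewrite powerRZ_sign chebyshevU_cos prednK // -RtoC_mult; congr RtoC.
rewrite /skernel (Rmult_comm PI); field; lra.
Qed.

(** [coord v j = T^(weight j + a/n) x], and with [e] the exponent of the entry,
    [weight j + a/n = e + weight i]. So [A^e] leaves [T^(weight i) x], whether [e] is positive or
    negative. *)
Lemma entry_power a (i j : 'I_n) (v : Y) x z : 0 <= a <= 1 -> flat v j = Tp (a / INR n) x ->
  frac_power A ((a + INR i - INR j) / INR n) (coord v j) z <-> z = Tp (weight i) x.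
Proof.
move=> ha hx.
have wi := weight01 n1 i; have wj := weight01 n1 j; have ia := index01 n1 ha.
set e := (a + INR i - INR j) / INR n.
have we : weight j + a / INR n = e + weight i.
  by rewrite /weight /e !S_INR; field; lra.
have hv : coord v j = Tp (weight j + a / INR n) x by rewrite (flatP n1) hx Tp_add //; lra.
have ji : INR i + 1 <= INR n by rewrite -S_INR; apply: le_INR; apply/leP.
have jj : INR j + 1 <= INR n by rewrite -S_INR; apply: le_INR; apply/leP.
have pi := pos_INR i; have pj := pos_INR j.
have e1 : -1 <= e <= 1.
  rewrite /e; split; first by apply/Rle_div_r; lra.
  by apply/Rle_div_l; lra.
case: (Rle_lt_dec 0 e) => he.
  rewrite (frac_power_ge0 hA); last lra.
  rewrite hv we Tp_add; try lra.
  by split=> [/Tp_inj ->|->] //; lra.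
rewrite (frac_power_le0 hA); last lra.
by rewrite hv -Tp_add; try lra; rewrite we (_ : - e + (e + weight i) = weight i) //; ring.
Qed.

Lemma power_graph_matrix a (v w : Y) : 0 <= a <= 1 ->
  power_graph a v w <-> op_matrix (Lambda_power_entry A a) (coord v) (coord w).
Proof.
move=> ha.
have sum_eq (u : 'I_n -> X) (i : 'I_n) :
    \vsum_(j < n) ((-1) ^ (i + j) * skernel n (a + INR i - INR j)) ** Tp (weight i) (u j) = Tp (weight i) (cycpow a u i).
  rewrite /cycpow is_linear_vsum; last by apply: Tp_linear; have := weight01 n1 i; lra.
  by apply: eq_bigr => j _; rewrite Tp_scal //; have := weight01 n1 i; lra.
split.
- move=> [u [h1 h2]].
  exists (fun (i j : 'I_n) => ((-1) ^ (i + j) * skernel n (a + INR i - INR j)) ** Tp (weight i) (u j)); split.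
    move=> i j; exists (Tp (weight i) (u j)); rewrite entry_coef; split => //.
    exact/(entry_power i _ ha (h1 j)).
  by move=> i; rewrite sum_eq (flatP n1) h2.
- move=> [z [hz hw]].
  have hl : (n.-1 < n)%N by rewrite prednK.
  (* The last row carries the largest exponents, [weight j + a/n], and [op_scal] keeps the domain of
     the power even when the coefficient is 0. This row therefore forces the full domain. *)
  have hu j : exists x, flat v j = Tp (a / INR n) x.
    have [x [hx _]] := hz (Ordinal hl) j.
    exists x; apply: (flat_eq n1).
    have wj := weight01 n1 j; have ia := index01 n1 ha.
    have e : (a + INR (Ordinal hl) - INR j) / INR n = weight j + a / INR n.
      rewrite /weight S_INR -[INR (Ordinal hl)]/(INR n.-1) (_ : INR n.-1 = INR n - 1); first by field; lra.
      by rewrite -{2}(prednK n0) S_INR; ring.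
    have jj : INR j + 1 <= INR n by rewrite -S_INR; apply: le_INR; apply/leP.
    have pj := pos_INR j.
    rewrite e in hx; move: hx => /frac_power_ge0 -> //; first by rewrite Tp_add //; lra.
    split; first lra.
    by rewrite /weight -Rdiv_plus_distr; apply/Rle_div_l; rewrite ?S_INR; lra.
  have [u hu'] := choose_coord hu.
  exists u; split => // i; apply: (flat_eq n1); rewrite hw -sum_eq; apply: eq_bigr => j _.
  have [x [hx ->]] := hz i j.
  by rewrite entry_coef ((entry_power i x ha (hu' j)).1 hx).
Qed.
End Operators.

(** * Compactness *)

Definition increasing (s : nat -> nat) : Prop := forall k, (s k < s k.+1)%N.

Lemma increasing_ge s k : increasing s -> (k <= s k)%N.
Proof. by move=> h; elim: k => // k ih; apply: leq_ltn_trans ih (h k). Qed.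

Lemma increasing_mono s j k : increasing s -> (j < k)%N -> (s j < s k)%N.
Proof.
move=> h; elim: k => // k ih; rewrite ltnS leq_eqVlt => /orP[/eqP->|/ih lt]; first exact: h.
exact: ltn_trans lt (h k).
Qed.

Lemma increasing_comp s t : increasing s -> increasing t -> increasing (fun k => s (t k)).
Proof. by move=> hs ht k; apply: increasing_mono. Qed.

Section Subsequences.
Variable U : NormedModule C_AbsRing.

Definition converges (u : nat -> U) : Prop := exists y, filterlim u eventually (locally y).

Definition sequentially_compact (S : U -> U) : Prop := forall u : nat -> U,
  (exists b, forall k, norm (u k) <= b) ->
  exists s, increasing s /\ converges (fun k => S (u (s k))).

Lemma converges_subsequence u s : increasing s -> converges u -> converges (fun k => u (s k)).
Proof.
move=> hs [y hy]; exists y; apply: (filterlim_comp _ _ _ s u _ eventually) hy.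
move=> P [N hN]; exists N => k hk; apply: hN.
by apply/leP; apply: leq_trans (increasing_ge k hs); apply/leP.
Qed.

Lemma sequentially_compact_family (S : U -> U) m (u : nat -> nat -> U) : sequentially_compact S ->
  (forall i, exists b, forall k, norm (u i k) <= b) ->
  exists s, increasing s /\ forall i, (i < m)%N -> converges (fun k => S (u i (s k))).
Proof.
move=> hS hu; elim: m => [|m [s [hs ih]]]; first by exists id; split => // k /=.
have [b hb] := hu m.
have [t [ht hc]] := hS (fun k => u m (s k)) (ex_intro _ b (fun k => hb (s k))).
exists (fun k => s (t k)); split; first exact: increasing_comp.
move=> i; rewrite ltnS leq_eqVlt => /orP[/eqP->|/ih h]; first exact: hc.
exact: (converges_subsequence ht h).
Qed.
End Subsequences.

Lemma eventually_forall n (P : 'I_n -> nat -> Prop) :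
  (forall i, eventually (P i)) -> eventually (fun k => forall i, P i k).
Proof.
move=> h; have [N hN] := choice (fun (i : 'I_n) N => forall k, (N <= k)%coq_nat -> P i k) h.
exists (\max_(i < n) N i) => k hk i; apply: hN.
by apply: Nat.le_trans hk; apply/leP; apply: leq_bigmax.
Qed.

Section Compactness.
Variables (X : Hilbert) (A : operator X) (hA : positive_selfadjoint A).
Local Notation bd := (bd hA).
Local Notation Tp := (inv_power hA).

(** From [(l - A) T u = l T u - u] one gets [T u = R (l T u - u)], with a bounded argument. *)
Lemma compact_resolvent_inv : compact_resolvent A -> sequentially_compact (invA hA).
Proof.
move=> [l [_ [R [Rlin [hR hc]]]]] u [b hb].
pose v k : X := minus (scal (l : C_AbsRing) (invA hA (u k))) (u k).
have ev k : invA hA (u k) = R (v k).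
  apply: (hR _ _).1; rewrite /resolvent /op_inv.
  exists (scal (l : C_AbsRing) (invA hA (u k))), (-1 ** u k); split; last split.
  - by exists (invA hA (u k)).
  - by exists (u k); split => //; apply/invAP.
  - by rewrite /v /minus rscal_opp.
have [c [c0 hcb]] := linear_norm _ (invA_linear hA).
have hv : exists m, forall k, norm (v k) <= m.
  exists (abs (l : C_AbsRing) * (c * b) + b) => k.
  apply: Rle_trans (norm_triangle _ _) _; rewrite norm_opp; apply: Rplus_le_compat; last exact: hb.
  apply: Rle_trans (norm_scal _ _) _; apply: Rmult_le_compat_l; first exact: abs_ge_0.
  by apply: Rle_trans (hcb _) _; apply: Rmult_le_compat_l; [lra | exact: hb].
have [s [y [hs hy]]] := hc v hv.
exists s; split => //; exists y.
by apply: filterlim_ext hy => k; rewrite ev.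
Qed.

(** [t^b <= e + c t] on the spectrum of [A^-1]. *)
Lemma Tp_interpolation b e : 0 < b <= 1 -> 0 < e -> exists c, 0 < c /\
  forall x, norm (Tp b x) <= e * norm x + c * norm (invA hA x).
Proof.
move=> hb he; have hbd := bd_pos hA.
have [d [d0 hd]] := pw_small (proj1 hb) he.
(* Split [t^b] into [k t^b / (t + k)] and [t^b / (t + k)] times [t]. The first part is at most [e]:
   for [t < d] because [t^b < e], and for [t >= d] because [k t^b <= k (1 + bd) = d e <= e t]. *)
have [k [de h3]] : exists k, 0 < k /\ k * (1 + bd) = d * e.
  exists (d * e / (1 + bd)); split; last by field; lra.
  by apply: Rdiv_lt_0_compat; [apply: Rmult_lt_0_compat | lra].
pose q t := pw b t * / (t + k).
pose r t := k * q t.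
have cq : fcont hA q.
  move=> t ht; apply: (continuous_mult (pw b)); first by apply: pw_cont; lra.
  apply: continuous_Rinv_comp; last lra.
  by apply: (continuous_plus (fun t => t)); [exact: continuous_id | exact: continuous_const].
have cr : fcont hA r by apply: fcont_mult => //; apply: fcont_const.
have [c [c0 hc]] := fcont_bounded cq.
exists c; split => // x.
have -> : Tp b x = plus (fcalc hA r x) (fcalc hA q (invA hA x)).
  rewrite -Phi_id -Phi_mult //; last exact: fcont_id.
  rewrite -Phi_add //; last by apply: fcont_mult => //; apply: fcont_id.
  by apply: Phi_ext => t ht; rewrite /r /q; field; lra.
apply: Rle_trans (norm_triangle _ _) _; apply: Rplus_le_compat; last exact: Phi_norm.
apply: Phi_norm => // t ht.
have p0 := pw_ge0 b t.
have i0 : 0 < / (t + k) by apply: Rinv_0_lt_compat; lra.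
rewrite /r /q Rabs_pos_eq; last by apply: Rmult_le_pos; [lra | apply: Rmult_le_pos; lra].
rewrite -Rmult_assoc; apply/Rle_div_l; first lra.
case: (Rlt_le_dec t d) => h.
  have := hd t h => h1.
  have : k * pw b t <= k * e by apply: Rmult_le_compat_l; lra.
  have : 0 <= e * t by apply: Rmult_le_pos; lra.
  lra.
have h1 : pw b t <= 1 + bd by apply: Rle_trans (@pw_bound b t _ _) _; lra.
have h2 : k * pw b t <= k * (1 + bd) by apply: Rmult_le_compat_l; lra.
have h4 : d * e <= e * t by rewrite Rmult_comm; apply: Rmult_le_compat_l; lra.
have : 0 <= e * (k) by apply: Rmult_le_pos; lra.
lra.
Qed.

(** In [Tp_interpolation] applied to differences, boundedness makes the first term small by the
    choice of [e], and convergence of [T u_k] the second: the sequence is Cauchy. *)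
Lemma Tp_converges b (u : nat -> X) : 0 < b <= 1 -> (exists m, forall k, norm (u k) <= m) ->
  converges (fun k => invA hA (u k)) -> converges (fun k => Tp b (u k)).
Proof.
move=> hb [m hm] [y hy].
have m0 : 0 <= m by apply: Rle_trans (hm 0%N); apply: norm_ge_0.
apply/(@filterlim_locally_cauchy _ X eventually _) => eps; have e0 := cond_pos eps.
have he : 0 < eps / (4 * (m + 1)) by apply: Rdiv_lt_0_compat; lra.
have [c [c0 hc]] := Tp_interpolation hb he.
have nf := @norm_factor_gt_0 _ X.
have hd : 0 < eps / (4 * c * @norm_factor _ X).
  by apply: Rdiv_lt_0_compat => //; apply: Rmult_lt_0_compat; lra.
have [P [hP hPc]] := (@filterlim_locally_cauchy _ X eventually _ _).2 (ex_intro _ y hy) (mkposreal _ hd).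
exists P; split => // j k hj hk; apply: norm_compat1.
have hlin : invA hA (minus (u k) (u j)) = minus (invA hA (u k)) (invA hA (u j)).
  by rewrite /minus invA_plus !opp_scal invA_scal.
have h1 := @norm_compat2 _ X _ _ (mkposreal _ hd) (hPc j k hj hk).
rewrite -hlin /= in h1.
have e1 : @norm_factor _ X * (eps / (4 * c * @norm_factor _ X)) = eps / (4 * c) by field; split; lra.
rewrite e1 in h1.
have hT : minus (Tp b (u k)) (Tp b (u j)) = Tp b (minus (u k) (u j)).
  by rewrite /minus Tp_plus ?Tp_opp //; lra.
rewrite hT; apply: Rle_lt_trans (hc _) _.
have h2 : norm (minus (u k) (u j)) <= 2 * m.
  apply: Rle_trans (norm_triangle _ _) _; rewrite norm_opp; have := hm k; have := hm j; lra.
have h3 : eps / (4 * (m + 1)) * norm (minus (u k) (u j)) <= eps / (4 * (m + 1)) * (2 * m).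
  by apply: Rmult_le_compat_l; lra.
have h4 : eps / (4 * (m + 1)) * (2 * m) <= eps / 2.
  have -> : eps / (4 * (m + 1)) * (2 * m) = eps / 2 * (m / (m + 1)) by field; lra.
  rewrite -[X in _ <= X]Rmult_1_r; apply: Rmult_le_compat_l; first lra.
  by apply/Rle_div_l; lra.
have h5 := Rmult_lt_compat_l _ _ _ c0 h1.
have h6 : c * (eps / (4 * c)) = eps / 4 by field; lra.
apply: (Rle_lt_trans _ (eps / 2 + c * norm (invA hA (minus (u k) (u j))))); lra.
Qed.

Variable n : nat.
Hypothesis n1 : (1 < n)%N.
Local Notation Y := (phase_space hA n).
Local Notation L := (@Lambda X A hA n).
Local Notation power_inv := (@power_inv X A hA n n1).

Let n0 : (0 < n)%N. Proof. exact: ltnW. Qed.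

Lemma resolvent0 (p y : Y) : resolvent L (RtoC 0) p y <-> y = power_inv 1 (opp p).
Proof.
rewrite -Lambda_inv; split.
- move=> [a [b [[y' [-> ->]] [[w [hw ->]] ->]]]].
  suff -> : opp (plus (0 ** y) (-1 ** w)) = w by [].
  by rewrite rscal_0 plus_zero_l rscal_opp rscal_assoc (_ : -1 * -1 = 1) ?rscal_1 //; ring.
- move=> h; exists (0 ** y), (-1 ** opp p); split; first by exists y.
  split; first by exists (opp p).
  by rewrite rscal_0 plus_zero_l -rscal_opp opp_opp.
Qed.

Lemma resolvent0_linear : is_linear (fun p : Y => power_inv 1 (opp p)).
Proof.
apply: (@is_linear_comp _ _ _ _ opp (power_inv 1)); first exact: is_linear_opp.
by apply: power_inv_linear; lra.
Qed.

Lemma Lambda_resolvent0 : resolvent_set L (RtoC 0).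
Proof. exact: (bounded_op_graph resolvent0_linear resolvent0). Qed.

(** [Lambda^-1] is [T^(1/n)] in each flat coordinate composed with the constant matrix
    [cycpow (-1)]. Compactness passes from [T] to [T^(1/n)], and one subsequence serves all
    coordinates. *)
Lemma Lambda_compact_resolvent : compact_resolvent A -> compact_resolvent L.
Proof.
move=> /compact_resolvent_inv hc; exists (RtoC 0); split; first exact: Lambda_resolvent0.
exists (fun p : Y => power_inv 1 (opp p)); split; first exact: resolvent0_linear.
split; first by move=> x y; apply: resolvent0.
move=> v [m hm].
have hnn := INR_gt1 n1.
have hb : 0 < 1 / INR n <= 1.
  by split; [apply: Rdiv_lt_0_compat; lra | apply/Rle_div_l; lra].
(* [cyc] makes the family total in [i]; only [i < n] is used. *)
pose u (i : nat) k : X := flat (v k) (cyc n0 i).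
have hu i : exists b, forall k, norm (u i k) <= b.
  by exists m => k; apply: Rle_trans (norm_flat_le (v k) _) (hm k).
have [s [hs hcv]] := sequentially_compact_family n hc hu.
have hT (i : 'I_n) : exists y, filterlim (fun k => Tp (1 / INR n) (flat (v (s k)) i)) eventually (locally y).
  have := hcv i (ltn_ord i); rewrite /u.
  have -> : cyc n0 i = i by apply: val_inj => /=; apply: modn_small.
  move=> h; apply: (Tp_converges hb _ h).
  by exists m => k; apply: Rle_trans (norm_flat_le (v (s k)) _) (hm (s k)).
have [ys hys] := choice (fun (i : 'I_n) y => filterlim (fun k => Tp (1 / INR n) (flat (v (s k)) i)) eventually (locally y)) hT.
exists s, (unflat hA n1 (fun i => opp (cycpow (-1) ys i))); split => //.
have [c0 hM0] := @bounded_map_cycpow X n (-1).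
have [c [cpos hM]] : exists c, 0 < c /\ bounded_map (cycpow (X := X) (n := n) (-1)) c.
  exists (Rabs c0 + 1); split; first by have := Rabs_pos c0; lra.
  by apply: bounded_map_le hM0 _; have := Rle_abs c0; lra.
apply/filterlim_locally => eps; have e0 := cond_pos eps.
have nf := @norm_factor_gt_0 _ X.
have hd : 0 < eps / (2 * INR n * c * @norm_factor _ X).
  apply: Rdiv_lt_0_compat => //; apply: Rmult_lt_0_compat => //; apply: Rmult_lt_0_compat => //; lra.
have hall := eventually_forall (fun i => proj1 (filterlim_locally _ _) (hys i) (mkposreal _ hd)).
have [N hN] := hall; exists N => k /hN hk.
apply: (Rle_lt_trans _ (INR n * (c * (eps / (2 * INR n * c))))).
  apply: (norm_le_flat n1) => i.
  rewrite /minus flat_plus // flat_opp // !flat_unflat.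
  have -> : Tp (1 / INR n) (cycpow (- (1)) (flat (opp (v (s k)))) i) =
     opp (cycpow (-1) (fun j => Tp (1 / INR n) (flat (v (s k)) j)) i).
    rewrite (cycpow_map _ _ _ (Tp_linear hA (b := 1 / INR n) ltac:(lra))) -Tp_opp; last lra.
    congr (inv_power _ _ _); rewrite [RHS]rscal_opp -(bm_scal hM) (_ : - (1) = -1); last by ring.
    by apply: cycpow_fun => j; rewrite flat_opp // rscal_opp.
  rewrite opp_opp plus_comm.
  have -> : plus (cycpow (-1) ys i) (opp (cycpow (-1) (fun j => Tp (1 / INR n) (flat (v (s k)) j)) i)) =
     cycpow (-1) (fun j => plus (ys j) (opp (Tp (1 / INR n) (flat (v (s k)) j)))) i.
    rewrite (bm_plus hM); congr plus; rewrite rscal_opp -(bm_scal hM).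
    by apply: cycpow_fun => j; rewrite rscal_opp.
  apply: (bm_bound hM) => j; left.
  have := @norm_compat2 _ X _ _ (mkposreal _ hd) (hk j).
  rewrite -norm_opp opp_minus /minus /=.
  by rewrite (_ : @norm_factor _ X * (eps / (2 * INR n * c * @norm_factor _ X)) = eps / (2 * INR n * c)) //; field; repeat split; lra.
rewrite (_ : INR n * (c * (eps / (2 * INR n * c))) = eps / 2); [lra | field; split; lra].
Qed.
End Compactness.

Theorem theorem1p2 (X : Hilbert) (hX : separable X) (A : operator X)
    (hA : positive_selfadjoint A) (n : nat) (hn : (3 <= n)%N) :
  let L : operator (phase_space hA n) := @Lambda X A hA n in
  ( resolvent_set L (RtoC 0) /\
    (forall phi v, op_inv L phi v <->
       op_matrix (@Lambda_inv_entry X A n) (coord phi) (coord v)) /\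
    (forall phi v, op_inv L phi v <->
       (forall i j : 'I_n, nat_of_ord i = 0%N -> j.+1 = n ->
          op_inv A (coord phi j) (coord v i)) /\
       (forall i j : 'I_n, nat_of_ord i = j.+1 -> coord v i = opp (coord phi j))) /\
    (compact_resolvent A -> compact_resolvent L) ) /\
  ( positive_type L /\
    forall a : R, 0 < a < 1 ->
      bounded_op (neg_power L a) /\ injective_op (neg_power L a) /\
      forall v, dom L v ->
        (exists w, balakrishnan L a v w) /\
        (forall w, positive_power L a v w <-> balakrishnan L a v w) ) /\
  ( forall a : R, 0 <= a <= 1 ->
      (forall v, dom (positive_power L a) v <->
         forall i : 'I_n,
           dom (frac_power A ((a + INR n - INR i.+1) / INR n)) (coord v i)) /\
      (forall v w, positive_power L a v w <->
         op_matrix (Lambda_power_entry A a) (coord v) (coord w)) ).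
Proof.
have n1 : (1 < n)%N by apply: ltn_trans hn.
move=> L; split; [|split].
- split; first exact: Lambda_resolvent0.
  split; first by move=> p v; symmetry; apply: Lambda_inv_matrix.
  split; first by move=> p v; apply: Lambda_explicit.
  exact: Lambda_compact_resolvent.
- split; first exact: Lambda_positive_type.
  move=> a ha; split.
    apply: (bounded_op_graph (@power_inv_linear _ _ hA n n1 a _)) => [|x y]; first lra.
    exact: neg_powerE.
  split.
    move=> x x' y; rewrite !(neg_powerE n1) // => -> /power_inv_inj; apply; lra.
  move=> v [p hp]; split.
    by exists (power_inv n1 (1 - a) p); apply/(balakrishnanE n1 _ ha hp).
  move=> w; rewrite (balakrishnanE n1 w ha hp) (positive_powerE n1); last lra.
  (* Since [v = Lambda^-1 p = Lambda^-a (Lambda^-(1-a) p)], injectivity of [Lambda^-a] identifies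
     [Lambda^a v] with [Lambda^-(1-a) p], the value of Balakrishnan's formula. *)
  have -> : v = power_inv n1 a (power_inv n1 (1 - a) p).
    rewrite power_inv_comp; try lra.
    by rewrite (_ : a + (1 - a) = 1); [apply: (Lambda_inv n1 v p).1 | ring].
  by split=> [/power_inv_inj e|->] //; symmetry; apply: e; lra.
- move=> a ha.
  have e v w : positive_power L a v w <-> power_graph a v w.
    by rewrite (positive_powerE n1) // (power_invE n1).
  split=> [v|v w].
    rewrite -(power_graph_dom n1 v ha).
    by split=> -[w /e hw]; exists w => //; apply/e.
  by rewrite e; apply: power_graph_matrix.
Qed.
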